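(* Let $f\in M_o$, let $H$ be a $p$-periodic Herman ring of $f$, and let $h$ be the number of $H$-relevant poles. Then $p\geq \frac{h(h+1)}{2}$. In particular, the following are true. (1) If the basic nest of $H$ surrounds a pole of $f$, then $p\geq \frac{h(h+1)}{2}$. (2) If the basic nest of $H$ does not surround any pole of $f$, then $p\geq \frac{h(h+3)}{2}$.
   Context: $M$ is the class of general meromorphic functions: transcendental meromorphic functions $f:\mathbb{C}\to\widehat{\mathbb{C}}$ having either at least two poles or exactly one pole which is not an omitted value. A value $z_0\in\widehat{\mathbb{C}}$ is an omitted value of $f$ if $f(z)\neq z_0$ for all $z\in\mathbb{C}$; $O_f$ is the set of all omitted values of $f$ (for $f\in M$ it has at most two points and lies in $\mathbb{C}$). $M_o$ is the set of $f\in M$ with at least one omitted value. The Fatou set of $f$ is the set of points having a neighbourhood on which $\{f^n\}_{n>0}$ is well defined and normal (limit $\infty$ allowed); a Fatou component is a maximal connected subset of it. For a Fatou component $U$, $U_k$ denotes the Fatou component containing $f^k(U)$; $U$ is $p$-periodic if $p$ is the smallest natural number with $U_p=U$. A $p$-periodic Fatou component $H$ is a Herman ring if there are $r>1$, an analytic homeomorphism $\phi:H\to\{z:1<|z|<r\}$ and an irrational $\alpha$ with $\phi(f^p(\phi^{-1}(z)))=e^{i2\pi\alpha}z$ for all $1<|z|<r$. (Functions in $M_o$ are known to have no Herman ring of period $1$ or $2$, so $p>2$ is assumed throughout.) The cycle of $H$ is $\{H_0,H_1,\dots,H_{p-1}\}$ with $H=H_0=H_p$ (indices modulo $p$). ''Ring''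 means a Herman ring of this cycle. For a ring $H'$, $B(H')$ is the bounded component of the complement of $H'$. $H'$ surrounds a set $A$ (or a point $w$) if $A\subset B(H')$ (or $w\in B(H')$). A pole $w$ of $f$ is $H$-relevant if some ring $H_i$ of the cycle of $H$ surrounds $w$. A ring $H_j$ is ($H$-)outermost if no $H_i$ with $i\neq j$ surrounds $H_j$. Given an outermost ring $H_j$, the collection consisting of $H_j$ and all rings of the cycle surrounded by $H_j$ is called an $H$-maximal nest, or simply a nest. A nest surrounds a point or a set if its outermost ring does. The basic nest of $H$ is the nest surrounding $O_f$. *)

(* Defs.v *)
From HB Require Import structures.
From mathcomp Require Import all_boot all_order all_algebra.
From mathcomp Require Import all_classical all_reals all_analysis.
From mathcomp Require Import complex.

Set Implicit Arguments.
Unset Strict Implicit.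
Unset Printing Implicit Defensive.

Import Order.TTheory GRing.Theory Num.Theory.
Import numFieldNormedType.Exports.

Local Open Scope classical_set_scope.
Local Open Scope ring_scope.

(* R[i] seen as a numFieldType, so that it carries the topology, the norm and
   the (complex) derivative that the library attaches to such fields. *)
Definition Cplx (R : realType) : numFieldType := R[i].

(* The point at infinity is None; the finite points are the Some z. *)
Definition Csphere (R : realType) := one_point_compactification (Cplx R).

Section Complex.
Variable R : realType.
Local Notation C := (Cplx R).
Local Notation Chat := (Csphere R).

Definition cabs (z : C) : R := Normc.normc (z : R[i]).

Definition cexpi (t : R) : C := (cos t +i* sin t)%C.

Definition chordal (x y : Chat) : R :=
  match x, y with
  | Some z, Some w =>
      2 * cabs (z - w) /
        (Num.sqrt (1 + cabs z ^+ 2) * Num.sqrt (1 + cabs w ^+ 2))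
  | Some z, None | None, Some z => 2 / Num.sqrt (1 + cabs z ^+ 2)
  | None, None => 0
  end.

Definition holomorphic_on (A : set C) (g : C -> C) : Prop :=
  forall z, A z -> derivable g z 1.

Definition locally_uniform_cvg (U : set C) (g : nat -> C -> Chat)
    (l : C -> Chat) : Prop :=
  forall z, U z -> exists2 V, nbhs z V &
    forall e : R, 0 < e ->
      \forall n \near \oo, forall w, U w -> V w -> chordal (g n w) (l w) < e.

(* Convergence is for the chordal metric: the limit may take the value
   infinity, or be identically infinite. *)
Definition normal_family (U : set C) (F : set (C -> Chat)) : Prop :=
  forall g : nat -> C -> Chat, (forall n, F (g n)) ->
    exists (s : nat -> nat) (l : C -> Chat),
      {homo s : m n / (m < n)%N} /\
      locally_uniform_cvg U (fun n => g (s n)) l.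

(* A is a component of the complement of V in the plane. *)
Definition complement_component (V A : set C) : Prop :=
  exists2 z, ~ V z & A = connected_component (~` V) z.

(* For a Herman ring V exactly one component of the complement is bounded;
   it is the set B(V) of the literature. *)
Definition surrounds (V A : set C) : Prop :=
  exists B, [/\ complement_component V B, bounded_set B & A `<=` B].

Definition annulus (r : R) : set C := [set z | 1 < cabs z < r].

Definition analytic_homeomorphism (A B : set C) (phi psi : C -> C) : Prop :=
  [/\ forall z, A z -> B (phi z) /\ psi (phi z) = z,
      forall z, B z -> A (psi z) /\ phi (psi z) = z,
      holomorphic_on A phi &
      {within B, continuous psi}].

End Complex.

Section Meromorphic.
Variables (R : realType) (f : Cplx R -> Csphere R).
Local Notation C := (Cplx R).
Local Notation Chat := (Csphere R).

Definition is_pole (z : C) : Prop := f z = None.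

(* The finite part; the value 0 at the poles is a dummy. *)
Definition finite_part (z : C) : C := odflt 0 (f z).

(* f is holomorphic where it is finite, and its infinities are isolated
   singularities at which f tends to infinity. *)
Definition meromorphic : Prop := forall z : C,
  (~ is_pole z ->
     (\forall w \near z, ~ is_pole w) /\ derivable finite_part z 1) /\
  (is_pole z ->
     (\forall w \near z^', ~ is_pole w) /\ f @ z^' --> (None : Chat)).

Definition rational_map : Prop :=
  exists P Q : {poly C}, Q != 0 /\
    forall z, Q.[z] != 0 -> f z = Some (P.[z] / Q.[z]).

Definition transcendental_meromorphic : Prop := meromorphic /\ ~ rational_map.

Definition omitted : set Chat := [set v | forall z, f z <> v].

Definition class_M : Prop :=
  transcendental_meromorphic /\
  ((exists z w, [/\ z <> w, is_pole z & is_pole w]) \/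
   (exists z, [/\ is_pole z, forall w, is_pole w -> w = z
                & ~ omitted (Some z)])).

Definition class_Mo : Prop := class_M /\ omitted !=set0.

(* f is not defined at infinity; here infinity is made absorbing, so that
   fiter n is the n-th iterate wherever fiter_defined n holds. *)
Definition fextend (x : Chat) : Chat := if x is Some z then f z else None.

Definition fiter (n : nat) (z : C) : Chat := iter n fextend (Some z).

Definition fiter_defined (n : nat) (z : C) : Prop :=
  forall k, (k < n)%N -> fiter k z <> None.

Definition fatou_set : set C := [set z | exists U : set C,
  [/\ open_nbhs z U,
      forall n w, (0 < n)%N -> U w -> fiter_defined n w &
      normal_family U [set fiter n | n in [set n | (0 < n)%N]]]].

Definition fatou_component (U : set C) : Prop :=
  exists2 z, fatou_set z & U = connected_component fatou_set z.

(* U_k: the Fatou component containing the image of U under the k-th iterate *)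
Definition component_iter (U : set C) (k : nat) : set C :=
  xget set0 [set V | fatou_component V /\ fiter k @` U `<=` Some @` V].

Definition periodic_component (p : nat) (U : set C) : Prop :=
  [/\ fatou_component U, (0 < p)%N, component_iter U p = U &
      forall k, (0 < k < p)%N -> component_iter U k <> U].

Definition herman_ring (p : nat) (H : set C) : Prop :=
  periodic_component p H /\
  exists (r alpha : R) (phi psi : C -> C),
    [/\ 1 < r, irrational alpha,
        analytic_homeomorphism H (annulus r) phi psi &
        forall z, annulus r z ->
          omap phi (fiter p (psi z)) = Some (cexpi (2 * pi * alpha) * z)].

Section Nests.
Variables (p : nat) (H : set C).

Definition ring_cycle : set (set C) := [set component_iter H i | i in `I_p].

Definition relevant_pole : set C :=
  [set w | is_pole w /\ exists2 V, ring_cycle V & surrounds V [set w]].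

Definition outermost (V : set C) : Prop :=
  ring_cycle V /\ forall W, ring_cycle W -> W <> V -> ~ surrounds W V.

Definition nest_of (V : set C) : set (set C) :=
  [set W | ring_cycle W /\ (W = V \/ surrounds V W)].

Definition maximal_nest (N : set (set C)) : Prop :=
  exists2 V, outermost V & N = nest_of V.

Definition nest_surrounds (N : set (set C)) (A : set C) : Prop :=
  exists V, [/\ N V, outermost V & surrounds V A].

(* The omitted values of a map with a pole are all finite, so the preimage
   under Some is the whole set of omitted values, as a subset of the plane. *)
Definition basic_nest (N : set (set C)) : Prop :=
  maximal_nest N /\ nest_surrounds N (Some @^-1` omitted).

Definition nest_surrounds_pole (N : set (set C)) : Prop :=
  exists2 w, is_pole w & nest_surrounds N [set w].

End Nests.
End Meromorphic.

(* Main.v *)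
(* Let B be the hole of a ring V of the cycle, and W = f(V) the next ring; f maps
   V bijectively onto W.  By the maximum modulus principle the image of a filled
   collar B + (part of V) is open and closed off the image of its rim.  Hence, if
   B contains no pole, f sends B into the filled next ring, the hole of W contains
   no omitted value, and nested rings stay nested; if B contains a pole, all
   omitted values lie in the hole of W, and the pole is the only one in B: for an
   omitted value a, G = 1/(f - a) is holomorphic on the filled ring and injective
   near its rim, and the set of base points w at which the difference quotient
   (G(z) - G(w))/(z - w) stays away from 0 is open and closed.

   Given a relevant pole w_k in the hole of the ring i_k, go back along the cycle,
   for t_k steps, to the last ring that surrounds the omitted values.  These rings
   are nested, and stay so until a pole is met, so that equal t_k would put two
   poles into one hole; and the corresponding segments of the cycle, of length
   t_k + 1, are disjoint.  So p is at least the sum of h distinct positive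
   integers, all of them at least 2 when the basic nest surrounds no pole.

   The maximum modulus principle itself is reduced to squares: if |h| has a strict
   maximum at the centre of a square, then Cauchy's theorem on rectangles, applied
   to a quotient built from a high power of h, gives a contradiction. *)

(* All the plane topology rests on one fact: a bounded set that is both open and closed is empty.
   This replaces Jordan curves and winding numbers in showing that a ring has at most one hole and
   that the hole caps exactly one of its two ends. A ring is parametrised by a level function [tau]
   with values between 0 and 1, read off from the modulus on the round annulus; [f] maps each level
   of a ring to the same level of the next one. So the rim of a collar of the hole has its image in
   one known level, and a connected set avoiding that level lies in the image of the collar or
   misses it. Poles are never removed as singularities: 1/(f - a) is 0 and continuous there, and the
   maximum principle allows finitely many exceptional points. The number t_k exists because the ring
   after one with a pole surrounds the omitted values, and p - 1 steps back are one step forward. If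
   t_k = 0, the ring i_k surrounds both a pole and the omitted values, which is what case (2)
   forbids. Hence the two sums 1 + ... + h and 2 + ... + (h + 1). *)
Require Import Defs.
From HB Require Import structures.
From mathcomp Require Import all_boot all_order all_algebra.
From mathcomp Require Import all_classical all_reals all_analysis.
From mathcomp Require Import complex.
From mathcomp Require Import ring lra zify.

Set Implicit Arguments.
Unset Strict Implicit.
Unset Printing Implicit Defensive.

Import Order.TTheory GRing.Theory Num.Theory.
Import numFieldNormedType.Exports.

Local Open Scope classical_set_scope.
Local Open Scope ring_scope.

(** * The complex plane *)

Section Plane.
Variable R : realType.
Local Notation C := (Cplx R).
Implicit Types (z w : C) (e : R).

Lemma cabs0 : cabs (0 : C) = 0. Proof. exact: Normc.normc0. Qed.
Lemma cabs1 : cabs (1 : C) = 1. Proof. exact: Normc.normc1. Qed.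
Lemma cabsM z w : cabs (z * w) = cabs z * cabs w. Proof. exact: Normc.normcM. Qed.
Lemma cabsV z : cabs z^-1 = (cabs z)^-1. Proof. exact: Normc.normcV. Qed.
Lemma cabs_ge0 z : 0 <= cabs z. Proof. by case: z => a b; exact: sqrtr_ge0. Qed.
Lemma normr_cabs z : `|z| = ((cabs z)%:C)%C. Proof. by case: z. Qed.
Lemma cabsN z : cabs (- z) = cabs z.
Proof. by apply: (@complexI R); rewrite -!normr_cabs normrN. Qed.
Lemma cabsD z w : cabs (z + w) <= cabs z + cabs w.
Proof.
have := ler_normD (z : R[i]) w; rewrite !normr_cabs.
by rewrite -(rmorphD (@real_complex_def R (Phant R))) lecR.
Qed.
Lemma cabsB z w : cabs (z - w) = cabs (w - z).
Proof. by rewrite -cabsN opprB. Qed.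
Lemma cabs_eq0 z : (cabs z == 0) = (z == 0).
Proof.
apply/eqP/eqP => [/Normc.eq0_normc//|->]; exact: cabs0.
Qed.
Lemma cabs_gt0 z : (0 < cabs z) = (z != 0).
Proof. by rewrite lt_def cabs_ge0 andbT cabs_eq0. Qed.
Lemma cabsX z n : cabs (z ^+ n) = cabs z ^+ n.
Proof. by elim: n => [|n IH]; rewrite ?expr0 ?cabs1// !exprS cabsM IH. Qed.
Lemma cabs_Re z : `|complex.Re z| <= cabs z.
Proof.
case: z => a b /=; rewrite /cabs /= -sqrtr_sqr ler_sqrt ?lerDl ?sqr_ge0//.
by rewrite addr_ge0 ?sqr_ge0.
Qed.
Lemma cabs_Im z : `|complex.Im z| <= cabs z.
Proof.
case: z => a b /=; rewrite /cabs /= -sqrtr_sqr ler_sqrt ?lerDr ?sqr_ge0//.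
by rewrite addr_ge0 ?sqr_ge0.
Qed.
Lemma cabs_le_ReIm z : cabs z <= `|complex.Re z| + `|complex.Im z|.
Proof.
case: z => a b /=; rewrite /cabs /=.
rewrite -[leRHS]ger0_norm ?addr_ge0// -sqrtr_sqr ler_sqrt ?sqr_ge0//.
by rewrite sqrrD !real_normK ?num_real// lerD2r lerDl mulrn_wge0 ?mulr_ge0.
Qed.

(** Balls of a [numFieldType] have their radius in the field itself, here a complex number;
    positivity in [R[i]] forces it to be real. From here on only the real modulus [cabs] is used. *)
Lemma nbhs_cabs z (A : set C) :
  nbhs z A <-> exists2 e : R, 0 < e & forall w, cabs (w - z) < e -> A w.
Proof.
rewrite -nbhs_nbhs_norm; split => -[e e0 eA].
  move: e e0 eA => [a b]; rewrite /= ltcE /= => /andP[/eqP-> a0] eA.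
  exists a => // w wa; apply: eA => /=; rewrite /ball_ /= normr_cabs ltcR.
  by rewrite cabsB.
exists (e%:C)%C; first by rewrite /= ltcR.
by move=> w /=; rewrite /ball_ /= normr_cabs ltcR cabsB => /eA.
Qed.

Lemma nbhs_cdisk z e : 0 < e -> \forall w \near z, cabs (w - z) < e.
Proof. by move=> e0; apply/nbhs_cabs; exists e. Qed.

Lemma continuous_cabsP (T : topologicalType) (g : T -> C) (x : T) :
  {for x, continuous g} <->
  forall e, 0 < e -> \forall y \near x, cabs (g y - g x) < e.
Proof.
split=> [cg e e0|H].
  exact: (cg _ (nbhs_cdisk (g x) e0)).
move=> A /= /nbhs_cabs[e e0 eA]; have := H e e0; apply: filterS => y; exact: eA.
Qed.

Lemma continuous_cabs : continuous (@cabs R).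
Proof.
move=> z A /= /nbhs_ballP[e /= e0 eA].
apply: filterS (nbhs_cdisk z e0) => w wz; apply: eA.
rewrite /ball /= ltr_distlC ltrBlDr; apply/andP; split.
  have := cabsD w (z - w); rewrite addrC subrK cabsB; lra.
have := cabsD z (w - z); rewrite addrC subrK; lra.
Qed.

Lemma continuous_Re : continuous (@complex.Re R : C -> R).
Proof.
move=> z A /= /nbhs_ballP[e /= e0 eA].
apply: filterS (nbhs_cdisk z e0) => w wz; apply: eA.
rewrite /ball /= distrC; apply: le_lt_trans wz.
by have := cabs_Re (w - z); case: (w) => ? ?; case: (z).
Qed.

Lemma continuous_Im : continuous (@complex.Im R : C -> R).
Proof.
move=> z A /= /nbhs_ballP[e /= e0 eA].
apply: filterS (nbhs_cdisk z e0) => w wz; apply: eA.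
rewrite /ball /= distrC; apply: le_lt_trans wz.
by have := cabs_Im (w - z); case: (w) => ? ?; case: (z).
Qed.

Lemma continuous_pairC : continuous (fun x : R * R => Complex x.1 x.2 : C).
Proof.
move=> [a b]; apply/continuous_cabsP => e e0.
have h : 0 < e / 2 by rewrite divr_gt0.
near=> y; apply: le_lt_trans (cabs_le_ReIm _) _ => /=.
rewrite [e]splitr ltrD//; rewrite distrC; near: y.
  exact: (cvgr_dist_lt _ _ (@cvg_fst _ _ (nbhs a) (nbhs b) _) _ h).
exact: (cvgr_dist_lt _ _ (@cvg_snd _ _ (nbhs a) (nbhs b) _) _ h).
Unshelve. all: by end_near. Qed.

(** With a non-strict bound the base point w = z need not be excluded and no quotient appears, which
    is the form that the estimates below consume. *)
Lemma cderivableP (g : C -> C) z : derivable g z 1 <->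
  exists d : C, forall e, 0 < e ->
    \forall w \near z, cabs (g w - g z - d * (w - z)) <= e * cabs (w - z).
Proof.
split.
  move=> /cvg_ex[/= d gd]; exists d => e e0.
  have /nbhs_cabs[t t0 H] : nbhs (0 : C) [set h : C | h != 0 ->
      cabs (h^-1 * (g (h + z) - g z) - d) < e].
    have := gd _ (nbhs_cdisk d e0); rewrite /nbhs /= /dnbhs /within /=.
    by apply: filterS => h; rewrite /= scaler1.
  apply/nbhs_cabs; exists t => // w wt.
  have [->|wz] := eqVneq w z; first by rewrite !subrr mulr0 subrr cabs0 mulr0.
  have wz' : w - z != 0 by rewrite subr_eq0.
  have /= := H (w - z); rewrite subr0 subrK => /(_ wt wz') /ltW => K.
  have -> : g w - g z - d * (w - z) =
    ((w - z)^-1 * (g w - g z) - d) * (w - z).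
    by field.
  by rewrite cabsM ler_wpM2r ?cabs_ge0.
move=> [d H]; apply/cvg_ex; exists d => /= A /nbhs_cabs[e e0 eA].
have /nbhs_cabs[t t0 K] := H _ (divr_gt0 e0 (@ltr0n R 2)).
rewrite /nbhs /= /dnbhs /within /=; apply/nbhs_cabs; exists t => // h; rewrite subr0 => ht h0.
apply: eA; rewrite /= scaler1.
have := K (h + z); rewrite addrK => /(_ ht) {}K.
change (cabs (h^-1 * (g (h + z) - g z) - d) < e).
have -> : h^-1 * (g (h + z) - g z) - d = h^-1 * (g (h + z) - g z - d * h).
  by field.
have h0' : 0 < cabs h by rewrite cabs_gt0.
have K2 : cabs (g (h + z) - g z - d * h) < e * cabs h.
  apply: le_lt_trans K _.
  by rewrite ltr_pM2r// ltr_pdivrMr// ltr_pMr// ltr1n.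
by rewrite cabsM cabsV mulrC ltr_pdivrMr.
Qed.

Lemma cderivable_continuous (g : C -> C) z :
  derivable g z 1 -> {for z, continuous g}.
Proof. by move=> /derivable1_diffP /differentiable_continuous. Qed.

Lemma bounded_cabs (A : set C) :
  bounded_set A <-> exists M : R, forall z, A z -> cabs z <= M.
Proof.
split.
  case=> -[a b] [/= ab H]; exists (`|a| + 1) => z Az.
  have b0 : b = 0 by move: ab; rewrite complex_real => /eqP.
  have /(_ _ z Az) := H (((`|a| + 1)%:C)%C).
  rewrite b0 ltcR normr_cabs lecR; apply.
  by rewrite (le_lt_trans (ler_norm a))// ltrDl.
move=> [M HM]; exists ((M%:C)%C); split; first by rewrite complex_real.
move=> [a b]; rewrite ltcE /= => /andP[/eqP b0 Ma] z Az.
by rewrite /= normr_cabs b0 lecR (le_trans (HM _ Az))// ltW.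
Qed.

Lemma closed_cabsP (A : set C) : closed A <->
  forall z, (forall e, 0 < e -> exists2 w, A w & cabs (w - z) < e) -> A z.
Proof.
split=> H z.
  move=> K; apply: H => B /nbhs_cabs[e e0 eB].
  by have [w Aw wz] := K e e0; exists w; split => //; exact: eB.
move=> clz; apply: H => e e0.
by have [w [Aw wz]] := clz _ (nbhs_cdisk z e0); exists w.
Qed.

Lemma hausdorff_C : hausdorff_space C.
Proof. exact: norm_hausdorff. Qed.

(** A bounded set lies in the continuous image of a product of two real segments. *)
Lemma compactC (A : set C) : closed A -> bounded_set A -> compact A.
Proof.
move=> cA /bounded_cabs[M AM].
apply: (@subclosed_compact _ _
  ((fun x : R * R => Complex x.1 x.2 : C) @` (`[-M, M] `*` `[-M, M]))) => //.
  apply: continuous_compact.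
    by apply: continuous_subspaceT => x; exact: continuous_pairC.
  by apply: compact_setX; exact: segment_compact.
move=> z Az; exists (complex.Re z, complex.Im z); last by case: z {Az}.
have := AM _ Az; have := cabs_Re z; have := cabs_Im z.
rewrite /= !in_itv /= => h1 h2 h3.
by split => /=; rewrite -ler_norml; exact: le_trans h3.
Qed.

Lemma compact_boundedC (A : set C) : compact A ->
  exists M : R, forall z, A z -> cabs z <= M.
Proof.
move=> cA; have [->|/set0P A0] := eqVneq A set0; first by exists 0.
have := compact_EVT_max A0 cA (continuous_subspaceT (@continuous_cabs)).
move=> [c _ H]; exists (cabs c) => z Az; apply: H; exact/mem_set.
Qed.

Lemma compact_closedC (A : set C) : compact A -> closed A.
Proof. by apply: compact_closed; exact: hausdorff_C. Qed.

Lemma closed_leC (f : C -> R) (s : R) : continuous f -> closed [set z | f z <= s].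
Proof.
move=> cf; apply: (@preimage_closed _ _ f [set x : R | x <= s]).
  by move=> x _; exact: cf.
exact: closed_le.
Qed.
Lemma closed_geC (f : C -> R) (s : R) : continuous f -> closed [set z | s <= f z].
Proof.
move=> cf; apply: (@preimage_closed _ _ f [set x : R | s <= x]).
  by move=> x _; exact: cf.
exact: closed_ge.
Qed.
Lemma continuous_absRe (w : C) : continuous (fun z : C => `|complex.Re z - complex.Re w|).
Proof.
move=> z; apply: (continuous_comp (f := fun z : C => complex.Re z - complex.Re w)).
  by apply: continuousB; [exact: continuous_Re|exact: cst_continuous].
exact: norm_continuous.
Qed.
Lemma continuous_absIm (w : C) : continuous (fun z : C => `|complex.Im z - complex.Im w|).
Proof.
move=> z; apply: (continuous_comp (f := fun z : C => complex.Im z - complex.Im w)).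
  by apply: continuousB; [exact: continuous_Im|exact: cst_continuous].
exact: norm_continuous.
Qed.

(** The rules are restated for functions written pointwise, so that they unify with the explicit
    quotients used later. *)
Lemma cderM (f g : C -> C) z : derivable f z 1 -> derivable g z 1 ->
  derivable (fun x => f x * g x) z 1.
Proof. exact: derivableM. Qed.
Lemma cderD (f g : C -> C) z : derivable f z 1 -> derivable g z 1 ->
  derivable (fun x => f x + g x) z 1.
Proof. exact: derivableD. Qed.
Lemma cderB (f g : C -> C) z : derivable f z 1 -> derivable g z 1 ->
  derivable (fun x => f x - g x) z 1.
Proof. exact: derivableB. Qed.
Lemma cderV (f : C -> C) z : f z != 0 -> derivable f z 1 ->
  derivable (fun x => (f x)^-1) z 1.
Proof. exact: derivableV. Qed.
Lemma cder_cst (c z : C) : derivable (fun=> c) z 1.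
Proof. exact: derivable_cst. Qed.
Lemma cder_id z : derivable (fun x : C => x) z 1.
Proof. exact: derivable_id. Qed.
Lemma cderX (f : C -> C) n z : derivable f z 1 ->
  derivable (fun x => f x ^+ n) z 1.
Proof.
move=> df; elim: n => [|n IH]; first exact: cder_cst.
rewrite (_ : (fun x => _) = (fun x => f x * f x ^+ n)); first exact: cderM.
by apply/funext => x; rewrite exprS.
Qed.
Lemma near_cder (f g : C -> C) z : (\forall w \near z, f w = g w) ->
  derivable f z 1 -> derivable g z 1.
Proof. by move=> fg; apply: near_eq_derivable. Qed.

Lemma contM (T : topologicalType) (f g : T -> C) (z : T) : {for z, continuous f} ->
  {for z, continuous g} -> {for z, continuous (fun x => f x * g x)}.
Proof. exact: continuousM. Qed.
Lemma contB (T : topologicalType) (f g : T -> C) (z : T) : {for z, continuous f} ->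
  {for z, continuous g} -> {for z, continuous (fun x => f x - g x)}.
Proof. exact: continuousB. Qed.
Lemma contX (T : topologicalType) (f : T -> C) n (z : T) : {for z, continuous f} ->
  {for z, continuous (fun x => f x ^+ n)}.
Proof.
move=> cf; elim: n => [|n IH]; first exact: cst_continuous.
rewrite (_ : (fun x => _) = (fun x => f x * f x ^+ n)); first exact: contM.
by apply/funext => x; rewrite exprS.
Qed.
Lemma contV (T : topologicalType) (f : T -> C) (z : T) : f z != 0 ->
  {for z, continuous f} -> {for z, continuous (fun x => (f x)^-1)}.
Proof. exact: continuousV. Qed.
Lemma cont_cabs (T : topologicalType) (f : T -> C) (z : T) : {for z, continuous f} ->
  {for z, continuous (fun x => cabs (f x))}.
Proof. by move=> cf; apply: continuous_comp => //; exact: continuous_cabs. Qed.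

End Plane.

(** * Cauchy's theorem on rectangles *)

Section Goursat.
Variable R : realType.
Local Notation C := (Cplx R).
Local Notation mu := (@lebesgue_measure R).
Implicit Types (a b c d m M : R) (u v : R -> R).

Definition rint u a b : R := \int[mu]_(x in `[a, b]) u x.

Lemma rint_integrable u a b : {within `[a, b], continuous u} ->
  mu.-integrable `[a, b] (EFin \o u).
Proof. by move=> cu; apply: continuous_compact_integrable => //; exact: segment_compact. Qed.

Lemma rint_cst m a b : a <= b -> rint (fun=> m) a b = m * (b - a).
Proof.
move=> ab; rewrite /rint Rintegral_cst//= lebesgue_measure_itv/= lte_fin.
case: ltP => // ba; rewrite /= ?EFinN; congr (_ * _); lra.
Qed.

Lemma within_cst m a b : {within `[a, b], continuous (fun=> m : R)}.
Proof. by apply: continuous_subspaceT => x; exact: cst_continuous. Qed.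

Lemma rint_le u v a b :
  {within `[a, b], continuous u} -> {within `[a, b], continuous v} ->
  (forall x, a <= x <= b -> u x <= v x) -> rint u a b <= rint v a b.
Proof.
move=> cu cv uv; apply: le_Rintegral => //; exact: rint_integrable.
Qed.

(** The deviation is taken from a constant m because, for an integrand that is affine up to a small
    error, the difference of its values on two opposite sides of a rectangle is constant up to that
    error. *)
Lemma rint_near u m M a b : a <= b -> {within `[a, b], continuous u} ->
  (forall x, a <= x <= b -> `|u x - m| <= M) ->
  `|rint u a b - m * (b - a)| <= M * (b - a).
Proof.
move=> ab cu uM.
have h1 : rint u a b <= (m + M) * (b - a).
  rewrite -rint_cst//; apply: rint_le => //; first exact: within_cst.
  by move=> x /uM; rewrite ler_norml; lra.
have h2 : (m - M) * (b - a) <= rint u a b.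
  rewrite -rint_cst//; apply: rint_le => //; first exact: within_cst.
  by move=> x /uM; rewrite ler_norml; lra.
by rewrite ler_norml; apply/andP; split; lra.
Qed.

Lemma rint_split u a m b : a <= m -> m <= b -> {within `[a, b], continuous u} ->
  rint u a b = rint u a m + rint u m b.
Proof.
move=> am mb cu.
have := @Rintegral_itvB R u (BLeft a) (BRight b) m (rint_integrable cu).
rewrite !bnd_simp => /(_ am mb) /eqP; rewrite subr_eq => /eqP E.
rewrite /rint E addrC; congr (_ + _).
apply: Rintegral_itv_obnd_cbnd; apply: integrableS (rint_integrable cu) => //=.
by apply: subset_itvr; rewrite bnd_simp.
Qed.

Definition cpt (x y : R) : C := Complex x y.

Definition rect a b c d : set C :=
  [set z | a <= complex.Re z <= b /\ c <= complex.Im z <= d].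

(* The imaginary part of the integral of k dz along the boundary; the real part is never needed. *)
Definition bdint (k : C -> C) a b c d : R :=
  rint (fun x => complex.Im (k (cpt x c)) - complex.Im (k (cpt x d))) a b +
  rint (fun y => complex.Re (k (cpt b y)) - complex.Re (k (cpt a y))) c d.

Lemma cpt_contx (k : C -> C) x y : {for cpt x y, continuous k} ->
  {for x, continuous (fun x => k (cpt x y))}.
Proof.
move=> ck; apply: (continuous_comp (f := fun x => cpt x y)); last exact: ck.
apply/continuous_cabsP => e e0.
apply/nbhs_ballP; exists e => // t; rewrite /ball /= distrC => tx.
change (cabs (cpt t y - cpt x y) < e).
apply: le_lt_trans (cabs_le_ReIm _) _; rewrite /= subrr normr0 addr0.
exact: tx.
Qed.

Lemma cpt_conty (k : C -> C) x y : {for cpt x y, continuous k} ->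
  {for y, continuous (fun y => k (cpt x y))}.
Proof.
move=> ck; apply: (continuous_comp (f := fun y => cpt x y)); last exact: ck.
apply/continuous_cabsP => e e0.
apply/nbhs_ballP; exists e => // t; rewrite /ball /= distrC => tx.
change (cabs (cpt x t - cpt x y) < e).
apply: le_lt_trans (cabs_le_ReIm _) _; rewrite /= subrr normr0 add0r.
exact: tx.
Qed.

Lemma within_pointwise u a b : (forall x, a <= x <= b -> {for x, continuous u}) ->
  {within `[a, b], continuous u}.
Proof.
move=> cu; apply: continuous_in_subspaceT => x /set_mem /=; rewrite in_itv /=.
exact: cu.
Qed.

Section rectangles.
Variables (k : C -> C) (a b c d : R).
Hypothesis ck : forall z, rect a b c d z -> {for z, continuous k}.

Lemma bd_contx a' b' y1 y2 : a <= a' -> b' <= b -> c <= y1 <= d -> c <= y2 <= d ->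
  {within `[a', b'],
    continuous (fun x => complex.Im (k (cpt x y1)) - complex.Im (k (cpt x y2)))}.
Proof.
move=> aa bb y1cd y2cd; apply: within_pointwise => x xab; apply: continuousB.
  apply: (continuous_comp (f := fun x => k (cpt x y1))); last exact: continuous_Im.
  by apply: cpt_contx; apply: ck; split => //=; lra.
apply: (continuous_comp (f := fun x => k (cpt x y2))); last exact: continuous_Im.
by apply: cpt_contx; apply: ck; split => //=; lra.
Qed.

Lemma bd_conty c' d' x1 x2 : c <= c' -> d' <= d -> a <= x1 <= b -> a <= x2 <= b ->
  {within `[c', d'],
    continuous (fun y => complex.Re (k (cpt x1 y)) - complex.Re (k (cpt x2 y)))}.
Proof.
move=> aa bb y1cd y2cd; apply: within_pointwise => x xab; apply: continuousB.
  apply: (continuous_comp (f := fun x => k (cpt x1 x))); last exact: continuous_Re.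
  by apply: cpt_conty; apply: ck; split => //=; lra.
apply: (continuous_comp (f := fun x => k (cpt x2 x))); last exact: continuous_Re.
by apply: cpt_conty; apply: ck; split => //=; lra.
Qed.

Lemma rintD u v a' b' :
  {within `[a', b'], continuous u} -> {within `[a', b'], continuous v} ->
  rint (fun x => u x + v x) a' b' = rint u a' b' + rint v a' b'.
Proof. by move=> cu cv; apply: RintegralD => //; exact: rint_integrable. Qed.

Lemma bdint_splitx m : a <= m <= b -> c <= d ->
  bdint k a b c d = bdint k a m c d + bdint k m b c d.
Proof.
move=> /andP[am mb] cd; rewrite /bdint.
rewrite (rint_split am mb); last by apply: bd_contx; lra.
rewrite addrACA; congr (_ + _); rewrite -rintD; try by apply: bd_conty; lra.
by congr rint; apply/funext => y; lra.
Qed.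

Lemma bdint_splity m : c <= m <= d -> a <= b ->
  bdint k a b c d = bdint k a b c m + bdint k a b m d.
Proof.
move=> /andP[cm md] ab; rewrite /bdint.
rewrite [X in _ + X](rint_split cm md); last by apply: bd_conty; lra.
rewrite addrACA; congr (_ + _); rewrite -rintD; try by apply: bd_contx; lra.
by congr rint; apply/funext => y; lra.
Qed.

(** The linear part contributes -(d - c) Re D (b - a) on the horizontal sides and (b - a) Re D (d -
    c) on the vertical ones, and these cancel. The error of k is at most e s with s the half
    perimeter, so each integrand is off by at most 2 e s, over a total length s. *)
Lemma bdint_near (z0 D : C) (e : R) : a <= b -> c <= d -> rect a b c d z0 ->
  (forall z, rect a b c d z -> cabs (k z - k z0 - D * (z - z0)) <= e * cabs (z - z0)) ->
  `|bdint k a b c d| <= 2 * e * ((b - a) + (d - c)) ^+ 2.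
Proof.
move=> ab cd [z0x z0y] kD.
set s := (b - a) + (d - c).
(* The sign of e is read off from [kD] at a point other than z0; if there is no such point, the
   rectangle is a single point and s = 0. *)
have e0 z : rect a b c d z -> z != z0 -> 0 <= e.
  move=> rz zz0; have := le_trans (cabs_ge0 _) (kD z rz).
  by rewrite pmulr_lge0// cabs_gt0 subr_eq0.
have E z : rect a b c d z -> cabs (k z - k z0 - D * (z - z0)) <= e * s.
  move=> rz; have [->|zz0] := eqVneq z z0.
    rewrite !subrr mulr0 subrr cabs0.
    have [[z' rz' z'0]|H] := pselect (exists2 z', rect a b c d z' & z' != z0).
      by apply: mulr_ge0; [exact: e0 rz' z'0|rewrite /s; lra].
    suff -> : s = 0 by rewrite mulr0 lexx.
    have Hz z' : rect a b c d z' -> z' = z0.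
      by move=> rz'; apply/eqP/negPn/negP => z'0; apply: H; exists z'.
    have := Hz (cpt a c); have := Hz (cpt b d).
    rewrite /rect /= => h1 h2; rewrite -h2 in h1; last by lra.
    by have [] := h1 ltac:(lra); rewrite /s; lra.
  apply: le_trans (kD _ rz) _; rewrite ler_wpM2l ?(e0 _ rz)//.
  apply: le_trans (cabs_le_ReIm _) _; rewrite /s.
  case: z rz {zz0} => x y [/= rx ry]; case: z0 z0x z0y {kD e0} => x0 y0 /= h1 h2.
  by rewrite lerD// ler_norml; lra.
have h1 : `|rint (fun x => complex.Im (k (cpt x c)) - complex.Im (k (cpt x d))) a b
     - (- (d - c) * complex.Re D) * (b - a)| <= (2 * (e * s)) * (b - a).
  apply: rint_near => //; first by apply: bd_contx; lra.
  move=> x xab.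
  have r1 : rect a b c d (cpt x c) by split => //=; lra.
  have r2 : rect a b c d (cpt x d) by split => //=; lra.
  have := le_trans (cabs_Im _) (E _ r1); have := le_trans (cabs_Im _) (E _ r2).
  case: (k (cpt x c)) => p1 q1; case: (k (cpt x d)) => p2 q2.
  case: (k z0) => p0 q0; case: (D) => d1 d2; case: (z0) => x0 y0 /=.
  by rewrite !ler_norml; lra.
have h2 : `|rint (fun y => complex.Re (k (cpt b y)) - complex.Re (k (cpt a y))) c d
     - ((b - a) * complex.Re D) * (d - c)| <= (2 * (e * s)) * (d - c).
  apply: rint_near => //; first by apply: bd_conty; lra.
  move=> y ycd.
  have r1 : rect a b c d (cpt b y) by split => //=; lra.
  have r2 : rect a b c d (cpt a y) by split => //=; lra.
  have := le_trans (cabs_Re _) (E _ r1); have := le_trans (cabs_Re _) (E _ r2).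
  case: (k (cpt b y)) => p1 q1; case: (k (cpt a y)) => p2 q2.
  case: (k z0) => p0 q0; case: (D) => d1 d2; case: (z0) => x0 y0 /=.
  by rewrite !ler_norml; lra.
rewrite /bdint; move: h1 h2; rewrite !ler_norml.
by rewrite /s; nra.
Qed.

End rectangles.
End Goursat.

(** * Goursat's bisection, and a strict maximum at the centre of a square *)

Section SquareMax.
Variable R : realType.
Local Notation C := (Cplx R).
Implicit Types (a b c d : R).

(** The boundary integrals of the four quarters add up to the whole, so one of them carries at least
    a quarter of it. Sides are written w + w and h + h, so that bisecting involves no division. *)
Lemma bdint_quarter (k : C -> C) a c w h : 0 <= w -> 0 <= h ->
  (forall z, rect a (a + (w + w)) c (c + (h + h)) z -> {for z, continuous k}) ->
  exists a' c', [/\ a' = a \/ a' = a + w, c' = c \/ c' = c + h &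
    `|bdint k a (a + (w + w)) c (c + (h + h))| <=
    4 * `|bdint k a' (a' + w) c' (c' + h)| ].
Proof.
move=> w0 h0 ck; apply: contrapT => H.
have Q a' c' : a' = a \/ a' = a + w -> c' = c \/ c' = c + h ->
    4 * `|bdint k a' (a' + w) c' (c' + h)| <
    `|bdint k a (a + (w + w)) c (c + (h + h))|.
  by move=> ha hc; rewrite ltNge; apply/negP => K; apply: H; exists a', c'.
have E : bdint k a (a + (w + w)) c (c + (h + h)) =
    (bdint k a (a + w) c (c + h) + bdint k a (a + w) (c + h) (c + h + h)) +
    (bdint k (a + w) (a + w + w) c (c + h) +
     bdint k (a + w) (a + w + w) (c + h) (c + h + h)).
  have ew : a + (w + w) = a + w + w by rewrite addrA.
  have eh : c + (h + h) = c + h + h by rewrite addrA.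
  rewrite ew eh in ck *.
  rewrite (bdint_splitx ck (m := a + w)); [|lra|lra].
  congr (_ + _).
    by apply: bdint_splity; [move=> z [zx zy]; apply: ck; split| |]; lra.
  by apply: bdint_splity; [move=> z [zx zy]; apply: ck; split| |]; lra.
have := Q a c (or_introl erefl) (or_introl erefl).
have := Q a (c + h) (or_introl erefl) (or_intror erefl).
have := Q (a + w) c (or_intror erefl) (or_introl erefl).
have := Q (a + w) (c + h) (or_intror erefl) (or_intror erefl).
rewrite E.
set J1 := bdint k a _ c _; set J2 := bdint k a _ (c + h) _.
set J3 := bdint k (a + w) _ c _; set J4 := bdint k (a + w) _ (c + h) _.
have := ler_normD (J1 + J2) (J3 + J4).
have := ler_normD J1 J2; have := ler_normD J3 J4.
lra.
Qed.

Theorem goursat (k : C -> C) a b c d : a <= b -> c <= d ->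
  (forall z, rect a b c d z -> derivable k z 1) -> bdint k a b c d = 0.
Proof.
move=> ab cd dk.
have ck z : rect a b c d z -> {for z, continuous k}.
  by move=> /dk; exact: cderivable_continuous.
pose w n := (b - a) / 2 ^+ n; pose h n := (d - c) / 2 ^+ n.
have p2 n : 0 < (2 : R) ^+ n by rewrite exprn_gt0.
have wS n : w n = w n.+1 + w n.+1 by rewrite /w exprS; field; rewrite gt_eqF.
have hS n : h n = h n.+1 + h n.+1 by rewrite /h exprS; field; rewrite gt_eqF.
have w0 n : 0 <= w n by apply: divr_ge0; [rewrite subr_ge0|apply: ltW].
have h0 n : 0 <= h n by apply: divr_ge0; [rewrite subr_ge0|apply: ltW].
pose ok n (x : R * R) := [/\ a <= x.1, x.1 + w n <= b, c <= x.2, x.2 + h n <= d &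
   `|bdint k a b c d| <= 4 ^+ n * `|bdint k x.1 (x.1 + w n) x.2 (x.2 + h n)| ].
pose next n (x y : R * R) := [/\ x.1 <= y.1, y.1 + w n.+1 <= x.1 + w n,
   x.2 <= y.2 & y.2 + h n.+1 <= x.2 + h n].
(* The implication sits under the existential: the next corner is then defined for every pair, and
   the sequence [s] is a plain recursion, with [oks] proved afterwards. *)
have step n (x : R * R) : {y | ok n x -> ok n.+1 y /\ next n x y}.
  have [okx|] := pselect (ok n x); last by move=> nok; exists x.
  apply: cid; case: okx => h1 h2 h3 h4 h5.
  have [|a' [c' [ha hc hJ]]] := @bdint_quarter k x.1 x.2 _ _ (w0 n.+1) (h0 n.+1).
    by rewrite -wS -hS => z [zx zy]; apply: ck; split; lra.
  exists (a', c') => _; have := w0 n.+1; have := h0 n.+1.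
  have := wS n; have := hS n => e1 e2 e3 e4.
  have [g1 g2 g3 g4] : [/\ x.1 <= a', a' + w n.+1 <= x.1 + w n, x.2 <= c' &
      c' + h n.+1 <= x.2 + h n].
    clear -ha hc e1 e2 e3 e4; move: (w n) (w n.+1) (h n) (h n.+1) ha hc e1 e2 e3 e4.
    move=> w1 w2 h1 h2 ha hc e1 e2 e3 e4.
    by split; [case: ha => ->|case: ha => ->|case: hc => ->|case: hc => ->]; lra.
  split.
    split => /=; [exact: le_trans g1|exact: le_trans h2|exact: le_trans g3|exact: le_trans h4|].
    apply: le_trans h5 _; rewrite exprSr -mulrA ler_wpM2l ?exprn_ge0//.
    by rewrite -wS -hS in hJ.
  by split.
pose s := fix s n := if n is m.+1 then sval (step m (s m)) else (a, c).
have oks n : ok n (s n).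
  elim: n => [|n IH]; last by have [] := svalP (step n (s n)) IH.
  by rewrite /ok /= expr0 mul1r /w /h expr0 !divr1 !subrKC; split; rewrite ?lexx.
have nexts n : next n (s n) (s n.+1).
  by have [] := svalP (step n (s n)) (oks n).
have mono m n : (s m).1 <= (s (m + n)%N).1 /\ (s (m + n)%N).1 + w (m + n)%N <= (s m).1 + w m
   /\ (s m).2 <= (s (m + n)%N).2 /\ (s (m + n)%N).2 + h (m + n)%N <= (s m).2 + h m.
  elim: n => [|n IH]; first by rewrite addn0 !lexx.
  by rewrite addnS; have [] := nexts (m + n)%N; lra.
(* The rectangles of ranks m and n both contain the one of rank m + n, so every lower corner lies
   below every upper corner; the suprema of the lower corners give the common point [z0]. *)
have cross m n : (s m).1 <= (s n).1 + w n /\ (s m).2 <= (s n).2 + h n.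
  have /= := mono m n; have := mono n m; rewrite (addnC n m).
  have := w0 (m + n)%N; have := h0 (m + n)%N; lra.
pose X := range (fun n => (s n).1); pose Y := range (fun n => (s n).2).
have hX : has_sup X.
  split; first by exists (s 0%N).1; exists 0%N.
  by exists ((s 0%N).1 + w 0%N) => _ [n _ <-]; have [] := cross n 0%N.
have hY : has_sup Y.
  split; first by exists (s 0%N).2; exists 0%N.
  by exists ((s 0%N).2 + h 0%N) => _ [n _ <-]; have [] := cross n 0%N.
pose z0 : C := Complex (sup X) (sup Y).
have z0P n : rect (s n).1 ((s n).1 + w n) (s n).2 ((s n).2 + h n) z0.
  split => /=; apply/andP; split.
  - by apply: sup_upper_bound => //; exists n.
  - by apply: ge_sup; [exact: hX.1|move=> _ [m _ <-]; have [] := cross m n].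
  - by apply: sup_upper_bound => //; exists n.
  - by apply: ge_sup; [exact: hY.1|move=> _ [m _ <-]; have [] := cross m n].
have /dk /cderivableP[D HD] : rect a b c d z0.
  have [zx zy] := z0P 0%N; have [h1 h2 h3 h4 _] := oks 0%N.
  by split; lra.
set S := (b - a) + (d - c).
have S0 : 0 <= S by rewrite /S; lra.
apply/eqP; rewrite -normr_eq0; apply/eqP/le_anti; rewrite normr_ge0 andbT.
rewrite leNgt; apply/negP => J0.
(* At rank n the two scales cancel: 4^n * 2 e (S / 2^n)^2 = 2 e S^2, which is less than 4 e (S^2 +
   1), the modulus of the integral that it should dominate. *)
pose e := `|bdint k a b c d| / (4 * (S ^+ 2 + 1)).
have e0 : 0 < e by rewrite divr_gt0// mulr_gt0// ltr_wpDl// sqr_ge0.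
have /nbhs_cabs[t t0 Ht] := HD e e0.
have [n Hn] : exists n, S / 2 ^+ n < t.
  have := @cvg_geometric R S (2^-1); rewrite ger0_norm ?invr_ge0// invf_lt1// ltr1n => /(_ isT).
  move=> /cvgr_dist_lt => /(_ _ t0) [n _ /(_ n (leqnn n))] /=.
  rewrite sub0r normrN /geometric /= exprVn => H; exists n.
  exact: le_lt_trans (ler_norm _) H.
have [h1 h2 h3 h4 h5] := oks n.
have rz : rect (s n).1 ((s n).1 + w n) (s n).2 ((s n).2 + h n) `<=` rect a b c d.
  by move=> z [zx zy]; split; lra.
have := @bdint_near R k (s n).1 ((s n).1 + w n) (s n).2 ((s n).2 + h n) _ z0 D e _ _ (z0P n).
move=> /(_ (fun z rzz => ck z (rz z rzz))).
have -> : (s n).1 + w n - (s n).1 = w n by lra.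
have -> : (s n).2 + h n - (s n).2 = h n by lra.
have -> : w n + h n = S / 2 ^+ n by rewrite /w /h -mulrDl.
rewrite lerDl lerDl => /(_ (w0 n) (h0 n)) K.
have {}K : `|bdint k (s n).1 ((s n).1 + w n) (s n).2 ((s n).2 + h n)|
     <= 2 * e * (S / 2 ^+ n) ^+ 2.
  apply: K => z [zx zy]; apply: Ht; apply: le_lt_trans Hn.
  apply: le_trans (cabs_le_ReIm _) _; rewrite /S mulrDl.
  have [] := z0P n; move: zx zy; rewrite -/(w n) -/(h n).
  case: (z) => x y; case: (z0) => x0 y0 /= g1 g2 g3 g4.
  by rewrite lerD// ler_norml; lra.
have : `|bdint k a b c d| <= 4 ^+ n * (2 * e * (S / 2 ^+ n) ^+ 2).
  by apply: le_trans h5 _; rewrite ler_wpM2l ?exprn_ge0.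
have -> : 4 ^+ n * (2 * e * (S / 2 ^+ n) ^+ 2) = 2 * e * S ^+ 2.
  rewrite expr_div_n -exprM mulnC exprM (_ : 2 ^+ 2 = 4 :> R); last by rewrite -natrX.
  by field; rewrite expf_neq0.
rewrite leNgt => /negP; apply.
have -> : `|bdint k a b c d| = e * (4 * (S ^+ 2 + 1)).
  by rewrite /e; field; rewrite gt_eqF// ltr_wpDl// sqr_ge0.
have := sqr_ge0 S; nra.
Qed.

Lemma norm_le_cvg0 (x B : R) : (forall e, 0 < e -> e < 1 -> `|x| <= B * e) -> x = 0.
Proof.
move=> H; apply/eqP; rewrite -normr_eq0; apply/negPn/negP => x0.
have xp : 0 < `|x| by rewrite lt_def x0 normr_ge0.
have B1 : 0 < 2 * (`|B| + 1) by rewrite mulr_gt0// ltr_wpDl.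
have [x1 x2] : Num.min (1 / 2) (`|x| / (2 * (`|B| + 1))) <= 1 / 2 /\
    Num.min (1 / 2) (`|x| / (2 * (`|B| + 1))) <= `|x| / (2 * (`|B| + 1)).
  by rewrite !ge_min !lexx orbT.
have e0 : 0 < Num.min (1 / 2) (`|x| / (2 * (`|B| + 1))) by rewrite lt_min !divr_gt0.
have := H _ e0 ltac:(lra).
rewrite leNgt => /negP; apply.
move: (Num.min _ _) x1 x2 e0 => e _; rewrite ler_pdivlMr// => x2 e0.
have := ler_norm B; move: x2 xp e0 (normr_ge0 B).
move: `|x| `|B| => y b x2 xp e0 b0 Bb.
apply: (@le_lt_trans _ _ (b * e)); first by rewrite ler_wpM2r// ltW.
clear -x2 e0 xp b0; have : 0 <= b * e by rewrite mulr_ge0// ltW.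
move=> h; nra.
Qed.

(** With the derivative of g at w for [d0], the quotient is continuous at w. Differentiability at w
    is not claimed, and the arguments below treat w as an exceptional point. *)
Definition quot (g : C -> C) (w d0 z : C) : C :=
  if z == w then d0 else (g z - g w) / (z - w).

Lemma quot_mul (g : C -> C) (w d z : C) : g z = g w + (z - w) * quot g w d z.
Proof.
rewrite /quot; case: eqVneq => [->|zw]; first by rewrite subrr mul0r addr0.
by rewrite mulrC divfK ?subr_eq0// addrC subrK.
Qed.

Lemma quot_derivable (g : C -> C) (w d z : C) : z != w -> derivable g z 1 -> derivable (quot g w d) z 1.
Proof.
move=> zw dg; have zw0 : z - w != 0 by rewrite subr_eq0.
apply: (@near_cder _ (fun x => (g x - g w) * (x - w)^-1)).
- have zw1 : 0 < cabs (z - w) by rewrite cabs_gt0.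
  apply: filterS (nbhs_cdisk z zw1) => x; rewrite /quot; case: eqVneq => // ->.
  by rewrite cabsB ltxx.
- apply: cderM; first by apply: cderB; [exact: dg|exact: cder_cst].
  apply: (cderV (f := fun x => x - w)); first exact: zw0.
  by apply: cderB; [exact: cder_id|exact: cder_cst].
Qed.

Lemma quot_continuous (g : C -> C) (w d : C) :
  (forall e, 0 < e ->
     \forall x \near w, cabs (g x - g w - d * (x - w)) <= e * cabs (x - w)) ->
  {for w, continuous (quot g w d)}.
Proof.
move=> H; apply/continuous_cabsP => e e0.
have := H _ (divr_gt0 e0 (@ltr0n R 2)); apply: filterS => x.
rewrite {2}/quot eqxx /quot; case: eqVneq => [->|xw]; first by rewrite !subrr cabs0.
have xw0 : x - w != 0 by rewrite subr_eq0.
have -> : g x - g w - d * (x - w) = ((g x - g w) / (x - w) - d) * (x - w) by field.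
rewrite cabsM ler_pM2r ?cabs_gt0// => /le_lt_trans; apply.
by rewrite ltr_pdivrMr// ltr_pMr// ltr1n.
Qed.

Definition square (z0 : C) (s : R) : set C :=
  [set z | `|complex.Re z - complex.Re z0| <= s /\ `|complex.Im z - complex.Im z0| <= s].

Lemma squareE (z0 : C) s : square z0 s =
  rect (complex.Re z0 - s) (complex.Re z0 + s) (complex.Im z0 - s) (complex.Im z0 + s).
Proof.
by apply/seteqP; split => z; rewrite /square /rect /= !ler_norml => -[h1 h2]; split; lra.
Qed.

(* By Cauchy's theorem h/(z-z0) and 1/(z-z0) have the same boundary integral,
   and the imaginary part of the latter is bounded below. *)
Lemma square_max_half (h : C -> C) (z0 : C) (s m : R) : 0 < s -> h z0 = 1 ->
  (forall z, square z0 s z -> derivable h z 1) ->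
  (forall z, square z0 s z ->
    `|complex.Re z - complex.Re z0| = s \/ `|complex.Im z - complex.Im z0| = s ->
    cabs (h z) <= m) ->
  1 / 2 <= m.
Proof.
move=> s0 h1 dh hm; rewrite leNgt; apply/negP => m2.
have sz0 : square z0 s z0 by rewrite /square /= !subrr normr0 ltW.
have /cderivableP[D HD] := dh _ sz0.
pose k := quot h z0 D.
have ck z : square z0 s z -> {for z, continuous k}.
  move=> sz; have [->|zz0] := eqVneq z z0; first exact: quot_continuous.
  by apply/cderivable_continuous/quot_derivable => //; exact: dh.
have k0 : forall z, square z0 s z -> z != z0 -> derivable k z 1.
  by move=> z sz zz; apply: quot_derivable => //; exact: dh.
move: sz0 {HD}.
case: z0 h1 dh hm @k ck k0 => x0 y0 h1 dh hm k ck k0 _.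
(* At the centre k is only known to be continuous. Four cuts at distance e from the centre isolate a
   small square; Cauchy's theorem disposes of the other pieces, and the small square contributes
   O(e), since k is bounded near the centre. *)
have Jk : bdint k (x0 - s) (x0 + s) (y0 - s) (y0 + s) = 0.
  have [t t0 Ht] := (nbhs_cabs _ _).1 ((continuous_cabsP _ _).1
    (ck (Complex x0 y0) ltac:(by split; rewrite /= subrr normr0 ltW)) 1 ltr01).
  apply: (@norm_le_cvg0 _ ((4 * (cabs (k (Complex x0 y0)) + 1)) * (2 * Num.min s (t / 2)))).
  move=> e' e'0 e'1; pose e := e' * Num.min s (t / 2).
  have mi0 : 0 < Num.min s (t / 2) by rewrite lt_min s0 divr_gt0.
  have e0 : 0 < e by rewrite mulr_gt0.
  have : e < Num.min s (t / 2) by rewrite /e gtr_pMl.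
  rewrite lt_min => /andP[es et].
  have rS : rect (x0 - s) (x0 + s) (y0 - s) (y0 + s) = square (Complex x0 y0) s.
    by rewrite squareE.
  rewrite (bdint_splitx _ (m := x0 - e)); [|by rewrite rS|lra|lra].
  rewrite (@goursat _ (x0 - s)); [|lra|lra|]; last first.
    move=> z [zx zy]; apply: k0; first by rewrite -rS; split; lra.
    by apply/eqP => zE; move: zx; rewrite zE /=; lra.
  rewrite (bdint_splitx _ (m := x0 + e)); [| |lra|lra]; last first.
    by rewrite -rS in ck => z [zx zy]; apply: ck; split; lra.
  rewrite (@goursat _ (x0 + e)); [|lra|lra|]; last first.
    move=> z [zx zy]; apply: k0; first by rewrite -rS; split; lra.
    by apply/eqP => zE; move: zx; rewrite zE /=; lra.
  rewrite (bdint_splity _ (m := y0 - e)); [| |lra|lra]; last first.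
    by rewrite -rS in ck => z [zx zy]; apply: ck; split; lra.
  rewrite (@goursat _ _ _ (y0 - s)); [|lra|lra|]; last first.
    move=> z [zx zy]; apply: k0; first by rewrite -rS; split; lra.
    by apply/eqP => zE; move: zy; rewrite zE /=; lra.
  rewrite (bdint_splity _ (m := y0 + e)); [| |lra|lra]; last first.
    by rewrite -rS in ck => z [zx zy]; apply: ck; split; lra.
  rewrite (@goursat _ _ _ (y0 + e)); [|lra|lra|]; last first.
    move=> z [zx zy]; apply: k0; first by rewrite -rS; split; lra.
    by apply/eqP => zE; move: zy; rewrite zE /=; lra.
  rewrite !add0r !addr0.
  set K := cabs (k (Complex x0 y0)) + 1.
  have kK z : rect (x0 - e) (x0 + e) (y0 - e) (y0 + e) z -> cabs (k z) <= K.
    move=> [zx zy]; have := Ht z; rewrite /K.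
    have := cabsD (k z - k (Complex x0 y0)) (k (Complex x0 y0)); rewrite subrK.
    suff : cabs (z - Complex x0 y0) < t by move=> zt c1 /(_ zt); lra.
    apply: le_lt_trans (cabs_le_ReIm _) _; case: z zx zy => x y /= zx zy.
    apply: (@le_lt_trans _ _ (e + e)); last lra.
    by rewrite lerD// ler_norml; lra.
  have cks z : rect (x0 - e) (x0 + e) (y0 - e) (y0 + e) z -> {for z, continuous k}.
    by rewrite -rS in ck => -[zx zy]; apply: ck; split; lra.
  have n1 : `|rint (fun x => complex.Im (k (cpt x (y0 - e))) -
       complex.Im (k (cpt x (y0 + e)))) (x0 - e) (x0 + e) - 0 * (x0 + e - (x0 - e))|
      <= (2 * K) * (x0 + e - (x0 - e)).
    apply: rint_near; first lra.
      by apply: (bd_contx cks); lra.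
    move=> x xx.
    have := le_trans (cabs_Im _) (kK (cpt x (y0 - e)) ltac:(by split => /=; lra)).
    have := le_trans (cabs_Im _) (kK (cpt x (y0 + e)) ltac:(by split => /=; lra)).
    by rewrite !ler_norml; lra.
  have n2 : `|rint (fun x => complex.Re (k (cpt (x0 + e) x)) -
       complex.Re (k (cpt (x0 - e) x))) (y0 - e) (y0 + e) - 0 * (y0 + e - (y0 - e))|
      <= (2 * K) * (y0 + e - (y0 - e)).
    apply: rint_near; first lra.
      by apply: (bd_conty cks); lra.
    move=> x xx.
    have := le_trans (cabs_Re _) (kK (cpt (x0 - e) x) ltac:(by split => /=; lra)).
    have := le_trans (cabs_Re _) (kK (cpt (x0 + e) x) ltac:(by split => /=; lra)).
    by rewrite !ler_norml; lra.
  rewrite -mulrA -(mulrA 2) (mulrC _ e') -/e /bdint.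
  by move: n1 n2; rewrite !mul0r !subr0 !ler_norml; lra.
have rS : rect (x0 - s) (x0 + s) (y0 - s) (y0 + s) = square (Complex x0 y0) s.
  by rewrite squareE.
rewrite -rS in ck hm.
(* Since h is 1 at the centre, k + 1/(z - z0) = h/(z - z0), and |z - z0| is at least s on the
   boundary. *)
have est x y : rect (x0 - s) (x0 + s) (y0 - s) (y0 + s) (cpt x y) ->
    `|x - x0| = s \/ `|y - y0| = s ->
    cabs (k (cpt x y) + (cpt (x - x0) (y - y0))^-1) <= m / s.
  move=> rxy xys.
  have ss : s <= cabs (cpt (x - x0) (y - y0)).
    case: xys => <-; [exact: (cabs_Re (cpt (x - x0) (y - y0)))|exact: (cabs_Im (cpt (x - x0) (y - y0)))].
  have nz : cpt (x - x0) (y - y0) != 0 by rewrite -cabs_gt0; exact: lt_le_trans ss.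
  have E : cpt x y - Complex x0 y0 = cpt (x - x0) (y - y0) by [].
  rewrite /k /quot -subr_eq0 E (negbTE nz) h1.
  have -> : (h (cpt x y) - 1) / cpt (x - x0) (y - y0) + (cpt (x - x0) (y - y0))^-1
     = h (cpt x y) / cpt (x - x0) (y - y0) by field.
  have hc : cabs (h (cpt x y)) <= m by apply: hm.
  rewrite cabsM cabsV ler_pdivrMr ?(lt_le_trans s0)//.
  rewrite mulrAC ler_pdivlMr//; apply: ler_pM => //; [exact: cabs_ge0|exact: ltW].
(* The right-hand side is the modulus of the component of 1/(z - z0) that enters [bdint], at the
   point of a side with offset t from its middle. *)
have inv t : `|t| <= s -> 1 / (2 * s) <= s / (t ^+ 2 + s ^+ 2).
  move=> ts; have t2 : t ^+ 2 <= s ^+ 2 by rewrite -(real_normK (num_real t)) lerXn2r// ?nnegrE// ltW.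
  have ts0 : 0 < t ^+ 2 + s ^+ 2 by rewrite ltr_wpDl ?sqr_ge0// exprn_gt0.
  rewrite ler_pdivrMr ?mulr_gt0// mulrAC ler_pdivlMr// mul1r; nra.
(* M bounds the difference of k on two opposite sides: an error m/s on each, minus at least 1/(2s)
   on each. For m < 1/2 it is negative, so both integrals in [bdint] are, against [Jk]. *)
set M := 2 * (m / s - 1 / (2 * s)).
have M0 : M * (2 * s) < 0.
  have -> : M * (2 * s) = 4 * m - 2 by rewrite /M; field; rewrite gt_eqF.
  lra.
have b1 : rint (fun x => complex.Im (k (cpt x (y0 - s))) -
    complex.Im (k (cpt x (y0 + s)))) (x0 - s) (x0 + s) <= M * (2 * s).
  have -> : 2 * s = (x0 + s) - (x0 - s) by lra.
  rewrite -rint_cst; last lra.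
  apply: rint_le; [by apply: (bd_contx ck); lra|exact: within_cst|].
  move=> x xx.
  have r1 : rect (x0 - s) (x0 + s) (y0 - s) (y0 + s) (cpt x (y0 - s)) by split => /=; lra.
  have r2 : rect (x0 - s) (x0 + s) (y0 - s) (y0 + s) (cpt x (y0 + s)) by split => /=; lra.
  have e1 : `|y0 - s - y0| = s by rewrite addrC addKr normrN gtr0_norm.
  have e2 : `|y0 + s - y0| = s by rewrite addrC addKr gtr0_norm.
  have := le_trans (cabs_Im _) (est _ _ r1 (or_intror e1)).
  have := le_trans (cabs_Im _) (est _ _ r2 (or_intror e2)).
  have := inv (x - x0) ltac:(by rewrite ler_norml; lra).
  case: (k (cpt x (y0 - s))) => p q; case: (k (cpt x (y0 + s))) => p' q' /=.
  have -> : y0 - s - y0 = - s by lra.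
  have -> : y0 + s - y0 = s by lra.
  by rewrite !sqrrN !mulNr opprK !ler_norml /M; lra.
have b2 : rint (fun y => complex.Re (k (cpt (x0 + s) y)) -
    complex.Re (k (cpt (x0 - s) y))) (y0 - s) (y0 + s) <= M * (2 * s).
  have -> : 2 * s = (y0 + s) - (y0 - s) by lra.
  rewrite -rint_cst; last lra.
  apply: rint_le; [by apply: (bd_conty ck); lra|exact: within_cst|].
  move=> x xx.
  have r1 : rect (x0 - s) (x0 + s) (y0 - s) (y0 + s) (cpt (x0 - s) x) by split => /=; lra.
  have r2 : rect (x0 - s) (x0 + s) (y0 - s) (y0 + s) (cpt (x0 + s) x) by split => /=; lra.
  have e1 : `|x0 - s - x0| = s by rewrite addrC addKr normrN gtr0_norm.
  have e2 : `|x0 + s - x0| = s by rewrite addrC addKr gtr0_norm.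
  have := le_trans (cabs_Re _) (est _ _ r1 (or_introl e1)).
  have := le_trans (cabs_Re _) (est _ _ r2 (or_introl e2)).
  have := inv (x - y0) ltac:(by rewrite ler_norml; lra).
  case: (k (cpt (x0 - s) x)) => p q; case: (k (cpt (x0 + s) x)) => p' q' /=.
  have -> : x0 - s - x0 = - s by lra.
  have -> : x0 + s - x0 = s by lra.
  by rewrite !sqrrN mulNr (addrC (s ^+ 2)) !ler_norml /M; lra.
by move: Jk; rewrite /bdint; lra.
Qed.

(** If |h| were largest at z0 only, then by compactness h/h(z0) would have modulus at most some th <
    1 on the boundary. All its powers satisfy the hypotheses of [square_max_half], so th^n >= 1/2
    for every n, which is absurd: taking powers turns the crude constant 1/2 into a sharp
    statement. *)
Lemma square_max_strict (h : C -> C) (z0 : C) s : 0 < s ->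
  (forall z, square z0 s z -> derivable h z 1) ->
  exists2 z, square z0 s z /\ z != z0 & cabs (h z0) <= cabs (h z).
Proof.
move=> s0 dh; have [hz0|hz0] := eqVneq (h z0) 0.
  exists (z0 + Complex s 0); last by rewrite hz0 cabs0 cabs_ge0.
  split; last first.
    rewrite -subr_eq0 addrAC subrr add0r; apply/eqP => -[sE].
    by move: s0; rewrite sE ltxx.
  by rewrite /square; case: (z0) => x y /=; rewrite addrAC subrr add0r addr0 subrr normr0 (gtr0_norm s0) lexx ltW.
apply: contrapT => H.
pose bd : set C := square z0 s `&` [set z | s <= Num.max `|complex.Re z - complex.Re z0| `|complex.Im z - complex.Im z0| ].
have sqc : compact (square z0 s).
  apply: compactC.
    rewrite (_ : square z0 s =
      [set z | `|complex.Re z - complex.Re z0| <= s] `&` [set z | `|complex.Im z - complex.Im z0| <= s])//.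
    by apply: closedI; apply: closed_leC; [exact: continuous_absRe|exact: continuous_absIm].
  apply/bounded_cabs; exists (cabs z0 + (s + s)) => z [h1 h2].
  have := cabsD z0 (z - z0); rewrite addrC subrK => /le_trans; apply; rewrite lerD2l.
  apply: le_trans (cabs_le_ReIm _) _.
  by move: h1 h2; case: (z) => ? ?; case: (z0) => ? ? /= h1 h2; rewrite lerD.
have bdc : compact bd.
  apply: (subclosed_compact _ sqc); last by move=> z [].
  apply: closedI; first exact: (compact_closedC sqc).
  apply: closed_geC => z.
  apply: (@continuous_max R C (fun z => `|complex.Re z - complex.Re z0|)
    (fun z => `|complex.Im z - complex.Im z0|)).
    exact: continuous_absRe.
  exact: continuous_absIm.
have bd0 : bd !=set0.
  exists (z0 + Complex s 0); rewrite /bd /square.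
  case: (z0) => x y /=; rewrite addrAC subrr add0r addr0 subrr normr0 (gtr0_norm s0) lexx.
  by split; [split => //; exact: ltW|rewrite le_max lexx].
have [z1 /set_mem z1b z1max] : exists2 c, c \in bd & forall t, t \in bd -> cabs (h t) <= cabs (h c).
  apply: compact_EVT_max => //; apply: continuous_in_subspaceT => z /set_mem [sz _].
  apply: cont_cabs.
  exact/cderivable_continuous/dh.
have th1 : cabs (h z1) < cabs (h z0).
  rewrite ltNge; apply/negP => H2; apply: H; exists z1 => //; split; first exact: z1b.1.
  apply/eqP => z10; have [_] := z1b; rewrite z10 /= !subrr normr0 maxxx.
  by rewrite leNgt s0.
pose th := cabs (h z1) / cabs (h z0).
have hz0p : 0 < cabs (h z0) by rewrite cabs_gt0.
have thn n : 1 / 2 <= th ^+ n.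
  apply: (@square_max_half (fun z => (h z / h z0) ^+ n) z0 s _ s0).
  - by rewrite divff// expr1n.
  - by move=> z sz; apply: cderX; apply: cderM; [exact: dh|exact: cder_cst].
  - move=> z sz zs; rewrite cabsX cabsM cabsV lerXn2r// ?nnegrE ?divr_ge0 ?cabs_ge0//.
    rewrite ler_pM2r ?invr_gt0//; apply: z1max; apply/mem_set; split => //=.
    by rewrite le_max; case: zs => ->; rewrite lexx ?orbT.
have th01 : `|th| < 1 by rewrite ger0_norm ?divr_ge0 ?cabs_ge0// ltr_pdivrMr// mul1r.
have := cvg_expr th01 => /cvgr_dist_lt /(_ (1/2)).
rewrite divr_gt0// => /(_ isT)[n _ /(_ n (leqnn n))] /=.
rewrite sub0r normrN => K; have := le_lt_trans (ler_norm _) K.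
by rewrite ltNge thn.
Qed.

End SquareMax.

(** * The maximum modulus principle *)

Section MaxModulus.
Variable R : realType.
Local Notation C := (Cplx R).

Lemma cabs2 (z : C) : cabs z ^+ 2 = complex.Re z ^+ 2 + complex.Im z ^+ 2.
Proof.
by case: z => a b; rewrite /cabs /= sqr_sqrtr// addr_ge0 ?sqr_ge0.
Qed.

(* The holomorphic function h(z) = g(z) conj(g(z0)) + e (z conj(z0) + 1) has a
   strict maximum of its modulus at a maximum point z0 of |g|^2 + e(|z|^2 + 1) *)
Lemma lagrange_strict (e : R) (g z g0 z0 : C) : 0 < e -> z != z0 ->
  cabs g ^+ 2 + e * (cabs z ^+ 2 + 1) <= cabs g0 ^+ 2 + e * (cabs z0 ^+ 2 + 1) ->
  cabs (g * conjc g0 + (e%:C)%C * (z * conjc z0 + 1)) <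
  cabs (g0 * conjc g0 + (e%:C)%C * (z0 * conjc z0 + 1)).
Proof.
move=> e0 zz0 le.
rewrite -(ltr_pXn2r (n := 2))// ?nnegrE ?cabs_ge0//.
set P := _ + _ in le; set P0 := _ + _ in le.
have E0 : cabs (g0 * conjc g0 + (e%:C)%C * (z0 * conjc z0 + 1)) ^+ 2 = P0 ^+ 2.
  rewrite /P0 !cabs2; case: (g0) => a b; case: (z0) => x y /=; ring.
(* Lagrange's identity for the vectors (g, sqrt(e) z, sqrt(e)) and (g0, sqrt(e) z0, sqrt(e)), whose
   squared norms are P and P0: the squared inner product is P P0 minus the squared 2x2 minors. The
   last minor makes the inequality strict. *)
have EP : cabs (g * conjc g0 + (e%:C)%C * (z * conjc z0 + 1)) ^+ 2 =
   P * P0 - (e * cabs (g * z0 - z * g0) ^+ 2 + e * cabs (g - g0) ^+ 2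
             + e ^+ 2 * cabs (z - z0) ^+ 2).
  rewrite /P /P0 !cabs2; case: (g0) => a b; case: (z0) => x y.
  case: (g) => c d; case: (z) => u v /=; ring.
have P00 : 0 <= P0.
  by apply: addr_ge0; [exact: sqr_ge0|apply: mulr_ge0; [exact: ltW|apply: addr_ge0; [exact: sqr_ge0|exact: ler01]]].
have q1 : 0 < e ^+ 2 * cabs (z - z0) ^+ 2.
  by rewrite mulr_gt0// exprn_gt0// cabs_gt0 subr_eq0.
have q2 : 0 <= e * cabs (g * z0 - z * g0) ^+ 2 by rewrite mulr_ge0 ?sqr_ge0// ltW.
have q3 : 0 <= e * cabs (g - g0) ^+ 2 by rewrite mulr_ge0 ?sqr_ge0// ltW.
rewrite E0 EP; nra.
Qed.

Lemma square_sub (z0 : C) (A : set C) : nbhs z0 A ->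
  exists2 s : R, 0 < s & square z0 s `<=` A.
Proof.
move=> /nbhs_cabs[e e0 eA]; exists (e / 4); first by rewrite divr_gt0.
move=> z [h1 h2]; apply: eA; apply: le_lt_trans (cabs_le_ReIm _) _.
move: h1 h2; case: z => x y; case: z0 => x0 y0 /= h1 h2.
apply: (@le_lt_trans _ _ (e / 4 + e / 4)); first exact: lerD.
lra.
Qed.

(** Differentiability is asked off the zeros of g only, so that 1/(f - v), which vanishes at the
    poles of f, qualifies. A maximum of |g| need not be strict; perturbing |g|^2 by e(|z|^2 + 1)
    makes the function of [lagrange_strict] peak strictly at a point where still |g| > M. *)
Theorem max_modulus_nonzero (K O : set C) (g : C -> C) (M : R) :
  compact K -> open O -> O `<=` K -> 0 <= M ->
  (forall z, K z -> {for z, continuous g}) ->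
  (forall z, O z -> g z != 0 -> derivable g z 1) ->
  (forall z, K z -> ~ O z -> cabs (g z) <= M) ->
  forall z, K z -> cabs (g z) <= M.
Proof.
move=> cK oO OK M0 cg dg gM z1 Kz1; rewrite leNgt; apply/negP => z1M.
have cgK : {within K, continuous (fun z => cabs (g z))}.
  apply: continuous_in_subspaceT => z /set_mem Kz.
  by apply: cont_cabs; exact: cg.
have [zm /set_mem Kzm zmax] := compact_EVT_max (ex_intro _ z1 Kz1) cK cgK.
set A := cabs (g zm) in zmax.
have MA : M < A by apply: lt_le_trans z1M (zmax _ _); exact/mem_set.
have [B KB] := compact_boundedC cK.
have B0 : 0 <= B by apply: le_trans (KB _ Kz1); exact: cabs_ge0.
have D0 : 0 < B ^+ 2 + 1 by rewrite ltr_wpDl// sqr_ge0.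
(* With this e, a point of K where |g| <= M has [Phi] at most M^2 + e(B^2 + 1) = A^2, less than
   [Phi zm]; so the maximum of [Phi] is not attained there. *)
pose e := (A ^+ 2 - M ^+ 2) / (B ^+ 2 + 1).
have e0 : 0 < e.
  by rewrite divr_gt0// subr_gt0 ltrXn2r ?nnegrE// (le_trans M0)// ltW.
pose Phi z := cabs (g z) ^+ 2 + e * (cabs z ^+ 2 + 1).
have [z0 /set_mem Kz0 z0max] : exists2 c, c \in K & forall t, t \in K -> Phi t <= Phi c.
  apply: compact_EVT_max => //; first by exists z1.
  apply: continuous_in_subspaceT => z /set_mem Kz.
  have sq (u : C -> R) : {for z, continuous u} -> {for z, continuous (fun z => u z ^+ 2)}.
    by move=> cu; apply: (continuousM cu cu).
  have c1 : {for z, continuous (fun z => cabs (g z))} by apply: cont_cabs; exact: cg.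
  have c2 : {for z, continuous (fun z : C => cabs z ^+ 2)} by apply: sq; exact: continuous_cabs.
  have c3 : {for z, continuous (fun z : C => cabs z ^+ 2 + 1)}.
    exact: (continuousD c2 (@cst_continuous _ _ (1 : R) z)).
  have c4 : {for z, continuous (fun z : C => e * (cabs z ^+ 2 + 1))}.
    exact: (continuousM (@cst_continuous _ _ e z) c3).
  exact: (continuousD (sq _ c1) c4).
have gz0 : M < cabs (g z0).
  rewrite ltNge; apply/negP => H; have := z0max _ (mem_set Kzm).
  rewrite /Phi -/A leNgt => /negP; apply.
  have h1 : cabs (g z0) ^+ 2 <= M ^+ 2 by rewrite lerXn2r// nnegrE cabs_ge0.
  have h2 : cabs z0 ^+ 2 <= B ^+ 2 by rewrite lerXn2r// ?nnegrE ?cabs_ge0// KB.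
  have h3 : 0 <= cabs zm ^+ 2 by rewrite sqr_ge0.
  have h4 : e * (B ^+ 2 + 1) = A ^+ 2 - M ^+ 2 by rewrite /e divfK// gt_eqF.
  nra.
have gz00 : g z0 != 0 by rewrite -cabs_gt0 (le_lt_trans M0).
have Oz0 : O z0.
  by apply: contrapT => nO; have := gM _ Kz0 nO; rewrite leNgt gz0.
have [s s0 sO] : exists2 s : R, 0 < s & square z0 s `<=` O `&` [set z | g z != 0].
  apply: square_sub; apply: filterI; first exact: open_nbhs_nbhs.
  have gp : 0 < cabs (g z0) by rewrite cabs_gt0.
  have := (continuous_cabsP _ _).1 (cg _ Kz0) _ gp; apply: filterS => z /=.
  by apply: contraTN => /eqP ->; rewrite sub0r cabsN ltxx.
pose h z := g z * conjc (g z0) + (e%:C)%C * (z * conjc z0 + 1).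
have [z [sz zz0]] : exists2 z, square z0 s z /\ z != z0 & cabs (h z0) <= cabs (h z).
  apply: square_max_strict; first exact: s0.
  move=> z /sO[Oz gz].
  apply: cderD; first by apply: cderM; [exact: dg|exact: cder_cst].
  apply: cderM; first exact: cder_cst.
  apply: cderD; last exact: cder_cst.
  by apply: cderM; [exact: cder_id|exact: cder_cst].
rewrite leNgt lagrange_strict//; apply: z0max; apply/mem_set/OK.
by have [] := sO _ sz.
Qed.

Definition rootprod (S : seq C) (z : C) : C := \prod_(w <- S) (z - w).

Lemma rootprod_derivable S z : derivable (rootprod S) z 1.
Proof.
elim: S => [|w S IH].
  rewrite (_ : rootprod [::] = cst 1); first exact: cder_cst.
  by apply/funext => x; rewrite /rootprod big_nil.
rewrite (_ : rootprod (w :: S) = (fun x => (x - w) * rootprod S x)); last first.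
  by apply/funext => x; rewrite /rootprod big_cons.
apply: cderM; last exact: IH.
by apply: cderB; [exact: cder_id|exact: cder_cst].
Qed.

Lemma rootprod_eq0 S z : (rootprod S z == 0) = (z \in S).
Proof.
rewrite /rootprod; elim: S => [|w S IH]; first by rewrite big_nil oner_eq0.
by rewrite big_cons mulf_eq0 IH inE subr_eq0.
Qed.

(* Apply the previous bound to the functions g^n P, where P vanishes on S, and
   let n tend to infinity. *)
Theorem max_modulus (K O : set C) (S : seq C) (g : C -> C) (M B : R) :
  compact K -> open O -> O `<=` K -> 0 <= M -> (forall z, z \in S -> O z) ->
  (forall z, K z -> z \notin S -> {for z, continuous g}) ->
  (forall z, O z -> z \notin S -> g z != 0 -> derivable g z 1) ->
  (forall z, K z -> z \notin S -> cabs (g z) <= B) ->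
  (forall z, K z -> ~ O z -> cabs (g z) <= M) ->
  forall z, K z -> z \notin S -> cabs (g z) <= M.
Proof.
move=> cK oO OK M0 SO cg dg gB gM z Kz zS; rewrite leNgt; apply/negP => zM.
have cP w : {for w, continuous (rootprod S)}.
  exact/cderivable_continuous/rootprod_derivable.
have [D HD] : exists D : R, forall w, K w -> cabs (rootprod S w) <= D.
  have cPK : {within K, continuous (fun z => cabs (rootprod S z))}.
    apply: continuous_subspaceT => w.
    by apply: cont_cabs; exact: cP.
  have [c _ H] := compact_EVT_max (ex_intro _ z Kz) cK cPK.
  by exists (cabs (rootprod S c)) => w Kw; apply: H; exact/mem_set.
have D0 : 0 <= D by apply: le_trans (HD _ Kz); exact: cabs_ge0.
(* The product is continuous on S because g is bounded by B and the polynomial vanishes there. The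
   exponent is positive so that the product is nonzero only where g is. *)
have key n : cabs (g z) ^+ n.+1 * cabs (rootprod S z) <= M ^+ n.+1 * D.
  rewrite -cabsX -cabsM.
  apply: (@max_modulus_nonzero K O (fun z => g z ^+ n.+1 * rootprod S z) _ cK oO OK).
  - by rewrite mulr_ge0// exprn_ge0.
  - move=> w Kw; have [wS|wS] := boolP (w \in S); last first.
      by apply: contM; [apply: contX; exact: cg|exact: cP].
    apply/continuous_cabsP => e e0.
    have /eqP Pw : rootprod S w == 0 by rewrite rootprod_eq0.
    have B1 : 0 < B ^+ n.+1 + 1.
      rewrite ltr_wpDl// exprn_ge0//; exact: le_trans (cabs_ge0 _) (gB _ Kz zS).
    have e1 : 0 < e / (B ^+ n.+1 + 1) by rewrite divr_gt0.
    have := (continuous_cabsP _ _).1 (cP w) _ e1.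
    have : nbhs w O by apply: open_nbhs_nbhs; split => //; exact: SO.
    apply: filterS2 => x Ox; rewrite Pw mulr0 !subr0 => Px.
    have [xS|xS] := boolP (x \in S).
      by rewrite (eqP (_ : rootprod S x == 0)) ?rootprod_eq0// mulr0 cabs0.
    rewrite cabsM cabsX.
    have gx : cabs (g x) ^+ n.+1 <= B ^+ n.+1.
      have := gB _ (OK _ Ox) xS; have := cabs_ge0 (g x) => h1 h2.
      by rewrite lerXn2r// ?nnegrE//; exact: le_trans h2.
    move: Px; rewrite ltr_pdivlMr// => Px.
    have := cabs_ge0 (rootprod S x); nra.
  - move=> w Ow; rewrite mulf_eq0 negb_or expf_eq0 /= rootprod_eq0 => /andP[gw wS].
    by apply: cderM; [apply: cderX; exact: dg|exact: rootprod_derivable].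
  - move=> w Kw Ow; rewrite cabsM cabsX; apply: ler_pM.
    + by rewrite exprn_ge0 ?cabs_ge0.
    + exact: cabs_ge0.
    + by rewrite lerXn2r// ?nnegrE ?cabs_ge0//; exact: gM.
    + exact: HD.
  - exact: Kz.
have gz0 : 0 < cabs (g z) by exact: le_lt_trans zM.
have P0 : 0 < cabs (rootprod S z) by rewrite cabs_gt0 rootprod_eq0.
pose t := M / cabs (g z).
have t01 : `|t| < 1 by rewrite ger0_norm ?divr_ge0 ?cabs_ge0// ltr_pdivrMr// mul1r.
have q0 : 0 < cabs (rootprod S z) / (D + 1) by rewrite divr_gt0// ltr_wpDl.
have := cvg_expr t01 => /cvgr_dist_lt /(_ _ q0)[n _ /(_ n.+1 (leqnSn n))] /=.
rewrite sub0r normrN => H; have {H} := le_lt_trans (ler_norm _) H.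
rewrite /t expr_div_n ltr_pdivrMr ?exprn_gt0// mulrAC ltr_pdivlMr ?ltr_wpDl//.
have := key n; rewrite mulrC.
have Mn : 0 <= M ^+ n.+1 by rewrite exprn_ge0.
move=> h1 h2; nra.
Qed.

End MaxModulus.

(** * Images under a meromorphic function *)

Section Meromorphic.
Variable R : realType.
Local Notation C := (Cplx R).
Local Notation Chat := (Csphere R).

Definition disk (z : C) (e : R) : set C := [set w | cabs (w - z) < e].
Definition cdisk (z : C) (e : R) : set C := [set w | cabs (w - z) <= e].

Lemma continuous_cabsB (z : C) : continuous (fun w : C => cabs (w - z)).
Proof.
move=> w; apply: (@cont_cabs _ _ (fun w => w - z) w).
exact: (@contB _ _ (fun w => w) (fun=> z) w cvg_id (@cst_continuous _ _ z w)).
Qed.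

Lemma cdisk_closed z e : closed (cdisk z e).
Proof. exact/closed_leC/continuous_cabsB. Qed.

Lemma cdisk_compact z e : compact (cdisk z e).
Proof.
apply: compactC; first exact: cdisk_closed.
apply/bounded_cabs; exists (e + cabs z) => w wz.
by have := cabsD (w - z) z; rewrite subrK => /le_trans; apply; rewrite lerD2r.
Qed.

Lemma disk_open z e : open (disk z e).
Proof.
rewrite openE => w wz; apply/nbhs_cabs; exists (e - cabs (w - z)).
  by rewrite subr_gt0.
move=> x xw; have := cabsD (x - w) (w - z).
by rewrite addrA subrK => /le_lt_trans; apply; rewrite -ltrBrDr.
Qed.

Lemma disk_center z (e : R) : 0 < e -> disk z e z.
Proof. by move=> e0; rewrite /disk /= subrr cabs0. Qed.

Lemma compact_cont_bound (K : set C) (F : C -> C) : compact K ->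
  (forall z, K z -> {for z, continuous F}) ->
  exists2 D : R, 0 < D & forall z, K z -> cabs (F z) <= D.
Proof.
move=> cK cF; have [->|/set0P K0] := eqVneq K set0; first by exists 1.
have cFK : {within K, continuous (fun z => cabs (F z))}.
  apply: continuous_in_subspaceT => z /set_mem Kz.
  by apply: cont_cabs; exact: cF.
have [c _ H] := compact_EVT_max K0 cK cFK.
exists (cabs (F c) + 1); first by rewrite ltr_wpDl// cabs_ge0.
by move=> z Kz; apply: le_trans (H _ (mem_set Kz)) _; rewrite lerDl.
Qed.

Variable f : C -> Chat.
Hypothesis merof : meromorphic f.

Lemma nonpole_derivable z : ~ is_pole f z -> derivable (finite_part f) z 1.
Proof. by move=> /(merof z).1[]. Qed.

Lemma near_nonpole z : ~ is_pole f z -> \forall w \near z, ~ is_pole f w.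
Proof. by move=> /(merof z).1[]. Qed.

Lemma finite_partE z v : f z = Some v -> finite_part f z = v.
Proof. by rewrite /finite_part => ->. Qed.

Lemma nonpoleE z : ~ is_pole f z -> f z = Some (finite_part f z).
Proof. by rewrite /is_pole /finite_part; case: (f z). Qed.

Lemma pole_near z : is_pole f z -> \forall w \near z, w != z -> ~ is_pole f w.
Proof.
by move=> /(merof z).2[H _]; move: H; rewrite /nbhs /= /dnbhs /within /=.
Qed.

Lemma pole_infty z (M : R) : is_pole f z ->
  \forall w \near z, w != z -> M < cabs (finite_part f w).
Proof.
move=> pz; have [H fz] := (merof z).2 pz.
(* Basic neighbourhoods of infinity in the one-point compactification are complements of closed
   compact sets. *)
have Nn : nbhs (None : Chat) ((Some @` (~` cdisk 0 M)) `|` [set None]).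
  by exists (cdisk 0 M) => //; split; [exact: cdisk_compact|exact: cdisk_closed].
have := fz _ Nn; rewrite /nbhs /= /dnbhs /within /=.
have := pole_near pz; apply: filterS2 => w pw Hw wz.
have [[v /= vM fw]|fw] := Hw wz; last by have := pw wz fw.
rewrite (finite_partE (esym fw)) ltNge; apply/negP => vM'; apply: vM.
by rewrite /cdisk /= subr0.
Qed.

(* The meromorphic function 1/(f - v): the value 0 at the poles of f is not a dummy. *)
Definition finv (v z : C) : C := if f z is Some u then (u - v)^-1 else 0.

Lemma finv_nonpole v z : ~ is_pole f z -> finv v z = (finite_part f z - v)^-1.
Proof. by rewrite /is_pole /finv /finite_part; case: (f z). Qed.

Lemma finv_pole v z : is_pole f z -> finv v z = 0.
Proof. by rewrite /is_pole /finv => ->. Qed.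

Lemma finv_derivable v z : ~ is_pole f z -> f z <> Some v -> derivable (finv v) z 1.
Proof.
move=> pz fz; apply: (@near_cder _ (fun w => (finite_part f w - v)^-1)).
  by have := near_nonpole pz; apply: filterS => w /(finv_nonpole v) ->.
apply: (@cderV _ (fun w => finite_part f w - v)).
  by apply/eqP => /subr0_eq E; apply: fz; rewrite (nonpoleE pz) E.
by apply: cderB; [exact: nonpole_derivable|exact: cder_cst].
Qed.

Lemma finv_continuous v z : f z <> Some v -> {for z, continuous (finv v)}.
Proof.
move=> fz; have [pz|pz] := pselect (is_pole f z); last first.
  exact/cderivable_continuous/finv_derivable.
apply/continuous_cabsP => e e0; rewrite (finv_pole v pz).
have := pole_infty (cabs v + e^-1) pz; have := pole_near pz.
apply: filterS2 => w pw Hw; rewrite subr0.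
have [->|wz] := eqVneq w z; first by rewrite (finv_pole v pz) cabs0.
have := Hw wz; rewrite (finv_nonpole _ (pw wz)) cabsV => {}Hw.
have h : e^-1 < cabs (finite_part f w - v).
  by have := cabsD (finite_part f w - v) v; rewrite subrK; lra.
have ei : 0 < e^-1 by rewrite invr_gt0.
by rewrite -[e]invrK ltf_pV2 ?posrE//; exact: lt_trans h.
Qed.

Lemma finv_derivable_neq0 v z : f z <> Some v -> finv v z != 0 ->
  derivable (finv v) z 1.
Proof.
move=> fz nz; apply: finv_derivable => // pz.
by rewrite (finv_pole v pz) eqxx in nz.
Qed.

Lemma finv_Some v z u : f z = Some u -> finv v z = (u - v)^-1.
Proof. by rewrite /finv => ->. Qed.

Definition fimage (K : set C) : set C := [set v | exists2 z, K z & f z = Some v].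

(** If v is not a value on K, then 1/(f - v) is continuous on K, poles included, hence bounded by
    some D; the finite values of f on K stay at distance 1/D from v. *)
Lemma fimage_closed K : compact K -> closed (fimage K).
Proof.
move=> cK; apply/closed_cabsP => v H; apply: contrapT => vK.
have fv z : K z -> f z <> Some v by move=> Kz fz; apply: vK; exists z.
have [D D0 HD] := compact_cont_bound cK (fun z Kz => finv_continuous (fv z Kz)).
have [|w [z Kz fz] wv] := H D^-1; first by rewrite invr_gt0.
have := HD _ Kz; rewrite (finv_Some _ fz) cabsV leNgt => /negP; apply.
rewrite -[ltLHS]invrK ltf_pV2// ?posrE ?invr_gt0// cabs_gt0 subr_eq0.
by apply/eqP => wE; apply: (fv z Kz); rewrite fz wE.
Qed.

(** On the rim |f - v| >= 1/D. If a value v' within 1/(2D) of v were missed on K, then 1/(f - v')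
    would be at most 2D on the rim, hence on K by the maximum principle, whereas at z0 it is 1/|v -
    v'| > 2D. *)
Lemma fimage_nbhs (K O : set C) z0 v : compact K -> open O -> O `<=` K ->
  O z0 -> f z0 = Some v -> (forall z, K z -> ~ O z -> f z <> Some v) ->
  nbhs v (fimage K).
Proof.
move=> cK oO OK Oz0 fz0 fbd.
have cKO : compact (K `\` O).
  apply: (subclosed_compact _ cK); last by move=> z [].
  by apply: closedI; [exact: compact_closedC|exact: open_closedC].
have [D D0 HD] := compact_cont_bound cKO (fun z Kz => finv_continuous (fbd z Kz.1 Kz.2)).
apply/nbhs_cabs; exists (2 * D)^-1; first by rewrite invr_gt0 mulr_gt0.
move=> v' v'v; apply: contrapT => nv'.
have fv z : K z -> f z <> Some v' by move=> Kz fz; apply: nv'; exists z.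
have := @max_modulus_nonzero R K O (finv v') (2 * D) cK oO OK.
have D2 : 0 < 2 * D by rewrite mulr_gt0.
move=> /(_ (ltW D2) (fun z Kz => finv_continuous (fv z Kz))).
move=> /(_ (fun z Oz => finv_derivable_neq0 (fv z (OK z Oz)))) H.
have := H _ z0 (OK _ Oz0); rewrite (finv_Some _ fz0) cabsV => {}H.
have vv' : 0 < cabs (v - v').
  by rewrite cabs_gt0 subr_eq0; apply/eqP => E; apply: (fv z0 (OK _ Oz0)); rewrite -E.
suff : (cabs (v - v'))^-1 <= 2 * D.
  rewrite leNgt => /negP; apply.
  by rewrite -[ltLHS]invrK ltf_pV2// ?posrE ?invr_gt0// cabsB.
apply: H => z Kz Oz.
have [pz|pz] := pselect (is_pole f z); first by rewrite (finv_pole _ pz) cabs0 ltW.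
have := HD z (conj Kz Oz); rewrite !finv_nonpole// !cabsV => HDz.
have u0 : 0 < cabs (finite_part f z - v).
  rewrite cabs_gt0 subr_eq0; apply/eqP => E.
  by apply: (fbd z Kz Oz); rewrite (nonpoleE pz) E.
have u1 : D^-1 <= cabs (finite_part f z - v).
  by rewrite -[leRHS]invrK lef_pV2// ?posrE ?invr_gt0.
have u2 := cabsD (finite_part f z - v') (v' - v); rewrite addrA subrK in u2.
have E2 : D^-1 = (2 * D)^-1 + (2 * D)^-1 by field; rewrite gt_eqF.
have u3 : (2 * D)^-1 <= cabs (finite_part f z - v') by lra.
have p3 : 0 < (2 * D)^-1 by rewrite invr_gt0.
by rewrite -[leRHS]invrK lef_pV2// posrE; exact: lt_le_trans u3.
Qed.

(* The image of O is open and closed in the complement of the image of its boundary. *)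
Lemma fimage_connected (K O X : set C) : compact K -> open O -> O `<=` K ->
  connected X -> (forall z v, K z -> ~ O z -> X v -> f z <> Some v) ->
  X `&` fimage O !=set0 -> X `<=` fimage O.
Proof.
move=> cK oO OK cX bdX X0.
have E : X `&` fimage O = X `&` fimage K.
  apply/seteqP; split => v [Xv [z Kz fz]]; split => //; exists z => //; first exact: OK.
  by apply: contrapT => Oz; exact: (bdX z v).
suff -> : X = X `&` fimage O by move=> v [].
apply/esym/cX => //; last by exists (fimage K) => //; exact: fimage_closed.
exists ((fimage K)°); first exact: open_interior.
rewrite E; apply/seteqP; split => v [Xv Hv]; split => //; last exact: interior_subset.
have [z Oz fz] : fimage O v by have [] : (X `&` fimage O) v by rewrite E.
by apply: (fimage_nbhs cK oO OK Oz fz) => z' Kz' Oz'; exact: bdX.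
Qed.

Lemma fimage_open_isolated z0 v (U : set C) : f z0 = Some v -> nbhs z0 U ->
  (\forall z \near z0, z != z0 -> f z <> Some v) -> nbhs v (fimage U).
Proof.
move=> fz0 /nbhs_cabs[e1 e10 He1] /nbhs_cabs[e2 e20 He2].
pose e := Num.min e1 e2 / 2.
have e0 : 0 < e by rewrite divr_gt0// lt_min e10.
have [ee1 ee2] : e < e1 /\ e < e2.
  have m0 : 0 < Num.min e1 e2 by rewrite lt_min e10.
  have : Num.min e1 e2 <= e1 by rewrite ge_min lexx.
  have : Num.min e1 e2 <= e2 by rewrite ge_min lexx orbT.
  by rewrite /e; lra.
have DK : disk z0 e `<=` cdisk z0 e by move=> z /ltW.
have H := fimage_nbhs (@cdisk_compact z0 e) (@disk_open z0 e) DK (disk_center z0 e0) fz0.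
have {H} : nbhs v (fimage (cdisk z0 e)).
  apply: H => z Kz Oz; apply: He2; first exact: le_lt_trans ee2.
  by apply/eqP => zE; apply: Oz; rewrite zE; exact: disk_center.
apply: filterS => u [z Kz fz]; exists z => //; apply: He1.
exact: le_lt_trans ee1.
Qed.

End Meromorphic.

(** * The identity theorem *)

Section Identity.
Variable R : realType.
Local Notation C := (Cplx R).

Lemma rootprod_cons (w : C) S z : rootprod (w :: S) z = (z - w) * rootprod S z.
Proof. by rewrite /rootprod big_cons. Qed.

Lemma rootprod_ge (S : seq C) (z : C) (r : R) : 0 <= r ->
  (forall w, w \in S -> r <= cabs (z - w)) -> r ^+ size S <= cabs (rootprod S z).
Proof.
move=> r0; elim: S => [|w S IH] H; first by rewrite /rootprod big_nil cabs1 expr0.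
rewrite rootprod_cons cabsM exprS; apply: ler_pM => //.
- by rewrite exprn_ge0.
- by apply: H; rewrite inE eqxx.
- by apply: IH => x xS; apply: H; rewrite inE xS orbT.
Qed.

Lemma rootprod_le (S : seq C) (z : C) (r : R) : 0 <= r ->
  (forall w, w \in S -> cabs (z - w) <= r) -> cabs (rootprod S z) <= r ^+ size S.
Proof.
move=> r0; elim: S => [|w S IH] H; first by rewrite /rootprod big_nil cabs1 expr0.
rewrite rootprod_cons cabsM exprS; apply: ler_pM; try exact: cabs_ge0.
- by apply: H; rewrite inE eqxx.
- by apply: IH => x xS; apply: H; rewrite inE xS orbT.
Qed.

(** Each step divides out a zero w of h closer to x than all the earlier ones; the product of the
    earlier factors does not vanish at w, so the current q does. The new quotient is continuous
    everywhere and holomorphic off the list of zeros, which suffices for [max_modulus]. *)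
Lemma divide_zeros (h : C -> C) (x : C) (r : R) : 0 < r ->
  (forall z, disk x r z -> derivable h z 1) ->
  (forall e : R, 0 < e -> exists z, [/\ z != x, cabs (z - x) < e & h z = 0]) ->
  forall n, exists (S : seq C) (q : C -> C),
    [/\ size S = n, forall z, h z = rootprod S z * q z,
        forall z, z \in S -> z != x /\ cabs (z - x) < r / 8,
        forall z, disk x r z -> {for z, continuous q} &
        forall z, disk x r z -> z \notin S -> derivable q z 1].
Proof.
move=> r0 dh acc; elim=> [|n [S [q [szS hS Sx cq dq]]]].
  exists [::], h; split; first by [].
  - by move=> z; rewrite /rootprod big_nil mul1r.
  - by [].
  - by move=> z /dh /cderivable_continuous.
  - by move=> z /dh.
have [e e0 eS] : exists2 e : R, 0 < e & forall s, s \in S -> e <= cabs (s - x).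
  elim: S {szS hS cq dq} Sx => [|s S IH] Sx; first by exists 1.
  have [|e e0 eS] := IH; first by move=> z zS; apply: Sx; rewrite inE zS orbT.
  have [sx _] := Sx s (mem_head _ _).
  have sx0 : 0 < cabs (s - x) by rewrite cabs_gt0 subr_eq0.
  exists (Num.min e (cabs (s - x))); first by rewrite lt_min e0.
  move=> z; rewrite inE => /orP[/eqP ->|/eS ez]; first by rewrite ge_min lexx orbT.
  by rewrite ge_min ez.
have [|w [wx we hw]] := acc (Num.min e (r / 8)).
  by rewrite lt_min e0 divr_gt0.
move: we; rewrite lt_min => /andP[we wr].
have wS : w \notin S by apply/negP => /eS; rewrite leNgt we.
have wD : disk x r w by rewrite /disk /=; apply: lt_trans wr _; lra.
have qw : q w = 0.
  move: (hS w); rewrite hw => /esym/eqP; rewrite mulf_eq0 rootprod_eq0 (negbTE wS) /=.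
  by move/eqP.
have [d Hd] := (cderivableP _ _).1 (dq w wD wS).
exists (w :: S), (quot q w d); split.
- by rewrite /= szS.
- by move=> z; rewrite hS rootprod_cons (quot_mul q w d z) qw add0r; ring.
- by move=> z; rewrite inE => /orP[/eqP -> //|/Sx].
- move=> z zD; have [->|zw] := eqVneq z w; first exact: quot_continuous.
  have [zS|zS] := boolP (z \in S); last first.
    have D := @quot_derivable R q w d z zw (dq z zD zS).
    exact: cderivable_continuous D.
  have zw0 : z - w != 0 by rewrite subr_eq0.
  have zw1 : 0 < cabs (z - w) by rewrite cabs_gt0.
  apply/continuous_cabsP => e' e'0.
  have c1 : {for z, continuous (fun y => (q y - q w) * (y - w)^-1)}.
    apply: contM; first exact: (contB (cq z zD) (@cst_continuous _ _ (q w) z)).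
    exact: (contV (f := fun y => y - w) zw0 (contB cvg_id (@cst_continuous _ _ w z))).
  have := (continuous_cabsP _ _).1 c1 _ e'0; apply: filterS2 (nbhs_cdisk z zw1) => y yz.
  rewrite /quot (negbTE zw); case: eqVneq => // yw.
  by move: yz; rewrite yw cabsB ltxx.
- move=> z zD; rewrite inE negb_or => /andP[zw zS].
  exact: (@quot_derivable R q w d z zw (dq z zD zS)).
Qed.

(** Power series are avoided. With n zeros within t/4 of x divided out, where t = r/2, the maximum
    principle on |z - x| <= t gives |q| <= M/(3t/4)^n, while the product of the n factors is at most
    (t/2)^n for |z - x| < t/4. So |h| <= M (2/3)^n for all n. *)
Theorem identity_theorem (h : C -> C) (x : C) (r : R) : 0 < r ->
  (forall z, disk x r z -> derivable h z 1) ->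
  (forall e : R, 0 < e -> exists z, [/\ z != x, cabs (z - x) < e & h z = 0]) ->
  \forall z \near x, h z = 0.
Proof.
move=> r0 dh acc; pose t := r / 2.
have t0 : 0 < t by rewrite divr_gt0.
have tr z : cdisk x t z -> disk x r z.
  by rewrite /cdisk /disk /= => /le_lt_trans; apply; rewrite /t; lra.
have ch z : cdisk x t z -> {for z, continuous h}.
  by move=> /tr /dh /cderivable_continuous.
have [M M0 HM] := compact_cont_bound (@cdisk_compact _ x t) ch.
apply/nbhs_cabs; exists (t / 4); first by rewrite divr_gt0.
move=> z zt.
have Kz : cdisk x t z by rewrite /cdisk /=; apply/ltW/(lt_le_trans zt); lra.
suff key n : cabs (h z) <= M * (2 / 3) ^+ n.
  apply/eqP; rewrite -cabs_eq0 eq_le cabs_ge0 andbT leNgt; apply/negP => hz0.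
  have q01 : `|2 / 3 : R| < 1 by rewrite ger0_norm; lra.
  have := cvg_expr q01 => /cvgr_dist_lt /(_ _ (divr_gt0 hz0 M0))[n _ /(_ n (leqnn n))] /=.
  rewrite sub0r normrN => H; have {H} := le_lt_trans (ler_norm _) H.
  by rewrite ltr_pdivlMr// mulrC ltNge key.
have [S [q [szS hS Sx cq dq]]] := divide_zeros r0 dh acc n.
have [zS|zS] := boolP (z \in S).
  have : rootprod S z == 0 by rewrite rootprod_eq0.
  by move=> /eqP Pz; rewrite hS Pz mul0r cabs0 mulr_ge0 ?ltW// exprn_ge0//; lra.
have cqK w : cdisk x t w -> {for w, continuous q} by move=> /tr /cq.
have [B B0 HB] := compact_cont_bound (@cdisk_compact _ x t) cqK.
have DK : disk x t `<=` cdisk x t by move=> w /ltW.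
have u0 : 0 < 3 * t / 4 by lra.
have N0 : 0 <= M / (3 * t / 4) ^+ n by rewrite divr_ge0 ?exprn_ge0// ltW.
have rt : r / 8 = t / 4 by rewrite /t; field.
have SD w : w \in S -> disk x t w.
  by move=> /Sx[_ wr]; apply: lt_trans wr _; rewrite rt; lra.
have qz : cabs (q z) <= M / (3 * t / 4) ^+ n.
  apply: (max_modulus (@cdisk_compact _ x t) (@disk_open _ x t) DK N0 SD
    (fun w Kw _ => cqK w Kw) (fun w Dw wS _ => dq w (tr w (DK w Dw)) wS)
    (fun w Kw _ => HB w Kw) _ Kz zS).
  move=> w Kw Dw.
  have wx : t <= cabs (w - x) by rewrite leNgt; apply/negP.
  have Pw : (3 * t / 4) ^+ n <= cabs (rootprod S w).
    rewrite -szS; apply: rootprod_ge; first exact: ltW.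
    move=> s /Sx[_]; rewrite rt => sx.
    have := cabsD (w - s) (s - x); rewrite addrA subrK.
    by move: (cabs (w - s)) (cabs (s - x)) (cabs (w - x)) sx wx => ? ? ?; lra.
  have hw := HM w Kw; rewrite hS cabsM in hw.
  have P0 : 0 < (3 * t / 4) ^+ n by rewrite exprn_gt0.
  by rewrite ler_pdivlMr//; apply: le_trans hw; rewrite mulrC ler_wpM2r// cabs_ge0.
rewrite hS cabsM.
have Pz : cabs (rootprod S z) <= (t / 2) ^+ n.
  rewrite -szS; apply: rootprod_le; first by lra.
  move=> s /Sx[_]; rewrite rt => sx.
  have := cabsD (z - x) (x - s); rewrite addrA subrK (cabsB x).
  by move: (cabs (z - s)) (cabs (s - x)) (cabs (z - x)) sx zt => ? ? ?; lra.
have -> : M * (2 / 3) ^+ n = (t / 2) ^+ n * (M / (3 * t / 4) ^+ n).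
  rewrite mulrCA; congr (_ * _); rewrite -expr_div_n; congr (_ ^+ _).
  by field; rewrite gt_eqF.
by apply: ler_pM => //; exact: cabs_ge0.
Qed.

(** If z0 were not isolated in its fibre, the interior of that fibre would contain z0. This interior
    is open, and closed in W by the identity theorem, because points of its closure are limits of
    other points of the fibre. *)
Lemma not_cst_isolated (h : C -> C) (W : set C) (z0 : C) :
  open W -> connected W -> (forall z, W z -> derivable h z 1) -> W z0 ->
  ~ (forall z, W z -> h z = h z0) ->
  \forall z \near z0, z != z0 -> h z <> h z0.
Proof.
move=> oW cW dh Wz0 ncst; apply: contrapT => H; apply: ncst.
pose Z := [set z | h z = h z0].
have key z : W z -> (forall e : R, 0 < e ->
    exists w, [/\ w != z, cabs (w - z) < e & h w = h z0]) -> Z° z.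
  move=> Wz acc.
  have [e e0 eW] := (nbhs_cabs _ _).1 (open_nbhs_nbhs (conj oW Wz)).
  have := @identity_theorem (fun w => h w - h z0) z e e0.
  have dhh w : disk z e w -> derivable (fun w => h w - h z0) w 1.
    by move=> /eW Ww; apply: cderB; [exact: dh|exact: cder_cst].
  move=> /(_ dhh) K.
  have : \forall w \near z, h w - h z0 = 0.
    by apply: K => e' /acc[w [wz we hw]]; exists w; split; [exact: wz|exact: we|rewrite hw subrr].
  by apply: filterS => w /subr0_eq.
have Z0 : Z° z0.
  apply: (key _ Wz0) => e e0; apply: contrapT => K; apply: H.
  apply/nbhs_cabs; exists e; first exact: e0.
  by move=> w we wz hw; apply: K; exists w.
have E : W `&` Z° = W.
  apply: cW; first by exists z0.
    by exists Z°; [exact: open_interior|].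
  exists (closure Z°); first exact: closed_closure.
  apply/seteqP; split => z [Wz Hz].
    by split; [exact: Wz|exact: subset_closure].
  split; first exact: Wz.
  apply: (key _ Wz) => e e0.
  have [w [Zw wz]] := Hz _ (nbhs_cdisk z e0).
  have [wE|wz0] := eqVneq w z; last first.
    by exists w; split; [exact: wz0|exact: wz|exact: (interior_subset Zw)].
  have [e' e'0 He'] := (nbhs_cabs _ _).1 Zw.
  (* Here the point found near z is z itself; a horizontal shift by d yields another point of the
     fibre. *)
  pose d := Num.min e e' / 2.
  have m0 : 0 < Num.min e e' by rewrite lt_min e0.
  have [m1 m2] : Num.min e e' <= e /\ Num.min e e' <= e'.
    by rewrite !ge_min !lexx orbT.
  have d0 : 0 < d by rewrite divr_gt0.
  have cd : cabs ((d%:C)%C : C) = d.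
    by rewrite /cabs /= expr0n /= addr0 sqrtr_sqr ger0_norm// ltW.
  exists (w + (d%:C)%C); split.
  - by rewrite -wE -subr_eq0 addrAC subrr add0r -cabs_eq0 cd gt_eqF.
  - by rewrite -wE addrAC subrr add0r cd /d; lra.
  - by apply: He'; rewrite addrAC subrr add0r cd /d; lra.
by move=> z; rewrite -E => -[_ /interior_subset].
Qed.

End Identity.

(** * Plane topology *)

Section PlaneTopology.
Variable R : realType.
Local Notation C := (Cplx R).

Lemma set0_absurd (T : Type) (A : set T) (x : T) : A = set0 -> A x -> False.
Proof. by move=> ->. Qed.

Lemma connectedU_closure (A B : set C) : closure A `&` B !=set0 ->
  connected A -> connected B -> connected (A `|` B).
Proof.
move=> [b [clb Bb]] cA cB; apply/connectedP => E [E0 EU sE].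
have AE : A `<=` E false `|` E true by rewrite -EU => x; left.
have BE : B `<=` E false `|` E true by rewrite -EU => x; right.
have sub i j : A `<=` E i -> B `<=` E j -> i != j -> False.
  move=> Ai Bj ij; have clE : closure (E i) b by exact: closureS clb.
  have [s1 s2] := sE.
  have Ejb := Bj b Bb; case: i ij clE {Ai} => ij clE; case: j ij Ejb {Bj} => // _ Ejb.
    exact: (set0_absurd s2 (conj Ejb clE)).
  exact: (set0_absurd s1 (conj clE Ejb)).
have ne i j : A `<=` E i -> B `<=` E i -> i != j -> False.
  move=> Ai Bi ij; have [x Ejx] := E0 j.
  have : (A `|` B) x by rewrite EU; case: j {ij} Ejx; [right|left].
  move=> ABx; have Eix : E i x by case: ABx => [/Ai|/Bi].
  have E01 := separated_disjoint sE.
  case: i ij Eix {Ai Bi} => ij Eix; case: j ij Ejx => // _ Ejx.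
    exact: (set0_absurd E01 (conj Ejx Eix)).
  exact: (set0_absurd E01 (conj Eix Ejx)).
have [Af|At] := connected_subset sE AE cA; have [Bf|Bt] := connected_subset sE BE cB.
- exact: (ne false true).
- exact: (sub false true).
- exact: (sub true false).
- exact: (ne true false).
Qed.

Lemma connected_side (O X : set C) : open O -> connected X ->
  (forall z, X z -> closure O z -> O z) -> X `<=` O \/ X `&` closure O = set0.
Proof.
move=> oO cX XO; have [X0|nX] := pselect (exists2 z, X z & O z); last first.
  right; apply/seteqP; split => // z [Xz clz].
  by apply: nX; exists z => //; exact: XO.
left => z Xz; suff : X `&` O = X by move=> XE; rewrite -XE in Xz; case: Xz.
apply: cX.
- by have [w Xw Ow] := X0; exists w.
- by exists O.
- exists (closure O); first exact: closed_closure.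
  apply/seteqP; split => w [Xw Ow]; split => //; first exact: subset_closure.
  exact: XO.
Qed.

(** At a point of largest real part, openness would allow a shift to the right. *)
Lemma compact_open_set0 (A : set C) : compact A -> open A -> A = set0.
Proof.
move=> cA oA; have [//|/set0P A0] := eqVneq A set0.
have [c /set_mem Ac cmax] := compact_EVT_max A0 cA (continuous_subspaceT (@continuous_Re R)).
have [e e0 eA] := (nbhs_cabs _ _).1 (open_nbhs_nbhs (conj oA Ac)).
pose w : C := (c : R[i]) + ((e / 2)%:C)%C.
have : A w.
  apply: eA; rewrite /w addrAC subrr add0r /cabs /= expr0n /= addr0 sqrtr_sqr.
  by rewrite ger0_norm; lra.
by move=> /mem_set /cmax; rewrite /w; case: (c) => x y /=; rewrite leNgt ltrDl divr_gt0.
Qed.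

Lemma compact_dist (A B : set C) : compact A -> closed B -> A `&` B = set0 ->
  exists2 e : R, 0 < e & forall a b, A a -> B b -> e <= cabs (a - b).
Proof.
move=> /compact_near_coveringP cA cB AB.
have : \forall e \near 0^'+, A `<=` [set a | forall b, B b -> e <= cabs (a - b)].
  apply: (cA R (0^'+) (fun e a => forall b, B b -> e <= cabs (a - b))) => a Aa.
  have nBa : ~ B a by move=> Ba; exact: (set0_absurd AB (conj Aa Ba)).
  have [t t0 Ht] := (nbhs_cabs _ _).1 (open_nbhs_nbhs (conj (closed_openC cB) nBa)).
  have h : 0 < t / 2 by rewrite divr_gt0.
  exists (disk a (t / 2), [set e : R | e < t / 2]) => /=.
    split; first exact: nbhs_cdisk.
    exact: nbhs_right_lt.
  move=> [a' e] /= [a'a et] b Bb.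
  have : t <= cabs (b - a) by rewrite leNgt; apply/negP => /Ht.
  have := cabsD (b - a') (a' - a); rewrite addrA subrK (cabsB b a').
  rewrite /disk /= in a'a.
  by move: (cabs (b - a)) (cabs (a' - b)) (cabs (a' - a)) a'a => ? ? ?; lra.
move=> H; have : \forall e \near (0 : R)^'+, 0 < e /\ A `<=` [set a | forall b, B b -> e <= cabs (a - b)].
  by apply: filterS2 (nbhs_right_gt 0) H.
by move=> /filter_ex[e [e0 He]]; exists e => // a b /He; apply.
Qed.

Lemma compact_separation (A B : set C) : compact A -> closed B -> A `&` B = set0 ->
  exists O, [/\ open O, A `<=` O, closure O `&` B = set0 &
     exists M : R, forall z, O z -> cabs z <= M].
Proof.
move=> cA cB AB; have [e e0 He] := compact_dist cA cB AB.
exists (\bigcup_(a in A) disk a (e / 2)); split.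
- by apply: bigcup_open => a _; exact: disk_open.
- by move=> a Aa; exists a => //; apply: disk_center; lra.
- apply/seteqP; split => // b [clb Bb].
  have [|w [[a Aa aw] wb]] := clb (disk b (e / 2)); first by apply: nbhs_cdisk; lra.
  have := He a b Aa Bb; have := cabsD (a - w) (w - b); rewrite addrA subrK (cabsB a w).
  move: aw wb; rewrite /disk /=.
  by move: (cabs (a - b)) (cabs (w - b)) (cabs (w - a)) => ? ? ?; lra.
- have [M HM] := compact_boundedC cA; exists (M + e / 2) => z [a Aa az].
  have := cabsD (z - a) a; rewrite subrK; move: az (HM a Aa); rewrite /disk /=.
  by move: (cabs (z - a)) (cabs z) (cabs a) => ? ? ?; lra.
Qed.

(** Finite intersection property in filter form: if all traces on L were nonempty, they would
    generate a proper filter, and a cluster point of it would lie in every member of [NN]. *)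
Lemma compact_directed (L : set C) (NN : set (set C)) :
  compact L -> (forall N, NN N -> closed N) -> NN !=set0 ->
  (forall N N', NN N -> NN N' -> NN (N `&` N')) ->
  (forall z, L z -> exists2 N, NN N & ~ N z) ->
  exists2 N, NN N & L `&` N = set0.
Proof.
move=> cL clN NN0 NI H; apply: contrapT => K.
pose F := filter_from NN (fun N => L `&` N).
have FF : ProperFilter F.
  apply: filter_from_proper; last first.
    move=> N NNN; apply/set0P/eqP => E; apply: K; by exists N.
  apply: filter_from_filter => // N N' h h'; exists (N `&` N'); first exact: NI.
  by move=> z [Lz [Nz Nz']].
have FL : F L by have [N NNN] := NN0; exists N => // z [].
have [z [Lz clz]] := cL F FF FL.
have [N NNN nNz] := H z Lz; apply: nNz; apply: (clN _ NNN) => U Uz.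
have FN : F N by exists N => // w [].
by have [w [Nw Uw]] := clz N U FN Uz; exists w.
Qed.

(** In a compact set, components and quasi-components agree. The relatively clopen sets N around x
    are encoded by closedness of N and of K minus N; their intersection Q is connected, hence inside
    the component and inside U, and by compactness some N already lies in U. *)
Lemma quasi_component (K U : set C) (x : C) : compact K -> K x -> open U ->
  connected_component K x `<=` U ->
  exists N, [/\ closed N, closed (K `\` N), N `<=` K, N x & N `<=` U].
Proof.
move=> cK Kx oU compU; have clK := compact_closedC cK.
pose NN := [set N | [/\ closed N, closed (K `\` N), N `<=` K & N x]].
have NNK : NN K by split; rewrite // setDv; exact: closed0.
have NNI N N' : NN N -> NN N' -> NN (N `&` N').
  move=> [h1 h2 h3 h4] [g1 g2 g3 g4]; split => //; first exact: closedI.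
    by rewrite setDIr; exact: closedU.
  by move=> z [/h3].
have NNcl N : NN N -> closed N by case.
pose Q := \bigcap_(N in NN) N.
have clQ : closed Q by apply: closed_bigI => N [].
have Qx : Q x by move=> N [].
have QK : Q `<=` K by move=> z; apply.
have cptQ : compact Q by exact: (subclosed_compact clQ cK QK).
have cQ : connected Q.
  apply/connectedP => E [E0 EU sE].
  have [b Ebx] : exists b, E b x.
    by move: Qx; rewrite EU => -[h|h]; [exists false|exists true].
  have clE i : closed (E i).
    have [s1 s2] := sE.
    move=> z clz; have Qz : Q z.
      by apply: clQ; apply: closureS clz; rewrite EU => w; case: (i); [right|left].
    move: Qz; rewrite EU => -[|] h; case: i clz => clz //.
      exfalso; exact: (set0_absurd s2 (conj h clz)).
    exfalso; exact: (set0_absurd s1 (conj clz h)).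
  have dis : E b `&` E (~~ b) = set0.
    by have := separated_disjoint sE; case: (b) => //=; rewrite setIC.
  have subQ i : E i `<=` Q by rewrite EU => z; case: i; [right|left].
  have cptE i : compact (E i) by exact: (subclosed_compact (clE i) cptQ (subQ i)).
  have [ O [oO EO clO _]] := compact_separation (cptE b) (clE (~~ b)) dis.
  (* If Q split into two closed pieces, O would separate them. A clopen N missing the boundary of O
     can be cut down to N inside O, which is again a member of [NN] but misses one of the pieces. *)
  have [N NNN LN] : exists2 N, NN N & (K `&` (closure O `\` O)) `&` N = set0.
    apply: (compact_directed _ NNcl (ex_intro _ K NNK) NNI).
      apply: (subclosed_compact _ cK); last by move=> z [].
      apply: closedI => //; apply: closedI; first exact: closed_closure.
      exact: open_closedC.
    move=> z [Kz [clz nOz]]; apply: contrapT => H.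
    have Qz : Q z by move=> N NNN; apply: contrapT => nNz; apply: H; exists N.
    have [Eb|Enb] : E b z \/ E (~~ b) z.
      by move: Qz; rewrite EU; case: (b) => /= -[]; [right|left|left|right].
    - by apply: nOz; exact: EO.
    - exact: (set0_absurd clO (conj clz Enb)).
  have [clN clKN NK Nx] := NNN.
  have E1 : N `&` O = N `&` closure O.
    apply/seteqP; split => z [Nz Oz]; split => //; first exact: subset_closure.
    apply: contrapT => nOz.
    exact: (set0_absurd LN (conj (conj (NK _ Nz) (conj Oz nOz)) Nz)).
  have NNO : NN (N `&` O).
    split; [by rewrite E1; apply: closedI => //; exact: closed_closure| | |].
    - rewrite setDIr; apply: closedU => //.
      have -> : K `\` O = K `&` ~` O by [].
      by apply: closedI => //; exact: open_closedC.
    - by move=> z [/NK].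
    - by split => //; exact: EO.
  have [y Ey] := E0 (~~ b).
  have [_ Oy] := subQ _ _ Ey _ NNO.
  exact: (set0_absurd clO (conj (subset_closure Oy) Ey)).
have QU : Q `<=` U.
  by move=> z Qz; apply: compU; exists Q.
have [N NNN LN] : exists2 N, NN N & (K `\` U) `&` N = set0.
  apply: (compact_directed _ NNcl (ex_intro _ K NNK) NNI).
    by apply: (subclosed_compact _ cK); [apply: closedI => //; exact: open_closedC|move=> z []].
  move=> z [Kz nUz]; apply: contrapT => H; apply: nUz; apply: QU => N NNN.
  by apply: contrapT => nNz; apply: H; exists N.
have [clN clKN NK Nx] := NNN; exists N; split => // z Nz.
apply: contrapT => nUz.
exact: (set0_absurd LN (conj (conj (NK _ Nz) nUz) Nz)).
Qed.

End PlaneTopology.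

(** * Ends of an annulus *)

Section Ends.
Variable R : realType.
Local Notation C := (Cplx R).

(* V is an open annulus, and tau runs from one of its ends (at 0) to the other (at 1). *)
Record annular (V : set C) (tau : C -> R) : Prop := Annular {
  ann_open : open V;
  ann_conn : connected V;
  ann_range : forall x, V x -> 0 < tau x < 1;
  ann_cont : forall x, V x -> {for x, continuous tau};
  ann_cpt : forall s t, 0 < s -> t < 1 -> compact (V `&` [set x | s <= tau x <= t]);
  ann_onto : forall s, 0 < s < 1 -> exists2 x, V x & tau x = s;
  ann_lo : forall s, 0 < s < 1 -> connected (V `&` [set x | tau x < s]);
  ann_hi : forall s, 0 < s < 1 -> connected (V `&` [set x | s < tau x]) }.

Definition flip (tau : C -> R) : C -> R := fun x => 1 - tau x.

Lemma annular_flip V tau : annular V tau -> annular V (flip tau).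
Proof.
move=> [oV cV rV ctV cpV onV loV hiV]; split.
- exact: oV.
- exact: cV.
- by move=> x /rV; rewrite /flip; lra.
- move=> x Vx; exact: (continuousB (@cst_continuous _ _ (1 : R) x) (ctV x Vx)).
- move=> s t s0 t1; rewrite (_ : _ `&` _ = V `&` [set x | 1 - t <= tau x <= 1 - s]).
    by apply: cpV; lra.
  by apply/seteqP; split => x [Vx]; rewrite /flip /= => h; split => //=; lra.
- move=> s s01; have [|x Vx xs] := onV (1 - s); first lra.
  by exists x => //; rewrite /flip xs; lra.
- move=> s s01; rewrite (_ : _ `&` _ = V `&` [set x | 1 - s < tau x]).
    by apply: hiV; lra.
  by apply/seteqP; split => x [Vx]; rewrite /flip /= => h; split => //=; lra.
- move=> s s01; rewrite (_ : _ `&` _ = V `&` [set x | tau x < 1 - s]).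
    by apply: loV; lra.
  by apply/seteqP; split => x [Vx]; rewrite /flip /= => h; split => //=; lra.
Qed.

Definition bdd (A : set C) : Prop := exists M : R, forall z, A z -> cabs z <= M.

Definition hole (V B : set C) : Prop := complement_component V B /\ bdd B.

Lemma hole_closed V B : open V -> hole V B -> closed B.
Proof.
by move=> oV [[b nVb ->] _]; apply: component_closed; exact: open_closedC.
Qed.

Lemma hole_compact V B : open V -> hole V B -> compact B.
Proof.
move=> oV hB; apply: compactC; first exact: hole_closed hB.
by apply/bounded_cabs; case: hB.
Qed.

Lemma hole_disjoint V B z : hole V B -> B z -> ~ V z.
Proof. by move=> [[b nVb ->] _] /connected_component_sub. Qed.

Lemma hole_connected V B : hole V B -> connected B.
Proof. by move=> [[b nVb ->] _]; exact: component_connected. Qed.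

Lemma hole_nonempty V B : hole V B -> B !=set0.
Proof.
by move=> [[b nVb ->] _]; exists b; exact: connected_component_refl.
Qed.

Lemma hole_component V B z : hole V B -> B z -> B = connected_component (~` V) z.
Proof.
by move=> [[b nVb ->] _] Bz; exact: same_connected_component.
Qed.

Lemma hole_of_component V z : ~ V z -> bdd (connected_component (~` V) z) ->
  hole V (connected_component (~` V) z).
Proof. by move=> nVz; split => //; exists z. Qed.

Lemma hole_max V B (X : set C) : hole V B -> connected X -> X `<=` ~` V ->
  X `&` B !=set0 -> X `<=` B.
Proof.
move=> hB cX XV [z [Xz Bz]]; rewrite (hole_component hB Bz).
exact: connected_component_max.
Qed.

Lemma bddU (A B : set C) : bdd A -> bdd B -> bdd (A `|` B).
Proof.
move=> [M HM] [N HN]; exists (Num.max M N) => z [/HM|/HN] h.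
  by rewrite le_max h.
by rewrite le_max h orbT.
Qed.

Lemma bddS (A B : set C) : A `<=` B -> bdd B -> bdd A.
Proof. by move=> AB [M HM]; exists M => z /AB /HM. Qed.

Lemma compact_bdd (A : set C) : compact A -> bdd A.
Proof. exact: compact_boundedC. Qed.

Lemma bdd_clopen_set0 (A : set C) : bdd A -> open A -> closed A -> A = set0.
Proof.
move=> bA oA cA; apply: compact_open_set0 => //; apply: compactC => //.
exact/bounded_cabs.
Qed.

(** A priori, other components of the complement of V may accumulate at B, so B is only enclosed in
    a clopen part N of the complement, close to B; N = B is proved later, in [filled_lo]. The set O
    isolates N, so that its boundary lies in V. *)
Lemma hole_nbhd V B U : open V -> hole V B -> open U -> B `<=` U ->
  exists O N : set C, [/\ open O, bdd O, O `<=` U &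
    [/\ closed N, closed (~` V `\` N), B `<=` N, N = ~` V `&` O &
        forall z, closure O z -> ~ O z -> V z] ].
Proof.
move=> oV hB oU BU.
have clF : closed (~` V) by exact: open_closedC.
have [b Bb] := hole_nonempty hB.
have [M HM] := hB.2.
(* The complement of V is unbounded, so it is truncated. Keeping N in the open disk of the same
   radius ensures that N is clopen in the whole complement too. *)
pose K := ~` V `&` cdisk 0 (M + 1).
have cK : compact K.
  apply: (subclosed_compact _ (@cdisk_compact R 0 (M + 1))); last by move=> z [].
  by apply: closedI => //; exact: cdisk_closed.
have BK : B `<=` K.
  move=> z Bz; split; first exact: (hole_disjoint hB).
  rewrite /cdisk /= subr0; apply: le_trans (HM z Bz) _; lra.
have oUD : open (U `&` disk 0 (M + 1)) by apply: openI => //; exact: disk_open.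
have compKB : connected_component K b `<=` B.
  apply: (hole_max hB); first exact: component_connected.
    by move=> z /connected_component_sub[].
  by exists b; split => //; apply: connected_component_refl; exact: BK.
have compKU : connected_component K b `<=` U `&` disk 0 (M + 1).
  move=> z /compKB Bz; split; first exact: BU.
  rewrite /disk /= subr0; apply: le_lt_trans (HM z Bz) _; lra.
have [N [clN clKN NK Nb NU]] := quasi_component cK (BK b Bb) oUD compKU.
have NF : N `<=` ~` V by move=> z /NK[].
have BN : B `<=` N.
  have : B `&` N = B.
    apply: (hole_connected hB); first by exists b.
      exists (~` (K `\` N)); first exact: closed_openC.
      apply/seteqP; split => z [Bz Nz]; split => //; first by case.
      by apply: contrapT => nNz; apply: Nz; split => //; exact: BK.
    by exists N.
  by move=> BNE z; rewrite -BNE => -[].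
have clFN : closed (~` V `\` N).
  have -> : ~` V `\` N = (K `\` N) `|` (~` V `&` ~` disk 0 (M + 1)).
    apply/seteqP; split => z.
      move=> [Fz nNz]; have [zM|zM] := pselect (disk 0 (M + 1) z); last by right.
      by left; split => //; split => //; exact: ltW.
    move=> [[[Fz _] nNz]|[Fz nD]]; first by [].
    by split => // /NU[_].
  by apply: closedU => //; apply: closedI => //; apply: open_closedC; exact: disk_open.
have cN : compact N by exact: (subclosed_compact clN cK NK).
have clE : closed ((~` V `\` N) `|` ~` U) by apply: closedU => //; exact: open_closedC.
have dis : N `&` ((~` V `\` N) `|` ~` U) = set0.
  by apply/seteqP; split => // z [Nz [[_ nN]|nU]] //; apply: nU; have [] := NU _ Nz.
have [ O [oO NO clO bO]] := compact_separation cN clE dis.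
have clOF z : closure O z -> ~ V z -> N z.
  move=> cz nVz; apply: contrapT => nNz; apply: (set0_absurd clO (conj cz _)).
  by left.
have OU : O `<=` U.
  move=> z Oz; apply: contrapT => nUz.
  by apply: (set0_absurd clO (conj (subset_closure Oz) _)); right.
exists O, N; split => //; split => //.
  apply/seteqP; split => z.
    by move=> Nz; split; [exact: NF|exact: NO].
  by move=> [nVz Oz]; apply: clOF => //; exact: subset_closure.
move=> z cz nOz; apply: contrapT => nVz; apply: nOz; apply: NO; exact: clOF.
Qed.

Section one_annulus.
Variables (V : set C) (tau : C -> R).
Hypothesis annV : annular V tau.

Let lo s := V `&` [set x | tau x < s].
Let hi s := V `&` [set x | s < tau x].
Let mid s t := V `&` [set x | s <= tau x <= t].

(** The boundary of O is a compact subset of V, so [tau] attains its extreme values on it, strictly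
    between 0 and 1. For an empty boundary the levels 1/2 are a dummy. *)
Lemma boundary_levels (O : set C) : open O -> bdd O ->
  (forall z, closure O z -> ~ O z -> V z) ->
  exists s t, [/\ 0 < s, s <= t, t < 1 &
    forall z, closure O z -> ~ O z -> s <= tau z <= t].
Proof.
move=> oO bO bdO; pose L := closure O `\` O.
have cL : compact L.
  apply: compactC.
    by apply: closedI; [exact: closed_closure|exact: open_closedC].
  apply/bounded_cabs; have [M HM] := bO; exists (M + 1) => z [cz _].
  have [w [Ow wz]] := cz _ (nbhs_cdisk z ltr01).
  have := cabsD (z - w) w; rewrite subrK cabsB; move: wz (HM w Ow).
  by move: (cabs (w - z)) (cabs z) (cabs w) => ? ? ?; lra.
have [L0|/set0P L0] := eqVneq L set0.
  exists (1 / 2), (1 / 2); split; [lra|lra|lra|].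
  by move=> z cz nz; exfalso; exact: (set0_absurd L0 (conj cz nz)).
have ctL : {within L, continuous tau}.
  apply: continuous_in_subspaceT => z /set_mem[cz nz].
  by apply: (ann_cont annV); exact: bdO.
have [c /set_mem[c1 c2] cmax] := compact_EVT_max L0 cL ctL.
have [d /set_mem[d1 d2] dmin] := compact_EVT_min L0 cL ctL.
have := ann_range annV (bdO c c1 c2); have := ann_range annV (bdO d d1 d2).
move=> /andP[q1 q2] /andP[q3 q4].
exists (tau d), (tau c); split => //.
  by apply: dmin; apply/mem_set.
move=> z cz nz; apply/andP; split; [apply: dmin|apply: cmax]; exact/mem_set.
Qed.

Lemma lo_side (O : set C) s t : 0 < s < 1 -> open O ->
  (forall z, closure O z -> ~ O z -> s <= tau z <= t) ->
  lo s `<=` O \/ lo s `&` closure O = set0.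
Proof.
move=> s01 oO st; apply: connected_side => //; first exact: (ann_lo annV).
move=> z [Vz zs] cz; apply: contrapT => nOz; have /andP[h _] := st z cz nOz.
by move: zs; rewrite /= ltNge h.
Qed.

Lemma hi_side (O : set C) s t : 0 < t < 1 -> open O ->
  (forall z, closure O z -> ~ O z -> s <= tau z <= t) ->
  hi t `<=` O \/ hi t `&` closure O = set0.
Proof.
move=> s01 oO st; apply: connected_side => //; first exact: (ann_hi annV).
move=> z [Vz zs] cz; apply: contrapT => nOz; have /andP[_ h] := st z cz nOz.
by move: zs; rewrite /= ltNge h.
Qed.

(* Capping both ends would produce a bounded clopen set. *)
Lemma no_capping (O O' : set C) s t : 0 < s < 1 -> 0 < t < 1 ->
  open O -> bdd O -> (forall z, closure O z -> ~ O z -> V z) ->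
  open O' -> bdd O' -> (forall z, closure O' z -> ~ O' z -> V z) ->
  lo s `<=` O -> hi t `<=` O' -> False.
Proof.
move=> s01 t01 oO bO bdO oO' bO' bdO' los hit.
have oV := ann_open annV.
have midV s' t' : mid s' t' `<=` V by move=> z [].
have VE : V `<=` (O `|` O') `|` mid s t.
  move=> z Vz; have [zs|sz] := ltP (tau z) s; first by left; left; apply: los.
  have [tz|zt] := ltP t (tau z); first by left; right; apply: hit.
  by right; split => //=; rewrite sz.
have cmid : compact (mid s t) by apply: (ann_cpt annV); lra.
have E0 : (O `|` O') `|` V = set0.
  apply: bdd_clopen_set0.
  - apply: (@bddS _ ((O `|` O') `|` mid s t)).
      by move=> z [|/VE //]; left.
    by apply: bddU; [exact: bddU|exact: compact_bdd].
  - by apply: openU => //; exact: openU.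
  - have -> : (O `|` O') `|` V = (closure O `|` closure O') `|` mid s t.
      apply/seteqP; split => z.
        move=> [[Oz|Oz]|/VE[[Oz|Oz]|mz]].
        + by left; left; exact: subset_closure.
        + by left; right; exact: subset_closure.
        + by left; left; exact: subset_closure.
        + by left; right; exact: subset_closure.
        + by right.
      move=> [[cz|cz]|/midV]; last by right.
        have [Oz|nOz] := pselect (O z); [by left; left|right; exact: bdO].
      have [Oz|nOz] := pselect (O' z); [by left; right|right; exact: bdO'].
    apply: closedU; last exact: compact_closedC.
    by apply: closedU; exact: closed_closure.
have [x Vx _] := ann_onto annV s01.
by apply: (set0_absurd E0 (_ : _ x)); right.
Qed.

(** If the closure of O missed both ends of V, then N would be O minus a compact middle part of V,
    hence open as well as closed and bounded. *)
Lemma some_end (O N : set C) s t : 0 < s < 1 -> 0 < t < 1 ->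
  bdd O -> closed N -> N = ~` V `&` O -> N !=set0 -> open O ->
  lo s `&` closure O = set0 -> hi t `&` closure O = set0 -> False.
Proof.
move=> s01 t01 bO clN NE N0 oO los hit.
have cmid : compact (mid s t) by apply: (ann_cpt annV); lra.
have : N = set0.
  apply: bdd_clopen_set0 => //.
    by apply: bddS bO; rewrite NE => z [].
  have -> : N = O `&` ~` mid s t.
    rewrite NE; apply/seteqP; split => z [h1 h2]; split => //; first by case.
    move=> Vz; apply: h2; split => //=; apply/andP; split; rewrite leNgt; apply/negP => h.
      exact: (set0_absurd los (conj (conj Vz h) (subset_closure h1))).
    exact: (set0_absurd hit (conj (conj Vz h) (subset_closure h1))).
  by apply: openI => //; apply: closed_openC; exact: compact_closedC.
by move=> N1; move: N0; rewrite N1 => -[].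
Qed.

(** Beyond the levels met by the boundary of O, each end of V is inside O or off its closure. Both
    inside is excluded by [no_capping] with O taken twice, both off by [some_end]. *)
Lemma hole_end B U : hole V B -> open U -> B `<=` U ->
  exists O N : set C, exists s t, [/\ open O, bdd O, O `<=` U &
   [/\ closed (~` V `\` N), B `<=` N, N = ~` V `&` O,
       forall z, closure O z -> ~ O z -> V z &
   [/\ 0 < s < 1, 0 < t < 1 & (lo s `<=` O /\ hi t `&` closure O = set0) \/
      (hi t `<=` O /\ lo s `&` closure O = set0)]]].
Proof.
move=> hB oU BU.
have [ O [N [oO bO OU [clN clFN BN NE bdO]]]] := hole_nbhd (ann_open annV) hB oU BU.
have [s [t [s0 st t1 lev]]] := boundary_levels oO bO bdO.
have s01 : 0 < s < 1 by lra.
have t01 : 0 < t < 1 by lra.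
exists O, N, s, t; split => //; split => //; split => //.
have N0 : N !=set0 by have [b /BN Nb] := hole_nonempty hB; exists b.
have [h1|h1] := lo_side s01 oO lev; have [h2|h2] := hi_side t01 oO lev.
- by exfalso; exact: (no_capping s01 t01 oO bO bdO oO bO bdO h1 h2).
- by left.
- by right.
- by exfalso; exact: (some_end s01 t01 bO clN NE N0 oO h1 h2).
Qed.

End one_annulus.

(** Two distinct holes have disjoint neighbourhoods, each swallowing an end of V. The same end is
    excluded by disjointness, opposite ends by [no_capping]. *)
Lemma hole_unique V tau B1 B2 : annular V tau -> hole V B1 -> hole V B2 -> B1 = B2.
Proof.
move=> annV h1 h2; have oV := ann_open annV.
have [b1 Bb1] := hole_nonempty h1; have [b2 Bb2] := hole_nonempty h2.
have [[x [B1x B2x]]|dis] := pselect (B1 `&` B2 !=set0).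
  by rewrite (hole_component h1 B1x) (hole_component h2 B2x).
exfalso; have dis' : B1 `&` B2 = set0.
  by apply/seteqP; split => // x hx; apply: dis; exists x.
have [U1 [oU1 BU1 clU1 _]] := compact_separation (hole_compact oV h1) (hole_closed oV h2) dis'.
have oU2 : open (~` closure U1) by apply: closed_openC; exact: closed_closure.
have BU2 : B2 `<=` ~` closure U1.
  by move=> z B2z cz; exact: (set0_absurd clU1 (conj cz B2z)).
have [ O1 [N1 [s1 [t1 [oO1 bO1 OU1 [_ _ _ bdO1 [s01 t01 e1]]]]]]] := hole_end annV h1 oU1 BU1.
have [ O2 [N2 [s2 [t2 [oO2 bO2 OU2 [_ _ _ bdO2 [s02 t02 e2]]]]]]] := hole_end annV h2 oU2 BU2.
have dO z : O1 z -> O2 z -> False.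
  by move=> /OU1 /subset_closure h /OU2.
case: e1 => -[e1 _]; case: e2 => -[e2 _].
- have m0 : 0 < Num.min s1 s2 < 1 by rewrite lt_min gt_min; lra.
  have [m1 m2] : Num.min s1 s2 <= s1 /\ Num.min s1 s2 <= s2.
    by rewrite !ge_min !lexx orbT.
  have [x Vx xt] : exists2 x, V x & tau x = Num.min s1 s2 / 2.
    by apply: (ann_onto annV); lra.
  by apply: (dO x); [apply: e1|apply: e2]; split => //=; rewrite xt; lra.
- exact: (no_capping annV s01 t02 oO1 bO1 bdO1 oO2 bO2 bdO2 e1 e2).
- exact: (no_capping annV s02 t01 oO2 bO2 bdO2 oO1 bO1 bdO1 e2 e1).
- have m0 : 0 < Num.max t1 t2 < 1 by rewrite lt_max gt_max; lra.
  have [m1 m2] : t1 <= Num.max t1 t2 /\ t2 <= Num.max t1 t2.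
    by rewrite !le_max !lexx orbT.
  have [x Vx xt] : exists2 x, V x & tau x = (Num.max t1 t2 + 1) / 2.
    by apply: (ann_onto annV); lra.
  by apply: (dO x); [apply: e1|apply: e2]; split => //=; rewrite xt; lra.
Qed.

(* B is the hole of V, attached to V at the end tau -> 0. *)
Record filled (V : set C) (tau : C -> R) (B : set C) : Prop := Filled {
  fil_ann : annular V tau;
  fil_hole : hole V B;
  fil_openV : open (B `|` V);
  fil_open : forall u, 0 < u < 1 -> open (B `|` (V `&` [set x | tau x < u]));
  fil_compact : forall u, 0 < u < 1 -> compact (B `|` (V `&` [set x | tau x <= u]));
  fil_conn : forall u, 0 < u < 1 -> connected (B `|` (V `&` [set x | tau x < u]));
  fil_connV : connected (B `|` V) }.

(** The component of the complement of V at any point of N stays inside O, hence is bounded and is a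
    hole; uniqueness of the hole gives N = B. So B is isolated in the complement of V, from which
    openness and compactness of the collars follow. *)
Lemma filled_lo V tau B (O N : set C) s t : annular V tau -> hole V B ->
  open O -> bdd O -> closed (~` V `\` N) -> B `<=` N -> N = ~` V `&` O ->
  (forall z, closure O z -> ~ O z -> V z) -> 0 < s < 1 -> 0 < t < 1 ->
  V `&` [set x | tau x < s] `<=` O ->
  (V `&` [set x | t < tau x]) `&` closure O = set0 -> filled V tau B.
Proof.
move=> annV hB oO bO clFN BN NE bdO s01 t01 los hit.
have oV := ann_open annV.
have NB : N `<=` B.
  move=> y Ny; have nVy : ~ V y by move: Ny; rewrite NE => -[].
  have hy : hole V (connected_component (~` V) y).
    apply: hole_of_component => //; apply: (@bddS _ N).
      have : connected_component (~` V) y `&` O = connected_component (~` V) y.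
        apply: component_connected.
        - exists y; split; first exact: connected_component_refl.
          by move: Ny; rewrite NE => -[].
        - by exists O.
        - exists (closure O); first exact: closed_closure.
          apply/seteqP; split => z [Cz Oz]; split => //; first exact: subset_closure.
          apply: contrapT => nOz; exact: (connected_component_sub Cz (bdO z Oz nOz)).
      move=> E z Cz; rewrite NE; split; first exact: connected_component_sub Cz.
      by move: Cz; rewrite -E => -[].
    by apply: bddS bO; rewrite NE => z [].
  rewrite (hole_unique annV hB hy); exact: connected_component_refl.
have BE : B = N by apply/seteqP.
have BO : B `<=` O by rewrite BE NE => z [].
have OV z : O z -> ~ V z -> B z by move=> Oz nVz; rewrite BE NE.
have clOV z : closure O z -> ~ V z -> B z.
  move=> cz nVz; have [Oz|nOz] := pselect (O z); first exact: OV.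
  by exfalso; apply: nVz; exact: bdO.
have taut z : V z -> closure O z -> tau z <= t.
  move=> Vz cz; rewrite leNgt; apply/negP => h.
  exact: (set0_absurd hit (conj (conj Vz h) cz)).
have openD : open (B `|` V).
  rewrite (_ : B `|` V = ~` (~` V `\` N)); first exact: closed_openC.
  apply/seteqP; split => z.
    by move=> [Bz|Vz] [nVz nNz]; [apply: nNz; exact: BN|exact: nVz].
  move=> H; have [Vz|nVz] := pselect (V z); [by right|left].
  by apply: NB; apply: contrapT => nNz; exact: H.
have openlo u : 0 < u < 1 -> open (V `&` [set x | tau x < u]).
  move=> u01; rewrite openE => x [Vx xu]; apply: filterI.
    exact: open_nbhs_nbhs.
  have H : nbhs (tau x) [set y : R | y < u].
    by apply: open_nbhs_nbhs; split; [exact: open_lt|exact: xu].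
  exact: (ann_cont annV Vx H).
have openu u : 0 < u < 1 -> open (B `|` (V `&` [set x | tau x < u])).
  move=> u01; have m0 : 0 < Num.min s u by rewrite lt_min; lra.
  have mu : Num.min s u <= u by rewrite ge_min lexx orbT.
  have ms : Num.min s u <= s by rewrite ge_min lexx.
  have cm : compact (V `&` [set x | Num.min s u <= tau x <= t]).
    by apply: (ann_cpt annV); lra.
  (* Removing a compact shell of V from O leaves B and levels below u, since O meets V only in
     levels at most t. *)
  rewrite (_ : _ `|` _ = (O `&` ~` (V `&` [set x | Num.min s u <= tau x <= t])) `|`
     (V `&` [set x | tau x < u])).
    apply: openU; last exact: openlo.
    by apply: openI => //; apply: closed_openC; exact: compact_closedC.
  apply/seteqP; split => z; last first.
    move=> [[Oz nz]|]; last by right.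
    have [Vz|nVz] := pselect (V z); last by left; exact: OV.
    right; split => //=; rewrite ltNge; apply/negP => uz; apply: nz; split => //=.
    by rewrite (le_trans mu uz) taut//; exact: subset_closure.
  move=> [Bz|]; last by right.
  by left; split; [exact: BO|move=> [Vz _]; exact: (hole_disjoint hB Bz)].
have cptu u : 0 < u < 1 -> compact (B `|` (V `&` [set x | tau x <= u])).
  move=> u01.
  have cm : compact (V `&` [set x | s <= tau x <= u]) by apply: (ann_cpt annV); lra.
  have KE z : V z -> tau z <= u -> O z \/ (V `&` [set x | s <= tau x <= u]) z.
    move=> Vz zu; have [zs|sz] := ltP (tau z) s; first by left; apply: los.
    by right; split => //=; rewrite sz.
  apply: compactC; last first.
    apply/bounded_cabs; apply: (@bddS _ (O `|` (V `&` [set x | s <= tau x <= u]))).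
      by move=> z [/BO|[Vz zu]]; [left|exact: KE].
    by apply: bddU => //; exact: compact_bdd.
  move=> z cz.
  have cz' : (closure O `|` (V `&` [set x | s <= tau x <= u])) z.
    have : closed (closure O `|` (V `&` [set x | s <= tau x <= u])).
      by apply: closedU; [exact: closed_closure|exact: compact_closedC].
    apply; apply: closureS cz => w [/BO|[Vw wu]]; first by left; exact: subset_closure.
    by have [Ow|mw] := KE w Vw wu; [left; exact: subset_closure|right].
  have [Vz|nVz] := pselect (V z); last first.
    by left; case: cz' => [cz'|[]] //; exact: clOV.
  right; split => //=; rewrite leNgt; apply/negP => uz.
  have nU : nbhs z (V `&` [set x | u < tau x]).
    apply: filterI; first exact: open_nbhs_nbhs.
    have H : nbhs (tau z) [set y : R | u < y].
      by apply: open_nbhs_nbhs; split; [exact: open_gt|exact: uz].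
    exact: (ann_cont annV Vz H).
  have [w [[Bw|[Vw wu]] [Vw' uw]]] := cz _ nU.
    exact: (hole_disjoint hB Bw).
  by move: uw; rewrite /= ltNge wu.
(* Otherwise B would have a neighbourhood off the closure of the collar, and by [hole_end] it would
   swallow an end of V: not the low end, which runs through the collar, and not the high end, as O
   already caps the low one. *)
have meet u : 0 < u < 1 -> closure (V `&` [set x | tau x < u]) `&` B !=set0.
  move=> u01; apply: contrapT => nm.
  have oW : open (~` closure (V `&` [set x | tau x < u])).
    by apply: closed_openC; exact: closed_closure.
  have BW : B `<=` ~` closure (V `&` [set x | tau x < u]).
    by move=> z Bz cz; apply: nm; exists z.
  have [ O2 [N2 [s2 [t2 [oO2 bO2 OU2 [_ _ _ bdO2 [s02 t02 e2]]]]]]] := hole_end annV hB oW BW.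
  case: e2 => -[e2 _]; last first.
    exact: (no_capping annV s01 t02 oO bO bdO oO2 bO2 bdO2 los e2).
  have m0 : 0 < Num.min s2 u by rewrite lt_min; lra.
  have [m1 m2] : Num.min s2 u <= s2 /\ Num.min s2 u <= u.
    by rewrite !ge_min !lexx orbT.
  have [x Vx xt] : exists2 x, V x & tau x = Num.min s2 u / 2.
    by apply: (ann_onto annV); lra.
  apply: (OU2 x); first by apply: e2; split => //=; rewrite xt; lra.
  by apply: subset_closure; split => //=; rewrite xt; lra.
split => //.
- move=> u u01; rewrite setUC; apply: connectedU_closure; first exact: meet.
    exact: (ann_lo annV).
  exact: hole_connected hB.
- rewrite setUC; apply: connectedU_closure.
  + have h : 0 < (1 / 2 : R) < 1 by lra.
    have [b [cb Bb]] := meet _ h; exists b; split => //.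
    by apply: closureS cb => z [].
  + exact: (ann_conn annV).
  + exact: hole_connected hB.
Qed.

Theorem ends V tau B : annular V tau -> hole V B ->
  filled V tau B \/ filled V (flip tau) B.
Proof.
move=> annV hB; have BT : B `<=` setT by [].
have [ O [N [s [t [oO bO _ [clFN BN NE bdO [s01 t01 e]]]]]]] := hole_end annV hB openT BT.
case: e => -[e1 e2]; [left|right].
  exact: (filled_lo annV hB oO bO clFN BN NE bdO s01 t01 e1 e2).
have s01' : 0 < 1 - s < 1 by lra.
have t01' : 0 < 1 - t < 1 by lra.
apply: (filled_lo (annular_flip annV) hB oO bO clFN BN NE bdO t01' s01').
  by move=> x [Vx]; rewrite /flip /= => h; apply: e1; split => //=; lra.
apply/seteqP; split => // x [[Vx]]; rewrite /flip /= => h cx.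
by apply: (set0_absurd e2 (conj (conj Vx _) cx)) => /=; lra.
Qed.

End Ends.

(** * Singularities and zero derivatives *)

Section Prelim.
Variable R : realType.
Local Notation C := (Cplx R).

Lemma not_in_seq (O : set C) (S : seq C) z (e : R) : open O -> O z -> 0 < e ->
  exists2 w, O w /\ w \notin S & cabs (w - z) < e.
Proof.
move=> oO Oz e0.
have [t t0 tO] := (nbhs_cabs _ _).1 (open_nbhs_nbhs (conj oO Oz)).
pose m := Num.min t e.
have m0 : 0 < m by rewrite lt_min t0.
have [mt me] : m <= t /\ m <= e by rewrite !ge_min !lexx orbT.
(* Infinitely many distinct points, of which a finite list cannot contain all; starting at n + 2
   keeps the distance to z strictly below m. *)
pose p n : C := z + ((m / n.+2%:R)%:C)%C.
have pz n : cabs (p n - z) = m / n.+2%:R.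
  rewrite /p addrAC subrr add0r /cabs /= expr0n /= addr0 sqrtr_sqr ger0_norm//.
  by rewrite divr_ge0 ?ler0n ?ltW.
have pm n : cabs (p n - z) < m.
  by rewrite pz ltr_pdivrMr ?ltr0n// ltr_pMr// ltr1n.
have pinj : injective p.
  move=> i j pij; have := pz i; rewrite pij pz => /(congr1 (fun x => m / x)).
  have mn : m != 0 by rewrite gt_eqF.
  have E k : m / (m / k.+2%:R) = k.+2%:R by rewrite invf_div mulrC divfK.
  by rewrite !E => /eqP; rewrite eqr_nat => /eqP[].
have [n nS] : exists n, p n \notin S.
  apply: contrapT => H.
  have HS n : p n \in S by apply: contrapT => nS; apply: H; exists n; apply/negP.
  have : (size (map p (iota 0 (size S).+1)) <= size S)%N.
    apply: uniq_leq_size; first by rewrite map_inj_uniq ?iota_uniq.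
    by move=> x /mapP[n _ ->].
  by rewrite size_map size_iota ltnn.
exists (p n); last exact: lt_le_trans me.
by split => //; apply: tO; exact: lt_le_trans mt.
Qed.

(** P stands for the real or the imaginary part; it reduces functions with zero complex derivative
    to the real mean value theorem on a segment. *)
Lemma line_is_derive (g : C -> C) (x v : C) (t : R) :
  (forall e : R, 0 < e -> \forall w \near (x + (t%:C)%C * v),
     cabs (g w - g (x + (t%:C)%C * v)) <= e * cabs (w - (x + (t%:C)%C * v))) ->
  forall P : C -> R, (forall z w, P (z - w) = P z - P w) -> (forall z, `|P z| <= cabs z) ->
  is_derive t 1 (fun s : R => P (g (x + (s%:C)%C * v))) 0.
Proof.
move=> H P PB Pc.
pose u s := P (g (x + (s%:C)%C * v)).
have cv : h^-1 *: (u (h *: 1 + t) - u t) @[h --> (0 : R)^'] --> (0 : R).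
  apply/cvgrPdist_lt => e e0; pose e' := e / (cabs v + 1).
  have v1 : 0 < cabs v + 1 by rewrite ltr_wpDl// cabs_ge0.
  have e'0 : 0 < e' by rewrite divr_gt0.
  have [d d0 Hd] := (nbhs_cabs _ _).1 (H _ e'0).
  have dv : 0 < d / (cabs v + 1) by rewrite divr_gt0.
  near=> h.
  have h0 : h != 0 by near: h; exact: nbhs_dnbhs_neq.
  rewrite sub0r normrN /GRing.scale /= mulr1 normrM normfV.
  have hh : 0 < `|h| by rewrite normr_gt0.
  have E : x + ((h + t)%:C)%C * v - (x + (t%:C)%C * v) = (h%:C)%C * v.
    by rewrite (rmorphD (real_complex R)); ring.
  have ch : cabs ((h%:C)%C : C) = `|h|.
    by rewrite /cabs /= expr0n /= addr0 sqrtr_sqr.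
  have hd : `|h| * cabs v < d.
    have hs : `|h| < d / (cabs v + 1).
      by near: h; exact: dnbhs0_lt.
    rewrite ltr_pdivlMr// in hs; apply: le_lt_trans hs.
    by rewrite ler_wpM2l// lerDl.
  have := Hd (x + ((h + t)%:C)%C * v); rewrite E cabsM ch => /(_ hd) K.
  rewrite mulrC ltr_pdivrMr// /u -PB; apply: le_lt_trans (Pc _) _.
  apply: le_lt_trans K _; rewrite mulrCA [ltRHS]mulrC ltr_pM2l//.
  by rewrite /e' mulrAC ltr_pdivrMr// ltr_pM2l// ltrDl.
have L := cvg_lim (@Rhausdorff R) cv.
apply: DeriveDef; first by apply/cvg_ex; exists 0; exact: cv.
exact: L.
Unshelve. all: by end_near. Qed.

Lemma zero_derivative_cst (g : C -> C) (x : C) (r : R) :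
  (forall z, disk x r z -> forall e : R, 0 < e ->
     \forall w \near z, cabs (g w - g z) <= e * cabs (w - z)) ->
  forall y, disk x r y -> g y = g x.
Proof.
move=> H y xy; pose v := y - x.
have xv s : 0 <= s <= 1 -> disk x r (x + (s%:C)%C * v).
  move=> s01; rewrite /disk /= addrAC subrr add0r cabsM.
  have -> : cabs ((s%:C)%C : C) = s.
    by rewrite /cabs /= expr0n /= addr0 sqrtr_sqr ger0_norm; lra.
  apply: le_lt_trans xy; rewrite -[leRHS]mul1r ler_wpM2r ?cabs_ge0//; lra.
have main (P : C -> R) : (forall z w, P (z - w) = P z - P w) ->
    (forall z, `|P z| <= cabs z) -> P (g y) = P (g x).
  move=> PB Pc; pose u s := P (g (x + (s%:C)%C * v)).
  have du (s : R) : 0 <= s <= 1 -> is_derive s 1 u 0.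
    by move=> s01; exact: (line_is_derive (H _ (xv s s01)) PB Pc).
  have cu : {within `[0, 1], continuous u}.
    apply: continuous_in_subspaceT => s /set_mem /=; rewrite in_itv /= => s01.
    by apply: differentiable_continuous; apply/derivable1_diffP; case: (du s s01).
  have [|c _] := @MVT R u (fun=> 0) 0 1 ltr01 _ cu.
    by move=> s; rewrite in_itv /= => s01; apply: du; lra.
  rewrite mul0r /u => /eqP; rewrite subr_eq0 => /eqP.
  by rewrite mul1r mul0r addr0 /v addrC subrK.
have hre : complex.Re (g y) = complex.Re (g x).
  by apply: main => [[? ?] [? ?]//|]; exact: cabs_Re.
have him : complex.Im (g y) = complex.Im (g x).
  by apply: main => [[? ?] [? ?]//|]; exact: cabs_Im.
by move: hre him; case: (g y) => ? ?; case: (g x) => ? ? /= -> ->.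
Qed.

Lemma derivable_lipschitz (g : C -> C) z : derivable g z 1 ->
  exists L : R, \forall w \near z, cabs (g w - g z) <= L * cabs (w - z).
Proof.
move=> /cderivableP[d Hd]; exists (1 + cabs d).
have := Hd 1 ltr01; apply: filterS => w.
have := cabsD (g w - g z - d * (w - z)) (d * (w - z)); rewrite subrK cabsM mulrDl.
move: (cabs (g w - g z)) (cabs (g w - g z - d * (w - z))) => A B.
by rewrite mul1r => h1 h2; apply: le_trans h1 _; rewrite lerD2r.
Qed.

(* A weak form of Riemann's theorem on removable singularities: all difference
   quotients of h based at points w' != w obey one and the same bound. *)
Lemma removable_lipschitz (h : C -> C) (w : C) (r : R) : 0 < r ->
  {for w, continuous h} ->
  (forall z, disk w r z -> z != w -> derivable h z 1) ->
  exists L : R, \forall z \near w, cabs (h z - h w) <= L * cabs (z - w).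
Proof.
move=> r0 cw dh; pose s := r / 2; have s0 : 0 < s by rewrite divr_gt0.
have sr z : cdisk w s z -> disk w r z.
  by rewrite /cdisk /disk /= => /le_lt_trans; apply; rewrite /s; lra.
have ch z : cdisk w s z -> {for z, continuous h}.
  by move=> /sr zr; have [->//|zw] := eqVneq z w; exact/cderivable_continuous/dh.
have [M M0 HM] := compact_cont_bound (@cdisk_compact _ w s) ch.
have DK : disk w s `<=` cdisk w s by move=> z /ltW.
(* On the rim |z - w| = s the numerator is at most 2M and |z - w'| is at least s/2, for every w' in
   the half disk; this makes the bound independent of w'. *)
pose L := 4 * M / s; exists L.
have L0 : 0 <= L by rewrite divr_ge0 ?mulr_ge0// ltW.
have key w' z : disk w (s / 2) w' -> w' != w -> cdisk w s z -> z != w -> z != w' ->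
    cabs (h z - h w') <= L * cabs (z - w').
  move=> w's w'w zs zw zw'.
  have Dw' : disk w s w' by move: w's; rewrite /disk /= => /lt_trans; apply; lra.
  have [l /nbhs_cabs[e e0 He]] := derivable_lipschitz (dh _ (sr _ (DK _ Dw')) w'w).
  pose q z := (h z - h w') * (z - w')^-1.
  have : cabs (q z) <= L.
    have q0 y : y \notin [:: w; w'] -> y - w' != 0.
      by rewrite !inE negb_or subr_eq0 => /andP[].
    apply: (@max_modulus R (cdisk w s) (disk w s) [:: w; w'] q L
      (Num.max l (2 * M / e)) (@cdisk_compact _ w s) (@disk_open _ w s) DK L0).
    - by move=> y; rewrite !inE => /orP[/eqP ->|/eqP ->//]; exact: disk_center.
    - move=> y Ky yS; apply: contM.
        exact: (contB (ch y Ky) (@cst_continuous _ _ (h w') y)).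
      exact: (contV (f := fun y => y - w') (q0 y yS) (contB cvg_id (@cst_continuous _ _ w' y))).
    - move=> y Dy yS _; apply: cderM.
        apply: cderB; last exact: cder_cst.
        apply: dh; first exact/sr/DK.
        by move: yS; rewrite !inE negb_or => /andP[].
      by apply: (@cderV _ (fun y => y - w') y (q0 y yS)); apply: cderB; [exact: cder_id|exact: cder_cst].
    - move=> y Ky yS; have yw0 : 0 < cabs (y - w') by rewrite cabs_gt0 q0.
      rewrite /q cabsM cabsV ler_pdivrMr//.
      have [ye|ye] := ltP (cabs (y - w')) e.
        apply: le_trans (He _ ye) _; by rewrite ler_pM2r// le_max lexx.
      apply: (@le_trans _ _ (2 * M)).
        apply: le_trans (cabsD _ _) _; rewrite cabsN.
        have := HM y Ky; have := HM w' (DK _ Dw').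
        by move: (cabs (h y)) (cabs (h w')) => ? ?; lra.
      apply: (@le_trans _ _ (2 * M / e * cabs (y - w'))).
        by rewrite mulrAC ler_pdivlMr// ler_wpM2l// mulr_ge0// ltW.
      by rewrite ler_pM2r// le_max lexx orbT.
    - move=> y Ky Dy.
      have yw : s <= cabs (y - w) by rewrite leNgt; apply/negP.
      have yw' : s / 2 <= cabs (y - w').
        have := cabsD (y - w') (w' - w); rewrite addrA subrK.
        move: w's; rewrite /disk /=.
        by move: yw (cabs (y - w')) (cabs (w' - w)) => + ? ?; move: (cabs _) => ?; lra.
      have yw0 : 0 < cabs (y - w') by lra.
      rewrite /q cabsM cabsV ler_pdivrMr//.
      apply: (@le_trans _ _ (2 * M)).
        apply: le_trans (cabsD _ _) _; rewrite cabsN.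
        have := HM y Ky; have := HM w' (DK _ Dw').
        by move: (cabs (h y)) (cabs (h w')) => ? ?; lra.
      apply: (@le_trans _ _ (L * (s / 2))).
        by rewrite /L le_eqVlt; apply/orP; left; apply/eqP; field; rewrite gt_eqF.
      by rewrite ler_wpM2l.
    - exact: zs.
    - by rewrite !inE negb_or zw zw'.
  have zw0 : 0 < cabs (z - w') by rewrite cabs_gt0 subr_eq0.
  by rewrite /q cabsM cabsV ler_pdivrMr.
apply: filterS (nbhs_cdisk w s0) => z zs.
have [->|zw] := eqVneq z w; first by rewrite !subrr cabs0 mulr0.
apply/ler_addgt0Pr => e e0.
have q0 : 0 < e / (2 * (L + 1)) by rewrite divr_gt0// mulr_gt0// ltr_wpDl.
have zw0 : 0 < cabs (z - w) by rewrite cabs_gt0 subr_eq0.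
have [d d0 Hd] := (nbhs_cabs _ _).1 ((continuous_cabsP _ _).1 cw (e / 2) (divr_gt0 e0 (@ltr0n R 2))).
(* The base point w' is moved towards w: continuity of h costs e/2, the term L|w' - w| costs another
   e/2, and the last entry keeps w' different from z. *)
pose m := Num.min (Num.min (s / 2) d) (Num.min (e / (2 * (L + 1))) (cabs (z - w))).
have m0 : 0 < m by rewrite !lt_min q0 zw0 d0 divr_gt0.
have [w' [_ w'w] w'm] := not_in_seq [:: w] openT (I : setT w) m0.
rewrite inE in w'w; move: w'm; rewrite !lt_min => /andP[/andP[a1 a2] /andP[a3 a4]].
have zw' : z != w'.
  by apply/eqP => E; move: a4; rewrite -E ltxx.
have K := key w' z a1 w'w (ltW zs) zw zw'.
have h1 := cabsD (h z - h w') (h w' - h w); rewrite addrA subrK in h1.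
have h2 := Hd w' a2.
have h3 := cabsD (z - w) (w - w'); rewrite addrA subrK (cabsB w) in h3.
apply: le_trans h1 _.
have L1 : L * cabs (w' - w) <= e / 2.
  apply: (@le_trans _ _ ((L + 1) * (e / (2 * (L + 1))))).
    by apply: ler_pM => //; [exact: cabs_ge0|rewrite lerDl|exact: ltW].
  by rewrite le_eqVlt; apply/orP; left; apply/eqP; field; rewrite gt_eqF// ltr_wpDl.
have L2 : L * cabs (z - w') <= L * cabs (z - w) + L * cabs (w' - w).
  by rewrite -mulrDr ler_wpM2l.
move: K h2 L1 L2; move: (cabs (h z - h w')) (cabs (h w' - h w)) (L * _) (L * _) (L * _).
by move=> ? ? ? ? ?; lra.
Qed.

(** Near each point of K at most that point is a pole. Compactness is used as near covering along
    the filter of lists ordered by inclusion, which produces one list for all of K. *)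
Lemma poles_finite (f : C -> Csphere R) (K : set C) : meromorphic f -> compact K ->
  exists S : seq C, forall z, z \in S <-> K z /\ is_pole f z.
Proof.
move=> mf /compact_near_coveringP cK.
pose F := filter_from [set: seq C] (fun S => [set S' : seq C | {subset S <= S'}]).
have FF : ProperFilter F.
  apply: filter_from_proper; last by move=> S _; exists S.
  apply: filter_from_filter; first by exists [::].
  move=> S S' _ _; exists (S ++ S') => // T /= H; split => x xS; apply: H;
    by rewrite mem_cat xS ?orbT.
have H : \forall S \near F, K `<=` [set z | is_pole f z -> z \in S].
  apply: (cK _ F (fun S z => is_pole f z -> z \in S)) => x Kx.
  have nx : \forall y \near x, is_pole f y -> y = x.
    have [px|px] := pselect (is_pole f x).
      have := pole_near mf px; apply: filterS => y Hy py.
      by apply: contrapT => /eqP yx; exact: Hy.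
    by have := near_nonpole mf px; apply: filterS => y Hy /Hy.
  exists ([set y | is_pole f y -> y = x], [set S' : seq C | {subset [:: x] <= S'}]) => /=.
    by split => //; exists [:: x].
  by move=> [y S'] /= [Hy HS'] /Hy ->; apply: HS'; rewrite inE.
have [S HS] := @filter_ex _ F FF _ H.
exists [seq z <- S | `[< K z /\ is_pole f z >]] => z.
rewrite mem_filter; split; first by move=> /andP[/asboolP].
by move=> [Kz pz]; apply/andP; split; [exact/asboolP|exact: HS].
Qed.

End Prelim.

(** * One step along the cycle of rings *)

Section Step.
Variable R : realType.
Local Notation C := (Cplx R).
Local Notation Chat := (Csphere R).
Variable f : C -> Chat.
Hypothesis merof : meromorphic f.

Record annulus_map (V : set C) (tau : C -> R) (W : set C) (tau' : C -> R) : Prop :=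
  AnnulusMap {
  am_ann : annular V tau;
  am_ann' : annular W tau';
  am_to : forall x, V x -> exists y, [/\ f x = Some y, W y & tau' y = tau x];
  am_inj : forall x x', V x -> V x' -> f x = f x' -> x = x';
  am_onto : forall y, W y -> exists2 x, V x & f x = Some y }.

Lemma annulus_map_flip V tau W tau' : annulus_map V tau W tau' ->
  annulus_map V (flip tau) W (flip tau').
Proof.
move=> [aV aW to inj onto]; split.
- exact: annular_flip.
- exact: annular_flip.
- by move=> x /to[y [fx Wy ty]]; exists y; split; rewrite // /flip ty.
- exact: inj.
- exact: onto.
Qed.

Section fill.
Variables (V : set C) (tau : C -> R) (W : set C) (tau' : C -> R) (B : set C).
Hypothesis am : annulus_map V tau W tau'.
Hypothesis fil : filled V tau B.

Let Om u := B `|` (V `&` [set x | tau x < u]).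
Let Ka u := B `|` (V `&` [set x | tau x <= u]).

Let OmKa u : Om u `<=` Ka u.
Proof. by move=> z [Bz|[Vz zu]]; [left|right; split => //; exact: ltW]. Qed.

Lemma rim u z : Ka u z -> ~ Om u z -> V z /\ tau z = u.
Proof.
move=> [Bz|[Vz zu]] nO; first by exfalso; apply: nO; left.
split => //; apply/eqP; rewrite eq_le; apply/andP; split; first exact: zu.
by rewrite leNgt; apply/negP => h; apply: nO; right.
Qed.

Lemma fill_disjoint z : B z -> V z -> False.
Proof. exact: (hole_disjoint (fil_hole fil)). Qed.

Lemma nonpole_V z : V z -> ~ is_pole f z.
Proof. by move=> /(am_to am)[y [fz _ _]]; rewrite /is_pole fz. Qed.

Lemma image_rim u z v : Ka u z -> ~ Om u z -> f z = Some v -> W v /\ tau' v = u.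
Proof.
move=> Kz nOz fz; have [Vz zu] := rim Kz nOz.
have [y [fy Wy ty]] := am_to am Vz.
have E : v = y by move: fy; rewrite fz => -[].
by rewrite E ty.
Qed.

Lemma image_component u (X : set C) : 0 < u < 1 -> connected X ->
  (forall v, X v -> W v -> tau' v != u) ->
  X `&` fimage f (Om u) !=set0 -> X `<=` fimage f (Om u).
Proof.
move=> u01 cX XW; apply: (fimage_connected merof (fil_compact fil u01) (fil_open fil u01)
  (@OmKa u) cX).
move=> z v Kz nOz Xv fz; have [Wv tv] := image_rim Kz nOz fz.
by have := XW v Xv Wv; rewrite tv eqxx.
Qed.

(** Otherwise B would be the open set B + V minus the closure of V, hence bounded, open and
    closed. *)
Lemma hole_in_closure : exists2 b, B b & closure V b.
Proof.
apply: contrapT => H.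
have hB := fil_hole fil; have oV := ann_open (am_ann am).
have [b Bb] := hole_nonempty hB.
have B0 : B = set0.
  apply: bdd_clopen_set0; [exact: hB.2| |exact: (hole_closed oV hB)].
  have -> : B = (B `|` V) `&` ~` closure V.
    apply/seteqP; split => z; first by move=> Bz; split; [left|move=> cz; apply: H; exists z].
    by move=> [[//|Vz] nz]; exfalso; apply: nz; exact: subset_closure.
  by apply: openI; [exact: (fil_openV fil)|apply: closed_openC; exact: closed_closure].
exact: (set0_absurd B0 Bb).
Qed.

Lemma V_isolated x v : V x -> f x = Some v ->
  \forall z \near x, z != x -> f z <> Some v.
Proof.
move=> Vx fx; have nV := open_nbhs_nbhs (conj (ann_open (am_ann am)) Vx).
apply: filterS nV => z Vz zx fz; move: zx; rewrite (am_inj am Vz Vx) ?eqxx//.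
by rewrite fz fx.
Qed.

(* Otherwise f would retract the filled annulus onto an annulus. *)
Lemma hole_escapes : (forall z, B z -> ~ is_pole f z) ->
  exists b v, [/\ B b, f b = Some v & ~ W v].
Proof.
move=> nopole; apply: contrapT => H.
have BW b v : B b -> f b = Some v -> W v.
  by move=> Bb fb; apply: contrapT => nW; apply: H; exists b, v.
(* If f(b) were in W, it would equal f(x) for some x in V. Points y of V near b have images near
   f(x), and these are also taken near x; injectivity on V puts y near both x and b. *)
have [b Bb clb] := hole_in_closure.
have fb := nonpoleE (nopole b Bb); set v := finite_part f b in fb.
have [x Vx fx] := am_onto am (BW b v Bb fb).
have bx : b != x by apply/eqP => E; apply: (fill_disjoint Bb); rewrite E.
have d0 : 0 < cabs (b - x) / 2 by rewrite divr_gt0// cabs_gt0 subr_eq0.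
have nU : nbhs x (V `&` disk x (cabs (b - x) / 2)).
  apply: filterI; first exact: (open_nbhs_nbhs (conj (ann_open (am_ann am)) Vx)).
  exact: nbhs_cdisk.
have nv := fimage_open_isolated merof fx nU (V_isolated Vx fx).
have cb := cderivable_continuous (nonpole_derivable merof (nopole b Bb)).
have nb : \forall y \near b, fimage f (V `&` disk x (cabs (b - x) / 2)) (finite_part f y).
  exact: cb.
have [y [Vy [ny yb]]] := clb _ (filterI nb (nbhs_cdisk b d0)).
have [x' [Vx' x'x] fx'] := ny.
have E : y = x'.
  by apply: (am_inj am Vy Vx'); rewrite fx' (nonpoleE (nonpole_V Vy)).
have := cabsD (b - y) (y - x); rewrite addrA subrK (cabsB b y).
move: x'x; rewrite -E /disk /=; move: yb.
by move: (cabs (b - x)) (cabs (y - b)) (cabs (y - x)) => p q r; lra.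
Qed.

Let half01 : 0 < (1 / 2 : R) < 1.
Proof. lra. Qed.

Lemma image_bdd u : 0 < u < 1 -> (forall z, B z -> ~ is_pole f z) -> bdd (fimage f (Om u)).
Proof.
move=> u01 nopole.
have np z : Ka u z -> ~ is_pole f z by move=> [/nopole//|[/nonpole_V]].
have [D D0 HD] := compact_cont_bound (fil_compact fil u01)
  (fun z Kz => cderivable_continuous (nonpole_derivable merof (np z Kz))).
exists D => v [z Oz fz]; rewrite -(finite_partE fz); apply: HD; exact: OmKa.
Qed.

Lemma component_in_image v u : 0 < u < 1 -> fimage f (Om u) v -> ~ W v ->
  connected_component (~` W) v `<=` fimage f (Om u).
Proof.
move=> u01 fv nWv; apply: (image_component u01); first exact: component_connected.
  by move=> w /connected_component_sub.
by exists v; split => //; exact: connected_component_refl.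
Qed.

(** A component of the complement of W that meets f(B) lies wholly in the image of a collar of B,
    which is bounded as there is no pole. So it is the hole of W and all its points are values of f;
    [hole_escapes] shows that there is such a component. *)
Lemma polefree_hole : (forall z, B z -> ~ is_pole f z) ->
  exists B', [/\ hole W B', forall v, B' v -> ~ omitted f (Some v) &
    forall b v, B b -> f b = Some v -> W v \/ B' v].
Proof.
move=> nopole.
have [b [v [Bb fb nWv]]] := hole_escapes nopole.
have sub b' v' : B b' -> f b' = Some v' -> ~ W v' ->
    connected_component (~` W) v' `<=` fimage f (Om (1 / 2)).
  by move=> Bb' fb'; apply: component_in_image => //; exists b' => //; left.
have hol b' v' : B b' -> f b' = Some v' -> ~ W v' ->
    hole W (connected_component (~` W) v').
  move=> Bb' fb' nW; apply: hole_of_component => //.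
  exact: bddS (sub b' v' Bb' fb' nW) (image_bdd half01 nopole).
exists (connected_component (~` W) v); split.
- exact: hol Bb fb nWv.
- by move=> w /(sub b v Bb fb nWv)[z _ fz] /(_ z).
- move=> b' v' Bb' fb'; have [|nW] := pselect (W v'); [by left|right].
  rewrite (hole_unique (am_ann' am) (hol b v Bb fb nWv) (hol b' v' Bb' fb' nW)).
  exact: connected_component_refl.
Qed.

Section with_pole.
Variables (a w0 : C).
Hypothesis oma : omitted f (Some a).
Hypotheses (Bw0 : B w0) (pw0 : is_pole f w0).

Let G := finv f a.

Let fa z : f z <> Some a. Proof. exact: oma. Qed.

Let Gcont z : {for z, continuous G}. Proof. exact: finv_continuous. Qed.

Let Gder z : ~ is_pole f z -> derivable G z 1.
Proof. by move=> pz; exact: finv_derivable. Qed.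

Let Gpole z : is_pole f z -> G z = 0. Proof. exact: finv_pole. Qed.

Let Gneq0 z : ~ is_pole f z -> G z != 0.
Proof.
move=> pz; rewrite /G finv_nonpole// invr_eq0 subr_eq0; apply/eqP => E.
by apply: (fa (z := z)); rewrite (nonpoleE pz) E.
Qed.

Let Ginj z z' : G z = G z' -> f z = f z'.
Proof.
have [pz|pz] := pselect (is_pole f z); have [pz'|pz'] := pselect (is_pole f z').
- by rewrite pz pz'.
- by rewrite (Gpole pz) => /esym/eqP; rewrite (negbTE (Gneq0 pz')).
- by rewrite (Gpole pz') => /eqP; rewrite (negbTE (Gneq0 pz)).
- rewrite /G !finv_nonpole// => /invr_inj /addIr E.
  by rewrite (nonpoleE pz) (nonpoleE pz') E.
Qed.

Let polesK u : 0 < u < 1 -> exists S : seq C, [/\ forall z, z \in S -> Om u z,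
    forall z, z \in S -> is_pole f z & forall z, Ka u z -> z \notin S -> ~ is_pole f z].
Proof.
move=> u01; have [S HS] := poles_finite merof (fil_compact fil u01).
exists S; split => z.
- move=> /HS[Kz pz]; apply: contrapT => nO.
  by have [Vz _] := rim Kz nO; exact: nonpole_V Vz pz.
- by move=> /HS[].
- by move=> Kz /negP zS pz; apply: zS; exact/HS.
Qed.

Lemma omitted_notW a' : omitted f (Some a') -> ~ W a'.
Proof. by move=> om /(am_onto am)[x _ fx]; exact: om fx. Qed.

Lemma omitted_notimage a' u : 0 < u < 1 -> omitted f (Some a') ->
  connected_component (~` W) a' `&` fimage f (Om u) = set0.
Proof.
move=> u01 om; apply/seteqP; split => // v [cv fv].
have nWv : ~ W v by exact: connected_component_sub cv.
have := component_in_image u01 fv nWv; rewrite -(same_connected_component cv) => sub.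
have [|z _ fz] := sub a'; last exact: om fz.
by apply: connected_component_refl; exact: omitted_notW.
Qed.

(** In an unbounded component, take x so far from a that c = 1/(x - a) is below 1/(2D), where |G| >=
    1/D on the rim. The component misses the image of the collar, so G never takes the value c
    there, and 1/(G - c) is at most 2D by the maximum principle. But at the pole w0, G = 0 and the
    modulus is 1/|c| > 2D. *)
Lemma omitted_bdd : bdd (connected_component (~` W) a).
Proof.
set X := connected_component _ _; apply: contrapT => nb.
pose u := (1 / 2 : R).
have cKa := fil_compact fil half01; have oOm := fil_open fil half01.
have dis := omitted_notimage half01 oma.
have cL : compact (Ka u `\` Om u).
  apply: (subclosed_compact _ cKa); last by move=> z [].
  by apply: closedI; [exact: compact_closedC|exact: open_closedC].
have GL z : (Ka u `\` Om u) z -> {for z, continuous (fun z => (G z)^-1)}.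
  move=> [Kz nz]; apply: (contV (f := G)); last exact: Gcont.
  by apply: Gneq0; have [Vz _] := rim Kz nz; exact: nonpole_V Vz.
have [D D0 HD] := compact_cont_bound cL GL.
have [x Xx xa] : exists2 x, X x & 2 * D < cabs (x - a).
  apply: contrapT => H; apply: nb; exists (2 * D + cabs a) => x Xx.
  have := cabsD (x - a) a; rewrite subrK => /le_trans; apply; rewrite lerD2r leNgt.
  by apply/negP => h; apply: H; exists x.
pose c := (x - a)^-1.
have xa0 : 0 < cabs (x - a) by apply: lt_trans xa; rewrite mulr_gt0.
have xan : x - a != 0 by rewrite -cabs_gt0.
have ci : cabs c < (2 * D)^-1.
  by rewrite cabsV ltf_pV2// posrE mulr_gt0.
have Gc z : Ka u z -> G z - c != 0.
  move=> Kz; rewrite subr_eq0; apply/eqP => E.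
  have pz : ~ is_pole f z.
    by move=> pz; move: E; rewrite (Gpole pz) => /esym/eqP; rewrite invr_eq0 (negbTE xan).
  move: E; rewrite /G finv_nonpole// => /invr_inj /addIr fx.
  have fzx : f z = Some x by rewrite (nonpoleE pz) fx.
  have nWx : ~ W x by exact: connected_component_sub Xx.
  have [Oz|nOz] := pselect (Om u z).
    by apply: (set0_absurd dis (x := x)); split => //; exists z.
  by apply: nWx; have [] := image_rim Kz nOz fzx.
pose q z := (G z - c)^-1.
have cq z : Ka u z -> {for z, continuous q}.
  move=> Kz; apply: (contV (f := fun z => G z - c) (Gc z Kz)).
  exact: (contB (Gcont (z:=z)) (@cst_continuous _ _ c z)).
have [S [SO Sp nS]] := polesK half01.
have [M M0 HM] := compact_cont_bound cKa cq.
have D2 : 0 <= 2 * D by rewrite mulr_ge0// ltW.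
have key z : Ka u z -> z \notin S -> cabs (q z) <= 2 * D.
  apply: (@max_modulus R (Ka u) (Om u) S q (2 * D) M cKa oOm (@OmKa u) D2 SO).
  - by move=> y Ky _; exact: cq.
  - move=> y Oy yS _; have Ky := OmKa Oy.
    apply: (@cderV _ (fun z => G z - c) y (Gc y Ky)).
    by apply: cderB; [exact: (Gder (nS y Ky yS))|exact: cder_cst].
  - by move=> y Ky _; exact: HM.
  - move=> y Ky nOy; have Gy : cabs (G y)^-1 <= D by exact: HD.
    have Gy0 : G y != 0.
      by apply: Gneq0; have [Vy _] := rim Ky nOy; exact: nonpole_V Vy.
    have Gy1 : D^-1 <= cabs (G y).
      by rewrite -[leRHS]invrK lef_pV2 ?posrE ?invr_gt0 ?cabs_gt0// -cabsV.
    have E2 : D^-1 = (2 * D)^-1 + (2 * D)^-1 by field; rewrite gt_eqF.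
    have h := cabsD (G y - c) c; rewrite subrK in h.
    have p0 : 0 < (2 * D)^-1 by rewrite invr_gt0 mulr_gt0.
    have h2 : (2 * D)^-1 <= cabs (G y - c).
      by move: h Gy1 ci p0; rewrite E2; move: (cabs (G y)) (cabs (G y - c)) (cabs c) => p q' r; lra.
    rewrite /q cabsV -[leRHS]invrK lef_pV2// posrE//; exact: lt_le_trans h2.
have qw0 : 2 * D < cabs (q w0).
  rewrite /q (Gpole pw0) sub0r cabsV cabsN -[ltLHS]invrK ltf_pV2// posrE ?invr_gt0 ?mulr_gt0//.
  by rewrite cabs_gt0 invr_eq0.
have Ow0 : Om u w0 by left.
have e0 : 0 < cabs (q w0) - 2 * D by rewrite subr_gt0.
(* The pole w0 is itself exceptional for [key]; by continuity the bound already fails at a nearby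
   point outside S. *)
have := (continuous_cabsP _ _).1 (cq w0 (OmKa Ow0)) _ e0.
move=> /nbhs_cabs[t t0 Ht].
have [z [Oz zS] zw] := not_in_seq S oOm Ow0 t0.
have := Ht z zw; have := key z (OmKa Oz) zS.
have := cabsD (q z) (q w0 - q z); rewrite addrC subrK (cabsB (q w0)).
by move: (cabs (q z)) (cabs (q w0)) (cabs (q z - q w0)) => p q' r; lra.
Qed.

Lemma omitted_hole : hole W (connected_component (~` W) a).
Proof. by apply: hole_of_component; [exact: omitted_notW|exact: omitted_bdd]. Qed.

(* Otherwise the image of B and a collar of it would contain the omitted value a. *)
Lemma hole_image_disjoint b v : B b -> f b = Some v -> ~ W v.
Proof.
move=> Bb fb Wv; set B' := connected_component (~` W) a.
have hB' : hole W B' := omitted_hole.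
have B'a : B' a by apply: connected_component_refl; exact: omitted_notW.
have noa u (X : set C) : 0 < u < 1 -> connected X ->
    (forall v, X v -> W v -> tau' v != u) -> X a -> X `&` fimage f (Om u) = set0.
  move=> u01 cX XW Xa; apply/seteqP; split => // y hy.
  have XO : X `<=` fimage f (Om u) by apply: (image_component u01 cX XW); exists y.
  by have [z _ fz] := XO a Xa; exact: oma fz.
have tv := ann_range (am_ann' am) Wv.
(* In either case a connected X contains a, avoids the level u, and meets the image of the collar,
   against [noa]. If B' caps the low end of W, X is B' with the levels below 1/2, which meets the
   image of the level 1/4 of V. Otherwise X is B' with the levels above [tau' v / 2], which contains
   v = f(b). *)
case: (ends (am_ann' am) hB') => fil'.
  have X0 := noa (1/2) _ half01 (fil_conn fil' half01).
  have [x Vx tx] : exists2 x, V x & tau x = 1 / 4 by apply: (ann_onto (am_ann am)); lra.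
  have [y [fx Wy ty]] := am_to am Vx.
  apply: (set0_absurd (X0 _ _) (x := y)).
  - move=> z [B'z Wz|[_ /= zt] _]; first by exfalso; exact: (hole_disjoint hB' B'z).
    by rewrite lt_eqF.
  - by left.
  - split; first by right; split => //=; rewrite ty tx; lra.
    by exists x => //; right; split => //=; rewrite tx; lra.
have u01 : 0 < tau' v / 2 < 1 by lra.
have v01 : 0 < 1 - tau' v / 2 < 1 by lra.
have X0 := noa (tau' v / 2) _ u01 (fil_conn fil' v01).
apply: (set0_absurd (X0 _ _) (x := v)).
- move=> z [B'z Wz|[_ ]]; first by exfalso; exact: (hole_disjoint hB' B'z).
  by rewrite /flip /= => h _; rewrite gt_eqF//; lra.
- by left.
- split; first by right; split => //=; rewrite /flip; lra.
  by exists b => //; left.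
Qed.

End with_pole.
End fill.
End Step.

(** * From injectivity near the rim to injectivity on the hole *)

Section InjectiveFill.
Variable R : realType.
Local Notation C := (Cplx R).

Lemma seq_isolated (S : seq C) (w : C) :
  exists2 e : R, 0 < e & forall s, s \in S -> s != w -> e <= cabs (s - w).
Proof.
elim: S => [|s S [e e0 eS]]; first by exists 1.
have [->|sw] := eqVneq s w.
  by exists e => // z; rewrite inE => /orP[/eqP ->|/eS//]; rewrite eqxx.
have sw0 : 0 < cabs (s - w) by rewrite cabs_gt0 subr_eq0.
exists (Num.min e (cabs (s - w))); first by rewrite lt_min e0.
move=> z; rewrite inE => /orP[/eqP -> _|zS zw]; first by rewrite ge_min lexx orbT.
by rewrite ge_min eS.
Qed.

Variables (G : C -> C) (V : set C) (tau : C -> R) (B : set C) (S : seq C).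
Hypothesis fil : filled V tau B.
Hypothesis cG : forall z, (B `|` V) z -> {for z, continuous G}.
Hypothesis SB : forall z, z \in S -> B z.
Hypothesis dG : forall z, (B `|` V) z -> z \notin S -> derivable G z 1.
Hypothesis injG : forall z z', V z -> (B `|` V) z' -> G z = G z' -> z = z'.

Let Om u := B `|` (V `&` [set x | tau x < u]).
Let Ka u := B `|` (V `&` [set x | tau x <= u]).
Let s01 : 0 < (2 / 3 : R) < 1. Proof. lra. Qed.
Let t01 : 0 < (1 / 3 : R) < 1. Proof. lra. Qed.
(** Base points w are taken up to level 1/3 and the maximum principle is applied up to level 2/3, so
    that the rim L keeps a positive distance from the base points, and G(L) from their images. *)
Let Os := Om (2 / 3).
Let Ks := Ka (2 / 3).
Let Ot := Om (1 / 3).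
Let Kt := Ka (1 / 3).

Let OsKs : Os `<=` Ks.
Proof. by move=> z [Bz|[Vz zu]]; [left|right; split => //; exact: ltW]. Qed.
Let OtKt : Ot `<=` Kt.
Proof. by move=> z [Bz|[Vz zu]]; [left|right; split => //; exact: ltW]. Qed.
Let KtOs : Kt `<=` Os.
Proof. by move=> z [Bz|[Vz /= zu]]; [left|right; split => //=; lra]. Qed.
Let KsD : Ks `<=` B `|` V.
Proof. by move=> z [Bz|[Vz zu]]; [left|right]. Qed.
Let cKs : compact Ks. Proof. exact: (fil_compact fil s01). Qed.
Let cKt : compact Kt. Proof. exact: (fil_compact fil t01). Qed.
Let oOs : open Os. Proof. exact: (fil_open fil s01). Qed.
Let oOt : open Ot. Proof. exact: (fil_open fil t01). Qed.
Let L := Ks `\` Os.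

Let cL : compact L.
Proof.
apply: (subclosed_compact _ cKs); last by move=> z [].
by apply: closedI; [exact: compact_closedC|exact: open_closedC].
Qed.

Let LV z : L z -> V z /\ tau z = 2 / 3.
Proof.
move=> [[Bz|[Vz zu]] nO]; first by exfalso; apply: nO; left.
split => //; apply/eqP; rewrite eq_le; apply/andP; split; first exact: zu.
by rewrite leNgt; apply/negP => h; apply: nO; right.
Qed.

Let BV z : B z -> V z -> False.
Proof. exact: (hole_disjoint (fil_hole fil)). Qed.

Let LKt z w : L z -> Kt w -> z <> w.
Proof.
move=> /LV[Vz tz] Kw zw; case: Kw; rewrite -zw; first by move/BV; apply.
by move=> [_]; rewrite /= tz; lra.
Qed.

Let lipG w : (B `|` V) w ->
  exists l : R, \forall z \near w, cabs (G z - G w) <= l * cabs (z - w).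
Proof.
move=> Dw; have [wS|wS] := boolP (w \in S); last exact: derivable_lipschitz (dG Dw wS).
have [e e0 He] := seq_isolated S w.
have [r r0 Hr] := (nbhs_cabs _ _).1 (open_nbhs_nbhs (conj (fil_openV fil) Dw)).
have m0 : 0 < Num.min e r by rewrite lt_min e0.
apply: (removable_lipschitz m0 (cG Dw)) => z; rewrite /disk /= lt_min => /andP[ze zr] zw.
apply: dG; first exact: Hr.
by apply/negP => zS; have := He z zS zw; rewrite leNgt ze.
Qed.

Lemma injective_fill_bounds : exists b0 d M D : R, [/\ 0 < b0, 0 < d, 0 < M, 0 < D &
  [/\ forall z w, L z -> Kt w -> b0 <= cabs (G z - G w),
      forall z w, L z -> Kt w -> d <= cabs (z - w),
      forall z, Ks z -> cabs (G z) <= M &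
      forall z w, Ks z -> Ks w -> cabs (z - w) <= D]].
Proof.
have [d d0 Hd] : exists2 e : R, 0 < e & forall a b, L a -> Kt b -> e <= cabs (a - b).
  apply: compact_dist cL _ _; first exact: compact_closedC.
  by apply/seteqP; split => // z [Lz Kz]; exact: (LKt Lz Kz).
have cim (A : set C) : compact A -> A `<=` Ks -> compact (G @` A).
  move=> cA AK; apply: continuous_compact => //.
  apply: continuous_in_subspaceT => z /set_mem /AK /KsD; exact: cG.
have cL' : compact (G @` L) by apply: cim => // z [].
have cKt' : compact (G @` Kt) by apply: cim => // z /KtOs /OsKs.
have dis : (G @` L) `&` (G @` Kt) = set0.
  apply/seteqP; split => // y [[z Lz zy] [w Kw wy]].
  apply: (LKt Lz Kw); apply: injG; [by case: (LV Lz)|exact/KsD/OsKs/KtOs|].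
  by rewrite zy wy.
have [b0 b00 Hb] := compact_dist cL' (compact_closedC cKt') dis.
have [M M0 HM] := compact_cont_bound cKs (fun z Kz => cG (KsD Kz)).
have [D HD] := compact_boundedC cKs.
have D0 : 0 < 2 * `|D| + 1 by rewrite ltr_wpDl// mulr_ge0.
exists b0, d, M, (2 * `|D| + 1); split => //; split => //.
- by move=> z w Lz Kw; apply: Hb; [exists z|exists w].
- move=> z w Kz Kw; have := cabsD z (- w); rewrite cabsN.
  have := HD z Kz; have := HD w Kw; have := ler_norm D.
  by move: (cabs z) (cabs w) (cabs (z - w)) `|D| => p q r n; lra.
Qed.

(* All difference quotients of G on Ks are bounded below by their minimum on
   the boundary L: the set of base points w for which this holds is open and
   closed in the connected set Ot. *)
Theorem injective_fill w1 w2 : B w1 -> B w2 -> G w1 = G w2 -> w1 = w2.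
Proof.
have [b0 [d [M [D [b00 d0 M0 D0 [Hb Hd HM HD]]]]]] := injective_fill_bounds.
(* For z on the rim and w a base point, |G z - G w| >= b0 >= be |z - w|, as D bounds the distances
   in Ks. *)
pose be := b0 / D; have be0 : 0 < be by rewrite divr_gt0.
pose E := [set w | Kt w /\ forall z, Ks z -> be * cabs (z - w) <= cabs (G z - G w)].
have SOs z : z \in S -> Os z by move=> /SB; left.
have contphi z (c k : C) : (B `|` V) z ->
    {for z, continuous (fun x => cabs (G x - c) - be * cabs (x - k))}.
  move=> Dz; have c1 : {for z, continuous (fun x => cabs (G x - c))}.
    by apply: cont_cabs; exact: (contB (cG Dz) (@cst_continuous _ _ c z)).
  have c2 : {for z, continuous (fun x : C => be * cabs (x - k))}.
    exact: (continuousM (@cst_continuous _ _ be z) (@continuous_cabsB R k z)).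
  exact: (continuousB c1 c2).
have negnear z (c k : C) : (B `|` V) z -> cabs (G z - c) < be * cabs (z - k) ->
    \forall x \near z, cabs (G x - c) < be * cabs (x - k).
  move=> Dz h.
  have h' : nbhs (cabs (G z - c) - be * cabs (z - k)) [set y : R | y < 0].
    by apply: open_nbhs_nbhs; split; [exact: open_lt|rewrite /= subr_lt0].
  have H : \forall x \near z, cabs (G x - c) - be * cabs (x - k) < 0.
    exact: (contphi z c k Dz _ h').
  by apply: filterS H => x; rewrite subr_lt0.
(* Self-improvement: any lower bound b > 0 makes (z - w)/(G z - G w) bounded off S', and the maximum
   principle then replaces 1/b by the rim bound 1/be. Continuity extends the inequality to the
   points of S'. *)
have Esub (w : C) (S' : seq C) (b : R) : Ot w -> (forall z, z \in S' -> Os z) ->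
    {subset S <= S'} -> w \in S' -> 0 < b ->
    (forall z, Ks z -> z \notin S' -> b * cabs (z - w) <= cabs (G z - G w)) -> E w.
  move=> Ow S'O SS wS' bp Hbw.
  have Kw : Kt w by exact: OtKt.
  have nw z : z \notin S' -> 0 < cabs (z - w).
    by move=> zS'; rewrite cabs_gt0 subr_eq0; apply: contraNneq zS' => ->.
  have nz z : Ks z -> z \notin S' -> G z - G w != 0.
    move=> Kz zS'; rewrite -cabs_gt0; apply: lt_le_trans (Hbw z Kz zS').
    by rewrite mulr_gt0// nw.
  have be1 : 0 <= be^-1 by rewrite invr_ge0 ltW.
  have key z : Ks z -> z \notin S' -> cabs ((z - w) * (G z - G w)^-1) <= be^-1.
    apply: (@max_modulus R Ks Os S' (fun z => (z - w) * (G z - G w)^-1) be^-1 b^-1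
      cKs oOs OsKs be1 S'O).
    - move=> y Ky yS; apply: contM; first exact: (contB cvg_id (@cst_continuous _ _ w y)).
      apply: (contV (f := fun z => G z - G w) (nz y Ky yS)).
      exact: (contB (cG (KsD Ky)) (@cst_continuous _ _ (G w) y)).
    - move=> y Oy yS _; have Ky := OsKs Oy; apply: cderM.
        by apply: cderB; [exact: cder_id|exact: cder_cst].
      apply: (@cderV _ (fun z => G z - G w) y (nz y Ky yS)).
      apply: cderB; last exact: cder_cst.
      by apply: (dG (KsD Ky)); apply: contra yS; exact: SS.
    - move=> y Ky yS; have h := nz y Ky yS; rewrite -cabs_gt0 in h.
      by rewrite cabsM cabsV ler_pdivrMr// mulrC ler_pdivlMr// mulrC Hbw.
    - move=> y Ky nOy; have Ly : L y by [].
      have yb := Hb y w Ly Kw.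
      have h : 0 < cabs (G y - G w) by exact: lt_le_trans yb.
      rewrite cabsM cabsV ler_pdivrMr// mulrC ler_pdivlMr// mulrC.
      apply: le_trans yb; rewrite /be mulrAC ler_pdivrMr// ler_wpM2l//; first exact: ltW.
      by apply: HD => //; exact/OsKs/KtOs.
  split => // z Kz; rewrite leNgt; apply/negP => h.
  have [zS'|zS'] := boolP (z \in S'); last first.
    have hn := nz z Kz zS'; rewrite -cabs_gt0 in hn.
    have := key z Kz zS'; rewrite cabsM cabsV ler_pdivrMr// mulrC ler_pdivlMr// mulrC.
    by rewrite leNgt h.
  have [e e0 He] := (nbhs_cabs _ _).1 (negnear z (G w) w (KsD Kz) h).
  have [y [Oy yS'] yz] := not_in_seq S' oOs (S'O z zS') e0.
  have hn := nz y (OsKs Oy) yS'; rewrite -cabs_gt0 in hn.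
  have := key y (OsKs Oy) yS'; rewrite cabsM cabsV ler_pdivrMr// mulrC ler_pdivlMr// mulrC.
  by rewrite leNgt He.
(* Being injective on V, G has a nonzero derivative c at some w of the collar. Near w the difference
   quotients are at least |c|/2; away from w, injectivity and compactness bound them below. *)
have start : exists w, Ot w /\ E w.
  have annV := fil_ann fil.
  have [x Vx tx] : exists2 x, V x & tau x = 1 / 6 by apply: (ann_onto annV); lra.
  have Ox : (Ot `&` V) x by split => //; right; split => //=; rewrite tx; lra.
  have oOV : open (Ot `&` V) by apply: openI => //; exact: ann_open annV.
  have nS w : V w -> w \notin S by move=> Vw; apply/negP => /SB /BV; apply.
  have [w [[Ow Vw] nd]] : exists w, (Ot `&` V) w /\ ~ (forall e : R, 0 < e ->
      \forall z \near w, cabs (G z - G w) <= e * cabs (z - w)).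
    apply: contrapT => H.
    have [r r0 Hr] := (nbhs_cabs _ _).1 (open_nbhs_nbhs (conj oOV Ox)).
    have cst := @zero_derivative_cst R G x r.
    have [y [xy yx] _] := not_in_seq [:: x] (@disk_open R x r) (disk_center x r0) r0.
    have E1 : G y = G x.
      apply: cst => // z /Hr Oz; apply: contrapT => K; apply: H; by exists z.
    have [Vy Dy] : V y /\ (B `|` V) x by have [_ ?] := Hr y xy; split => //; right.
    by move: yx; rewrite (injG Vy Dy E1) inE eqxx.
  exists w; split => //.
  have Dw : (B `|` V) w by right.
  have [c Hc] := (cderivableP _ _).1 (dG Dw (nS w Vw)).
  have c0 : 0 < cabs c.
    rewrite cabs_gt0; apply/eqP => cE; apply: nd => e e0.
    by have := Hc e e0; apply: filterS => z; rewrite cE mul0r subr0.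
  have [e /= e0 He] := (nbhs_cabs _ _).1 (Hc _ (divr_gt0 c0 (@ltr0n R 2))).
  have cA : compact (Ks `&` [set z | e <= cabs (z - w)]).
    apply: (subclosed_compact _ cKs); last by move=> z [].
    by apply: closedI; [exact: compact_closedC|apply: closed_geC; exact: continuous_cabsB].
  have Gnw z : Ks z -> z != w -> G z - G w != 0.
    move=> Kz; apply: contraNneq => /subr0_eq E1.
    by rewrite (injG Vw (KsD Kz) (esym E1)).
  have nzA z : (Ks `&` [set z | e <= cabs (z - w)]) z ->
      {for z, continuous (fun z => (G z - G w)^-1)}.
    move=> [Kz ez]; apply: (contV (f := fun z => G z - G w)).
      apply: Gnw => //; apply/eqP => zw; move: ez.
      by rewrite zw /= subrr cabs0 leNgt e0.
    exact: (contB (cG (KsD Kz)) (@cst_continuous _ _ (G w) z)).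
  have [P P0 HP] := compact_cont_bound cA nzA.
  have b1 : 0 < Num.min (cabs c / 2) (P * D)^-1.
    by rewrite lt_min divr_gt0//= invr_gt0 mulr_gt0.
  apply: (Esub w (w :: S) _ Ow _ _ _ b1).
  - by move=> z; rewrite inE => /orP[/eqP ->|/SOs//]; exact/KtOs/OtKt.
  - by move=> z zS; rewrite inE zS orbT.
  - by rewrite inE eqxx.
  move=> z Kz; rewrite inE negb_or => /andP[zw _].
  have zw0 : 0 < cabs (z - w) by rewrite cabs_gt0 subr_eq0.
  have [ze|ez] := ltP (cabs (z - w)) e.
    apply: (@le_trans _ _ (cabs c / 2 * cabs (z - w))).
      by rewrite ler_pM2r// ge_min lexx.
    have := He z ze; rewrite cabsB => h1.
    have := cabsD (G z - G w) (c * (z - w) - (G z - G w)).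
    rewrite addrC subrK cabsM => h2; move: h1 h2; rewrite mulrAC.
    move: (cabs (c * (z - w) - (G z - G w))) (cabs (G z - G w)) (cabs c * _) => p q r.
    by lra.
  apply: (@le_trans _ _ ((P * D)^-1 * cabs (z - w))).
    by rewrite ler_pM2r// ge_min lexx orbT.
  have := HP z (conj Kz ez); rewrite cabsV => HPz.
  have gz : 0 < cabs (G z - G w) by rewrite cabs_gt0 Gnw.
  apply: (@le_trans _ _ P^-1).
    rewrite invfM -mulrA; apply: ler_piMr; first by rewrite invr_ge0; exact: ltW.
    by rewrite mulrC ler_pdivrMr// mul1r; apply: HD => //; exact/OsKs/KtOs/OtKt.
  by rewrite -[leRHS]invrK lef_pV2// posrE// invr_gt0.
have LipK w : Ks w -> exists2 l : R, 0 <= l &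
    forall z, Ks z -> cabs (G z - G w) <= l * cabs (z - w).
  move=> Kw; have [l /nbhs_cabs[e e0 He]] := lipG (KsD Kw).
  exists (`|l| + 2 * M / e); first by rewrite addr_ge0// divr_ge0 ?mulr_ge0// ltW.
  move=> z Kz; rewrite mulrDl.
  have h1 : 0 <= `|l| * cabs (z - w) by rewrite mulr_ge0 ?cabs_ge0.
  have h2 : 0 <= 2 * M / e * cabs (z - w).
    by rewrite mulr_ge0 ?cabs_ge0// divr_ge0 ?mulr_ge0// ltW.
  have [ze|ez] := ltP (cabs (z - w)) e.
    apply: le_trans (He z ze) _; apply: (@le_trans _ _ (`|l| * cabs (z - w))).
      by rewrite ler_wpM2r ?cabs_ge0// ler_norm.
    by rewrite lerDl.
  apply: (@le_trans _ _ (2 * M)).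
    apply: le_trans (cabsD _ _) _; rewrite cabsN.
    have := HM z Kz; have := HM w Kw.
    by move: (cabs (G z)) (cabs (G w)) => p q; lra.
  apply: (@le_trans _ _ (2 * M / e * cabs (z - w))); last by rewrite lerDr.
  by rewrite mulrAC ler_pdivlMr// ler_wpM2l// mulr_ge0// ltW.
have openE w : Ot w -> E w -> \forall w' \near w, Ot w' -> E w'.
  move=> Ow Ew; have Kw := OtKt Ow; have Ksw := OsKs (KtOs Kw).
  have k0 : 0 < be / 2 * d ^+ 2 by rewrite mulr_gt0 ?divr_gt0 ?exprn_gt0.
  (* On the rim, the denominator of the difference p of the quotients based at w and w' is at least
     d^2; k1 and k2 make each of the two terms of its numerator at most half of (be/2) d^2. Hence p
     is at most be/2, the quotients at w' are at least be/2, and [Esub] restores be. *)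
  pose k1 := be / 2 * d ^+ 2 / (4 * M); pose k2 := be / 2 * d ^+ 2 / (2 * D).
  have k10 : 0 < k1 by rewrite divr_gt0// mulr_gt0.
  have k20 : 0 < k2 by rewrite divr_gt0// mulr_gt0.
  have n1 := nbhs_cdisk w k10.
  have n2 := (continuous_cabsP _ _).1 (cG (KsD Ksw)) _ k20.
  apply: filterS2 n1 n2 => w' ww' Gw' Ow'.
  have [->//|w'w] := eqVneq w' w.
  have Kw' := OtKt Ow'; have Ksw' := OsKs (KtOs Kw').
  have be2 : 0 < be / 2 by rewrite divr_gt0.
  pose S' := [:: w, w' & S].
  have S'O z : z \in S' -> Os z.
    rewrite !inE => /orP[/eqP ->|/orP[/eqP ->|/SOs//]]; exact: KtOs.
  have nin z : z \notin S' -> [/\ z - w != 0, z - w' != 0 & z \notin S].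
    by rewrite !inE !negb_or !subr_eq0 => /and3P[].
  apply: (Esub w' S' _ Ow' S'O _ _ be2).
  - by move=> z zS; rewrite !inE zS !orbT.
  - by rewrite !inE eqxx orbT.
  have [l l0 Hl] := LipK w Ksw; have [l' l'0 Hl'] := LipK w' Ksw'.
  pose p z := (G z - G w) * (z - w)^-1 - (G z - G w') * (z - w')^-1.
  have key z : Ks z -> z \notin S' -> cabs (p z) <= be / 2.
    apply: (@max_modulus R Ks Os S' p (be / 2) (l + l') cKs oOs OsKs (ltW be2) S'O).
    - move=> y Ky /nin[h1 h2 _]; apply: contB.
        apply: contM; first exact: (contB (cG (KsD Ky)) (@cst_continuous _ _ (G w) y)).
        exact: (contV (f := fun y => y - w) h1 (contB cvg_id (@cst_continuous _ _ w y))).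
      apply: contM; first exact: (contB (cG (KsD Ky)) (@cst_continuous _ _ (G w') y)).
      exact: (contV (f := fun y => y - w') h2 (contB cvg_id (@cst_continuous _ _ w' y))).
    - move=> y Oy /nin[h1 h2 yS] _; have dy := dG (KsD (OsKs Oy)) yS; apply: cderB.
        apply: cderM; first by apply: cderB; [exact: dy|exact: cder_cst].
        apply: (@cderV _ (fun y => y - w) y h1).
        by apply: cderB; [exact: cder_id|exact: cder_cst].
      apply: cderM; first by apply: cderB; [exact: dy|exact: cder_cst].
      apply: (@cderV _ (fun y => y - w') y h2).
      by apply: cderB; [exact: cder_id|exact: cder_cst].
    - move=> y Ky /nin[h1 h2 _]; apply: le_trans (cabsD _ _) _; rewrite cabsN !cabsM !cabsV.
      by apply: lerD; rewrite ler_pdivrMr ?cabs_gt0//; [exact: Hl|exact: Hl'].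
    - move=> y Ky nOy; have Ly : L y by [].
      have d1 := Hd y w Ly Kw; have d2 := Hd y w' Ly Kw'.
      have y1 : 0 < cabs (y - w) by exact: lt_le_trans d1.
      have y2 : 0 < cabs (y - w') by exact: lt_le_trans d2.
      have h1 : y - w != 0 by rewrite -cabs_gt0.
      have h2 : y - w' != 0 by rewrite -cabs_gt0.
      have -> : p y = ((G y - G w) * (w - w') + (G w' - G w) * (y - w)) *
          ((y - w) * (y - w'))^-1.
        by rewrite /p; field; rewrite h1 h2.
      rewrite cabsM cabsV ler_pdivrMr ?cabsM ?mulr_gt0//.
      apply: (@le_trans _ _ (be / 2 * d ^+ 2)); last first.
        rewrite ler_pM2l// expr2; apply: ler_pM => //; exact: ltW.
      apply: le_trans (cabsD _ _) _; rewrite !cabsM (cabsB w).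
      have g1 : cabs (G y - G w) * cabs (w' - w) <= 2 * M * k1.
        apply: ler_pM; try exact: cabs_ge0; last exact: ltW.
        apply: le_trans (cabsD _ _) _; rewrite cabsN.
        have := HM y Ky; have := HM w Ksw.
        by move: (cabs (G y)) (cabs (G w)) => p' q; lra.
      have g2 : cabs (G w' - G w) * cabs (y - w) <= k2 * D.
        apply: ler_pM; try exact: cabs_ge0; first exact: ltW.
        exact: HD.
      have e1 : 2 * M * k1 = be / 2 * d ^+ 2 / 2 by rewrite /k1; field; rewrite gt_eqF.
      have e2 : k2 * D = be / 2 * d ^+ 2 / 2 by rewrite /k2; field; rewrite gt_eqF.
      rewrite e1 in g1; rewrite e2 in g2.
      by apply: le_trans (lerD g1 g2) _; rewrite -splitr.
  move=> z Kz zS'; have [h1 h2 _] := nin z zS'.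
  have := key z Kz zS'; have := Ew.2 z Kz.
  have y1 : 0 < cabs (z - w) by rewrite cabs_gt0.
  have y2 : 0 < cabs (z - w') by rewrite cabs_gt0.
  have -> : cabs (G z - G w) = cabs ((G z - G w) * (z - w)^-1) * cabs (z - w).
    by rewrite cabsM cabsV divfK// gt_eqF.
  have -> : cabs (G z - G w') = cabs ((G z - G w') * (z - w')^-1) * cabs (z - w').
    by rewrite cabsM cabsV divfK// gt_eqF.
  rewrite !ler_pM2r//.
  have := cabsD (p z) ((G z - G w') * (z - w')^-1); rewrite /p subrK.
  move: (cabs (_ - _ * _)) (cabs ((G z - G w) * _)) (cabs ((G z - G w') * _)) => x1 x2 x3.
  by lra.
have OtE : Ot `&` E = Ot.
  apply: (fil_conn fil t01).
  - by have [w [Ow Ew]] := start; exists w.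
  - exists E°; first exact: open_interior.
    apply/seteqP; split => w [Ow Ew]; split => //; last exact: interior_subset.
    have nO := open_nbhs_nbhs (conj oOt Ow).
    by apply: filterS2 nO (openE w Ow Ew) => w' Ow'; apply.
  - exists (closure E); first exact: closed_closure.
    apply/seteqP; split => w [Ow Ew]; split => //; first exact: subset_closure.
    split; first exact: OtKt.
    move=> z Kz; rewrite leNgt; apply/negP => h.
    have h' : cabs (G w - G z) < be * cabs (w - z) by rewrite cabsB (cabsB w).
    have Dw : (B `|` V) w by exact/KsD/OsKs/KtOs/OtKt.
    have [w' [[_ Ew'] Hw']] := Ew _ (negnear w (G z) z Dw h').
    by have := Ew' z Kz; rewrite leNgt (cabsB z) (cabsB (G z)) Hw'.
move=> Bw1 Bw2 E12.
have [_ [_ Ew1]] : (Ot `&` E) w1 by rewrite OtE; left.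
have Kw2 : Ks w2 by left.
have := Ew1 w2 Kw2; rewrite E12 subrr cabs0 pmulr_rle0//.
move=> h; apply/eqP; rewrite eq_sym -subr_eq0 -cabs_eq0 eq_le h cabs_ge0 //.
Qed.

End InjectiveFill.

(** * At most one pole in a hole *)

Section OnePole.
Variable R : realType.
Local Notation C := (Cplx R).
Variable f : C -> Csphere R.
Hypothesis merof : meromorphic f.

(** Both poles are zeros of G = 1/(f - a), so [injective_fill] identifies them. It requires G to
    separate points of V from those of B: f(B) misses W = f(V) by [hole_image_disjoint]. *)
Lemma hole_one_pole V tau W tau' B a w1 w2 : annulus_map f V tau W tau' ->
  filled V tau B -> omitted f (Some a) -> B w1 -> B w2 ->
  is_pole f w1 -> is_pole f w2 -> w1 = w2.
Proof.
move=> am fil oma Bw1 Bw2 p1 p2.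
have [S HS] := poles_finite merof (hole_compact (ann_open (am_ann am)) (fil_hole fil)).
have cG z : {for z, continuous (finv f a)} by apply: finv_continuous => //; exact: oma.
apply: (@injective_fill R (finv f a) V tau B S fil) => //.
- by move=> z /HS[].
- move=> z [Bz|Vz] zS; apply: finv_derivable => //; try exact: oma.
    by move=> pz; move/negP: zS; apply; exact/HS.
  exact: nonpole_V am _ Vz.
- move=> z z' Vz Dz' E.
  have nz := nonpole_V am Vz; have fz := nonpoleE nz.
  have nz' : ~ is_pole f z'.
    move=> pz'; move: E; rewrite (finv_pole a pz') finv_nonpole// => /eqP.
    rewrite invr_eq0 subr_eq0 => /eqP E; apply: (oma z); by rewrite fz E.
  have fz' := nonpoleE nz'.
  have ff : f z = f z'.
    by move: E; rewrite !finv_nonpole// => /invr_inj /addIr E; rewrite fz fz' E.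
  case: Dz' => [Bz'|Vz']; last exact: (am_inj am).
  have [y [fy Wy _]] := am_to am Vz.
  exfalso; apply: (hole_image_disjoint merof am fil oma Bw1 p1 Bz' _ Wy).
  by rewrite -ff fy.
- by rewrite !finv_pole.
Qed.

End OnePole.

(** * Round annuli *)

Section Connectivity.
Variable R : realType.
Local Notation C := (Cplx R).

Lemma cabs_real (t : R) : cabs ((t%:C)%C : C) = `|t|.
Proof. by rewrite /cabs /= expr0n /= addr0 sqrtr_sqr. Qed.

Lemma continuous_line (z v : C) : continuous (fun t : R => z + (t%:C)%C * v : C).
Proof.
move=> t; apply/continuous_cabsP => e e0.
have q0 : 0 < e / (cabs v + 1) by rewrite divr_gt0// ltr_wpDl// cabs_ge0.
apply/nbhs_ballP; exists (e / (cabs v + 1)) => // s; rewrite /ball /= distrC => st.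
have -> : z + (s%:C)%C * v - (z + (t%:C)%C * v) = ((s - t)%:C)%C * v.
  by rewrite (rmorphB (real_complex R)); ring.
rewrite cabsM cabs_real; move: st; rewrite ltr_pdivlMr ?ltr_wpDl ?cabs_ge0//.
by apply: le_lt_trans; rewrite ler_wpM2l// lerDl.
Qed.

Lemma disk_connected (z : C) (e : R) : 0 < e -> connected (disk z e).
Proof.
move=> e0.
have -> : disk z e = \bigcup_(w in disk z e) ((fun t : R => z + (t%:C)%C * (w - z)) @` `[0, 1]).
  apply/seteqP; split => w.
    move=> wz; exists w => //; exists 1; first by rewrite /= in_itv /= ler01 lexx.
    by rewrite mul1r addrC subrK.
  move=> [x xz [t]]; rewrite /= in_itv /= => /andP[t0 t1] <-.
  rewrite /disk /= addrAC subrr add0r cabsM cabs_real ger0_norm//.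
  by apply: le_lt_trans xz; rewrite ler_piMl ?cabs_ge0.
apply: bigcup_connected.
  exists z => w wz; exists 0; first by rewrite /= in_itv /= ler01 lexx.
  by rewrite mul0r addr0.
move=> w wz; apply: connected_continuous_connected; first exact: segment_connected.
by apply: continuous_subspaceT => t; exact: continuous_line.
Qed.

Lemma component_open (A : set C) (x : C) : open A -> open (connected_component A x).
Proof.
move=> oA; rewrite openE => y Ay.
have [e e0 eA] := (nbhs_cabs _ _).1 (open_nbhs_nbhs (conj oA (connected_component_sub Ay))).
apply/nbhs_cabs; exists e => // w wy.
rewrite (same_connected_component Ay).
apply: (connected_component_max _ _ (@disk_connected y e e0)) => //.
exact: disk_center.
Qed.

Lemma polar (z : C) : exists t : R, z = (((cabs z)%:C)%C : C) * cexpi t.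
Proof.
have [->|z0] := eqVneq z 0; first by exists 0; rewrite cabs0 mul0r.
have r0 : 0 < cabs z by rewrite cabs_gt0.
pose x := complex.Re z / cabs z; pose y := complex.Im z / cabs z.
have xy : x ^+ 2 + y ^+ 2 = 1.
  rewrite /x /y !expr_div_n -mulrDl -cabs2 divff// expf_neq0// gt_eqF//.
have x1 : -1 <= x <= 1.
  rewrite -ler_norml -(@ler_pXn2r _ 2) ?nnegrE// expr1n real_normK ?num_real//.
  by rewrite -xy lerDl sqr_ge0.
have sx : Num.sqrt (1 - x ^+ 2) = `|y|.
  by rewrite -xy addrAC subrr add0r sqrtr_sqr.
have zE (t : R) : cos t = x -> sin t = y -> z = (((cabs z)%:C)%C : C) * cexpi t.
  move=> ct st; rewrite /cexpi ct st /x /y; move: r0; move: (cabs z) => r r0.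
  case: (z) => a b; apply/eqP; rewrite eq_complex /= !mul0r subr0 addr0.
  have rn : r != 0 by rewrite gt_eqF.
  by rewrite ![r * _]mulrC !(divfK rn) !eqxx.
have [y0|y0] := leP 0 y.
  exists (acos x); apply: zE; first by rewrite acosK// in_itv.
  by rewrite sin_acos// sx ger0_norm.
exists (- acos x); apply: zE; first by rewrite cosN acosK// in_itv.
by rewrite sinN sin_acos// sx ltr0_norm// opprK.
Qed.

Lemma cabs_cexpi (t : R) : cabs (cexpi t : C) = 1.
Proof. by rewrite /cexpi /cabs /= cos2Dsin2 sqrtr1. Qed.

Lemma continuous_circle (r : R) : continuous (fun t : R => (((r%:C)%C : C) * cexpi t) : C).
Proof.
move=> t; apply: (@contM _ _ (fun=> ((r%:C)%C : C)) (@cexpi R) t).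
  exact: cst_continuous.
apply/continuous_cabsP => e e0; have h : 0 < e / 2 by rewrite divr_gt0.
near=> s; apply: le_lt_trans (cabs_le_ReIm _) _; rewrite [e]splitr.
apply: ltrD; near: s.
  exact: (cvgr_distC_lt _ _ (@continuous_cos R t) _ h).
exact: (cvgr_distC_lt _ _ (@continuous_sin R t) _ h).
Unshelve. all: by end_near. Qed.

(** The annulus is a union of circles, each joined to one common radial segment. *)
Lemma round_annulus_connected (a b : R) : 0 <= a ->
  connected [set z : C | a < cabs z < b].
Proof.
move=> a0; have [ba|ab] := leP b a.
  rewrite (_ : [set z | _] = set0); first exact: connected0.
  apply/seteqP; split => // z /andP[h1 h2].
  by have := lt_trans h1 h2; rewrite ltNge ba.
pose ray := (fun t : R => (((t%:C)%C : C))) @` `]a, b[.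
pose circ (r : R) := range (fun t : R => (((r%:C)%C : C)) * cexpi t).
have cray : connected ray.
  apply: connected_continuous_connected; first by apply/connected_intervalP/interval_is_interval.
  apply: continuous_subspaceT => t.
  have := @continuous_line 0 1 t.
  by rewrite (_ : (fun t : R => 0 + (t%:C)%C * 1 : C) = (fun t : R => ((t%:C)%C : C)))//;
     apply/funext => s; rewrite mulr1 add0r.
have ccirc r : connected (circ r).
  apply: connected_continuous_connected.
    by apply/connected_intervalP => x y _ _ z _.
  by apply: continuous_subspaceT => t; exact: continuous_circle.
have -> : [set z : C | a < cabs z < b] = \bigcup_(r in `]a, b[) (circ r `|` ray).
  apply/seteqP; split => z.
    move=> zab; exists (cabs z); first by rewrite /= in_itv.
    by left; have [t zt] := polar z; exists t.
  move=> [r]; rewrite /= in_itv /= => /andP[ar rb] [[t _ <-]|[t]].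
    by rewrite cabsM cabs_cexpi mulr1 cabs_real ger0_norm ?ar// ltW// (le_lt_trans a0).
  rewrite /= in_itv /= => /andP[at' tb] <-; rewrite cabs_real ger0_norm ?at'//.
  by rewrite ltW// (le_lt_trans a0).
apply: bigcup_connected.
  exists ((((a + b) / 2)%:C)%C : C) => r _; right; exists ((a + b) / 2) => //.
  by rewrite /= in_itv /=; lra.
move=> r; rewrite /= in_itv /= => rab; apply: connectedU => //.
exists ((r%:C)%C : C); split; last by exists r; rewrite //= in_itv.
by exists 0 => //; rewrite /cexpi cos0 sin0 mulr1.
Qed.

End Connectivity.

(** * The cycle of a Herman ring *)

Section Dynamics.
Variable R : realType.
Local Notation C := (Cplx R).
Local Notation Chat := (Csphere R).
Variable f : C -> Chat.
Hypothesis merof : meromorphic f.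
Local Notation g := (finite_part f).
Local Notation F := (fatou_set f).

Lemma fatou_open : open F.
Proof.
rewrite openE => z [U [[oU Uz] defU nU]].
by apply: filterS (open_nbhs_nbhs (conj oU Uz)) => w Uw; exists U.
Qed.

Lemma fatou_component_open U : fatou_component f U -> open U.
Proof. by move=> [z Fz ->]; apply: component_open; exact: fatou_open. Qed.

Lemma fatou_component_connected U : fatou_component f U -> connected U.
Proof. by move=> [z Fz ->]; exact: component_connected. Qed.

Lemma fatou_component_sub U : fatou_component f U -> U `<=` F.
Proof. by move=> [z Fz ->]; exact: connected_component_sub. Qed.

Lemma fatou_component_nonempty U : fatou_component f U -> U !=set0.
Proof. by move=> [z Fz ->]; exists z; exact: connected_component_refl. Qed.

Lemma fatou_component_eq U z : fatou_component f U -> U z ->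
  U = connected_component F z.
Proof. by move=> [x Fx ->] h; exact: same_connected_component. Qed.

(** [fiter_defined] looks only at ranks strictly below its argument, so finiteness at rank n comes
    from definedness at rank n + 1. *)
Lemma fatou_finite z n : F z -> fiter f n z <> None.
Proof.
move=> [U [[oU Uz] defU nU]].
exact: (defU n.+1 z (ltn0Sn n) Uz n (ltnSn n)).
Qed.

Lemma fatou_nonpole z : F z -> ~ is_pole f z.
Proof. by move=> Fz; exact: (fatou_finite (n := 1) Fz). Qed.

Lemma fiterSr n z : ~ is_pole f z -> fiter f n.+1 z = fiter f n (g z).
Proof. by move=> pz; rewrite /fiter iterSr /= (nonpoleE pz). Qed.

Lemma fiter_iter n z : (forall k, (k < n)%N -> F (iter k g z)) ->
  fiter f n z = Some (iter n g z).
Proof.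
elim: n => [//|n IH] H; rewrite /fiter iterS -/(fiter f n z) IH; last first.
  by move=> k kn; apply: H; exact: ltn_trans kn _.
by rewrite /= (nonpoleE (fatou_nonpole (H n (ltnSn n)))).
Qed.

(** The iterates f^k on the image D of a small disk, read at f(w), are the iterates f^(k+1) at w, so
    normality descends. The fibres being discrete makes D open. *)
Lemma fatou_image (W : set C) z : open W -> W `<=` F -> W z ->
  (forall w, W w -> \forall x \near w, x != w -> g x <> g w) -> F (g z).
Proof.
move=> oW WF Wz iso.
have [U [[oU Uz] defU nU]] := WF z Wz.
have [e0 e00 He0] := (nbhs_cabs _ _).1 (open_nbhs_nbhs (conj (openI oW oU) (conj Wz Uz))).
pose e := e0 / 2; have e_gt0 : 0 < e by rewrite divr_gt0.
have cdWU w : cdisk z e w -> W w /\ U w.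
  rewrite /cdisk /= => we; have := He0 w; case => //.
  by apply: le_lt_trans we _; rewrite /e; lra.
have dc w : disk z e w -> cdisk z e w by move/ltW.
have np w : W w -> ~ is_pole f w by move/WF/fatou_nonpole.
pose D := fimage f (disk z e).
have oD : open D.
  rewrite openE => v [w zw fw].
  have [Ww _] := cdWU w (dc w zw).
  apply: (fimage_open_isolated merof fw).
    by apply: open_nbhs_nbhs; split => //; exact: disk_open.
  have nW := open_nbhs_nbhs (conj oW Ww).
  apply: filterS2 nW (iso w Ww) => x Wx H xw fx; apply: (H xw).
  by rewrite (finite_partE fx) (finite_partE fw).
have Dgz : D (g z).
  by exists z; [exact: disk_center|exact/nonpoleE/np].
have shift n w : cdisk z e w -> fiter f n.+1 w = fiter f n (g w).
  by move=> /cdWU[/np pw _]; exact: fiterSr.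
exists D; split.
- by split.
- move=> n v n0 [w zw fw] k kn; have zw' := dc w zw.
  rewrite -(finite_partE fw) -(shift _ _ zw').
  have [_ Uw] := cdWU w zw'.
  exact: (defU n.+1 w (ltn0Sn n) Uw k.+1).
- move=> h Hh.
  have [k Hk] : exists k : nat -> nat, forall n, (0 < k n)%N /\ fiter f (k n) = h n.
    have H n : {m | (0 < m)%N /\ fiter f m = h n}.
      by apply: cid; have [m m0 mh] := Hh n; exists m.
    by exists (fun n => sval (H n)) => n; exact: (svalP (H n)).
  have [n|s [l [smono ucv]]] := nU (fun n => fiter f (k n).+1).
    by exists (k n).+1.
  (* The limit at v is read at a chosen preimage. The choice is uncontrolled, so convergence must be
     uniform on the whole closed disk; compactness provides this from local uniformity. *)
  pose pre v := xget (0 : C) [set w | disk z e w /\ f w = Some v].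
  exists s, (fun v => l (pre v)); split => // v0 Dv0.
  exists D; first exact: (open_nbhs_nbhs (conj oD Dv0)).
  move=> eps eps0.
  have /compact_near_coveringP cz : compact (cdisk z e) by exact: cdisk_compact.
  have near_all : \forall n \near \oo, cdisk z e `<=`
      [set w | chordal (fiter f (k (s n)).+1 w) (l w) < eps].
    apply: (cz nat \oo (fun n w => chordal (fiter f (k (s n)).+1 w) (l w) < eps)).
    move=> x zx; have [_ Ux] := cdWU x zx.
    have [V nV HV] := ucv x Ux.
    exists (V `&` U, [set n | forall w, U w -> V w ->
        chordal (fiter f (k (s n)).+1 w) (l w) < eps]) => /=.
      split; last exact: HV.
      by apply: filterI => //; exact: (open_nbhs_nbhs (conj oU Ux)).
    by move=> [w n] /= [[Vw Uw] Hn]; exact: Hn.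
  apply: filterS near_all => n Hn v Dv _.
  have [pz fpre] : disk z e (pre v) /\ f (pre v) = Some v.
    have ex : exists w, [set w | disk z e w /\ f w = Some v] w.
      by have [w zw fw] := Dv; exists w.
    exact: (xgetPex 0 ex).
  have K : chordal (fiter f (k (s n)).+1 (pre v)) (l (pre v)) < eps := Hn _ (dc _ pz).
  move: K; rewrite (shift _ _ (dc _ pz)) (finite_partE fpre).
  by have [_ ->] := Hk (s n).
Qed.

Lemma component_iter_eq (U X : set C) k : U !=set0 -> fatou_component f X ->
  fiter f k @` U `<=` Some @` X -> component_iter f U k = X.
Proof.
move=> [u Uu] cX UX.
have ex : exists V, [set V | fatou_component f V /\ fiter f k @` U `<=` Some @` V] V.
  by exists X.
have [cV UV] := xgetPex set0 ex; rewrite -/(component_iter f U k) in cV UV.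
have fu : (fiter f k @` U) (fiter f k u) by exists u.
have [x Xx xu] := UX _ fu; have [y Vy yu] := UV _ fu.
have xy : x = y by move: xu; rewrite -yu => -[].
by rewrite (fatou_component_eq cX Xx) (fatou_component_eq cV (_ : _ x))// xy.
Qed.

Variables (p : nat) (H : set C).
Hypothesis Hherman : herman_ring f p H.

Let Hper := Hherman.1.
Let compH : fatou_component f H. Proof. by case: Hper. Qed.
Let p0 : (0 < p)%N. Proof. by case: Hper. Qed.
Let H0 : H !=set0. Proof. exact: fatou_component_nonempty. Qed.

Let W k := component_iter f H k.
Let G k := iter k g.

Lemma W_0 : W 0%N = H.
Proof. by apply: component_iter_eq => // _ [x Hx <-]; exists x. Qed.

Let W_p : W p = H. Proof. by case: Hper. Qed.

(** [component_iter] returns the empty set when no component qualifies; since W p = H is nonempty,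
    it was a genuine choice and the inclusion holds. *)
Let fp_sub : fiter f p @` H `<=` Some @` H.
Proof.
have [[V HV]|nV] := pselect (exists V, [set V | fatou_component f V /\
    fiter f p @` H `<=` Some @` V] V).
  by have [_] := xgetPex set0 (ex_intro _ V HV); rewrite -/(component_iter f H p) -/(W p) W_p.
have WE : W p = set0 by apply: xgetPN => V HV; apply: nV; exists V.
by move: H0; rewrite -W_p WE => -[].
Qed.

Lemma herman_data : exists (r : R) (phi psi : C -> C) (c : C), [/\ 1 < r, cabs c = 1,
  analytic_homeomorphism H (annulus r) phi psi &
  forall x, H x -> exists y, [/\ fiter f p x = Some y, H y & phi y = c * phi x]].
Proof.
have [_ [r [al [phi [psi [r1 _ hom Hrot]]]]]] := Hherman.
exists r, phi, psi, (cexpi (2 * pi * al)); split => //; first exact: cabs_cexpi.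
move=> x Hx; have [h1 h2 h3 h4] := hom.
have [Ax xE] := h1 x Hx.
have := Hrot _ Ax; rewrite xE.
have [|y Hy fy] := fp_sub (_ : (fiter f p @` H) (fiter f p x)); first by exists x.
by rewrite -fy => -[E]; exists y.
Qed.

(** The next image lies in the Fatou set by [fatou_image], provided that the fibres of g in W k are
    discrete. Were g constant on W k, then f^(k+1) and hence f^p would be constant on H, whereas f^p
    is conjugate to a rotation; this is why k stays at most p. *)
Lemma W_invariant k : (k <= p)%N ->
  [/\ fatou_component f (W k), forall x, H x -> W k (G k x),
    forall x, H x -> forall j, (j < k)%N -> F (G j x) &
    forall j, (j < k)%N -> [/\ forall z, W j z -> \forall x \near z, x != z -> g x <> g z
      & forall z, W j z -> W j.+1 (g z)] ].
Proof.
elim: k => [_|k IH kp].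
  rewrite W_0; split => //.
have [cW GW GF inv] := IH (ltnW kp).
have oW := fatou_component_open cW; have cnW := fatou_component_connected cW.
have WF := fatou_component_sub cW.
have dg z : W k z -> derivable g z 1.
  by move=> /WF /fatou_nonpole /nonpole_derivable; apply.
have iso z : W k z -> \forall x \near z, x != z -> g x <> g z.
  move=> Wz; apply: (not_cst_isolated oW cnW dg Wz) => cst.
  have [r [phi [psi [c [r1 c1 [h1 h2 h3 h4] Hp]]]]] := herman_data.
  have inj x x' : H x -> H x' -> x = x'.
    move=> Hx Hx'.
    have E : fiter f k.+1 x = fiter f k.+1 x'.
      have e1 y : H y -> fiter f k.+1 y = Some (g z).
        move=> Hy; rewrite fiter_iter; first by rewrite iterS cst//; exact: GW.
        move=> j; rewrite ltnS leq_eqVlt => /orP[/eqP ->|jk]; first exact/WF/GW.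
        exact: GF.
      by rewrite !e1.
    have E' : fiter f p x = fiter f p x'.
      rewrite -(subnK kp) /fiter !iterD -/(fiter f k.+1 x) -/(fiter f k.+1 x').
      by rewrite E.
    have [y [fy _ py]] := Hp x Hx; have [y' [fy' _ py']] := Hp x' Hx'.
    have yy : y = y' by move: E'; rewrite fy fy' => -[].
    have c0 : c != 0 by rewrite -cabs_gt0 c1.
    have /(mulfI c0) pp : c * phi x = c * phi x' by rewrite -py -py' yy.
    by have [_ <-] := h1 x Hx; have [_ <-] := h1 x' Hx'; rewrite pp.
  have [x Hx] := H0.
  have [e e0 He] := (nbhs_cabs _ _).1 (open_nbhs_nbhs (conj (fatou_component_open compH) Hx)).
  have [y [Hy yx] _] := not_in_seq [:: x] (fatou_component_open compH) Hx e0.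
  by move: yx; rewrite (inj y x Hy Hx) inE eqxx.
have gF z : W k z -> F (g z) by move=> Wz; exact: (fatou_image oW WF Wz iso).
have [x Hx] := H0.
have Wx := GW x Hx.
pose X := connected_component F (g (G k x)).
have cX : fatou_component f X by exists (g (G k x)) => //; exact: gF.
have gX z : W k z -> X (g z).
  move=> Wz; have : (g @` W k) (g z) by exists z.
  apply: connected_component_max; first by exists (G k x).
    by move=> _ [y Wy <-]; exact: gF.
  apply: connected_continuous_connected => //.
  by apply: continuous_in_subspaceT => y /set_mem /dg /cderivable_continuous.
have GF' y : H y -> forall j, (j < k.+1)%N -> F (G j y).
  move=> Hy j; rewrite ltnS leq_eqVlt => /orP[/eqP ->|jk]; first exact/WF/GW.
  exact: GF.
have WX : W k.+1 = X.
  apply: component_iter_eq => // _ [y Hy <-].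
  rewrite fiter_iter; last by move=> j jk; exact: GF'.
  by exists (g (G k y)) => //; apply: gX; exact: GW.
rewrite WX; split => //.
- by move=> y Hy; apply: gX; exact: GW.
- move=> j; rewrite ltnS leq_eqVlt => /orP[/eqP ->|jk]; last exact: inv.
  by split => // z Wz; rewrite WX; exact: gX.
Qed.

Lemma W_comp k : (k <= p)%N -> fatou_component f (W k).
Proof. by move=> /W_invariant[]. Qed.

Lemma W_isolated k z : (k < p)%N -> W k z -> \forall x \near z, x != z -> g x <> g z.
Proof.
by move=> kp Wz; have [_ _ _ /(_ k kp)[iso _]] := W_invariant (leqnn p); exact: iso.
Qed.

Lemma W_step k z : (k < p)%N -> W k z -> W k.+1 (g z).
Proof.
by move=> kp Wz; have [_ _ _ /(_ k kp)[_ st]] := W_invariant (leqnn p); exact: st.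
Qed.

Lemma W_derivable k z : (k <= p)%N -> W k z -> derivable g z 1.
Proof.
move=> kp /(fatou_component_sub (W_comp kp)) /fatou_nonpole.
exact: nonpole_derivable.
Qed.

Lemma W_iter k j z : (k + j <= p)%N -> W k z -> W (k + j) (G j z).
Proof.
elim: j => [|j IH] kjp Wz; first by rewrite addn0.
by rewrite addnS in kjp *; apply: W_step => //; apply: IH => //; exact: ltnW.
Qed.

Lemma W_iter_continuous k j z : (k + j <= p)%N -> W k z -> {for z, continuous (G j)}.
Proof.
elim: j => [|j IH] kjp Wz; first exact: cvg_id.
rewrite addnS in kjp.
have cj := IH (ltnW kjp) Wz.
apply: (continuous_comp cj); apply: cderivable_continuous.
exact: (W_derivable (ltnW kjp) (W_iter (ltnW kjp) Wz)).
Qed.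

Lemma GE x : H x -> fiter f p x = Some (G p x).
Proof.
move=> Hx; apply: fiter_iter => k kp.
by have [_ _ + _] := W_invariant (leqnn p); apply.
Qed.

Lemma W_iterH k x : (k <= p)%N -> H x -> W k (G k x).
Proof. by move=> /W_invariant[_ + _ _]; apply. Qed.

Lemma G_image_open k : (k <= p)%N -> open (G k @` H).
Proof.
elim: k => [_|k IH kp].
  by rewrite image_id; exact: fatou_component_open.
rewrite openE => v [x Hx <-].
have Wx := W_iterH (ltnW kp) Hx.
have pz := fatou_nonpole (fatou_component_sub (W_comp (ltnW kp)) Wx).
have nU := open_nbhs_nbhs (conj (IH (ltnW kp)) (ex_intro2 _ _ x Hx erefl)).
have oW := open_nbhs_nbhs (conj (fatou_component_open (W_comp (ltnW kp))) Wx).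
have := fimage_open_isolated merof (nonpoleE pz) nU.
have iso : \forall z \near G k x, z != G k x -> f z <> Some (g (G k x)).
  apply: filterS2 oW (W_isolated kp Wx) => z Wz Hz zx fz; apply: (Hz zx).
  by rewrite (finite_partE fz).
move=> /(_ iso); apply: filterS => u [_ [y Hy <-] fy].
by exists y => //=; rewrite (finite_partE fy).
Qed.

Lemma herman_iterates : exists (r : R) (phi psi : C -> C) (c : C),
  [/\ 1 < r, cabs c = 1, analytic_homeomorphism H (annulus r) phi psi &
  forall x, H x -> H (G p x) /\ phi (G p x) = c * phi x].
Proof.
have [r [phi [psi [c [r1 c1 hom Hp]]]]] := herman_data.
exists r, phi, psi, c; split => // x Hx.
by have [y [fy Hy py]] := Hp x Hx; move: fy; rewrite (GE Hx) => -[->].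
Qed.

Lemma annulus_open (r : R) : open (@annulus R r).
Proof.
have -> : @annulus R r = (@cabs R @^-1` [set x : R | 1 < x]) `&` (@cabs R @^-1` [set x : R | x < r]).
  apply/seteqP; split => z; first by move=> /andP[].
  by move=> [/= z1 z2]; apply/andP.
by apply: openI; apply: open_comp; [by move=> z _; exact: continuous_cabs|exact: open_gt|
  by move=> z _; exact: continuous_cabs|exact: open_lt].
Qed.

(* x |-> f^k (F^-1 (f^(p-k) x)), with F = f^p on H, retracts W k onto f^k(H). *)
Lemma W_image k : (k <= p)%N -> W k = G k @` H.
Proof.
move=> kp; have [r [phi [psi [c [r1 c1 [h1 h2 h3 h4] Hp]]]]] := herman_iterates.
have c0 : c != 0 by rewrite -cabs_gt0 c1.
have kpk : (k + (p - k) <= p)%N by rewrite subnKC.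
have WH z : W k z -> H (G (p - k) z).
  by move=> Wz; have := W_iter kpk Wz; rewrite subnKC// W_p.
have Aphi x : H x -> annulus r (c^-1 * phi x).
  by move=> /h1[Ax _]; rewrite /annulus /= cabsM cabsV c1 invr1 mul1r.
pose rt z := G k (psi (c^-1 * phi (G (p - k) z))).
have rtG z : W k z -> (G k @` H) (rt z).
  by move=> /WH /Aphi /h2[Hz _]; exists (psi (c^-1 * phi (G (p - k) z))).
have rtid x : H x -> rt (G k x) = G k x.
  move=> Hx; rewrite /rt /G -iterD subnK// -/(G p x).
  by have [_ ->] := Hp x Hx; rewrite mulKf//; have [_ ->] := h1 x Hx.
have crt z : W k z -> {for z, continuous rt}.
  move=> Wz.
  have c2 := W_iter_continuous kpk Wz.
  have c3 : {for G (p - k) z, continuous phi} by apply/cderivable_continuous/h3/WH.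
  have c4 : {for c^-1 * phi (G (p - k) z), continuous psi}.
    have := h4; rewrite continuous_open_subspace; last exact: annulus_open.
    by apply; apply/mem_set/Aphi/WH.
  have Hpsi : H (psi (c^-1 * phi (G (p - k) z))) by have [] := h2 _ (Aphi _ (WH z Wz)).
  have c5 : {for psi (c^-1 * phi (G (p - k) z)), continuous (G k)}.
    by apply: (@W_iter_continuous 0 k); rewrite ?add0n// W_0.
  have c6 : {for z, continuous (fun x => c^-1 * phi (G (p - k) x))}.
    apply: contM; first exact: cst_continuous.
    exact: (continuous_comp c2 c3).
  exact: (continuous_comp (continuous_comp c6 c4) c5).
have GW : G k @` H `<=` W k by move=> _ [x Hx <-]; exact: W_iterH.
have cnW := fatou_component_connected (W_comp kp).
(* The image is open, and closed in the connected W k as the fixed-point set of the continuous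
   [rt]. *)
have E : W k `&` (G k @` H) = W k.
  apply: cnW.
  - by have [x Hx] := H0; exists (G k x); split; [exact: W_iterH|exists x].
  - by exists (G k @` H) => //; exact: G_image_open.
  - exists (closure (G k @` H)); first exact: closed_closure.
    apply/seteqP; split => z [Wz Hz]; split => //; first exact: subset_closure.
    suff <- : rt z = z by exact: rtG.
    apply/eqP; rewrite -subr_eq0 -cabs_eq0 eq_le cabs_ge0 andbT leNgt; apply/negP => d0.
    have d2 : 0 < cabs (rt z - z) / 2 by rewrite divr_gt0.
    have n1 := (continuous_cabsP _ _).1 (crt z Wz) _ d2.
    have [w [Gw [w1 w2]]] := Hz _ (filterI n1 (nbhs_cdisk z d2)).
    have rw : rt w = w by have [x Hx <-] := Gw; exact: rtid.
    rewrite rw in w1.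
    have := cabsD (rt z - w) (w - z); rewrite addrA subrK (cabsB (rt z) w).
    by move: w1 w2; move: (cabs (w - rt z)) (cabs (w - z)) (cabs (rt z - z)) => a b d; lra.
by apply/seteqP; split => z; [rewrite -E => -[]|exact: GW].
Qed.

(** Two components that meet coincide, and so do their successors. For i < j, after p - j steps H
    would recur at the index i + (p - j), strictly between 0 and p, against the minimality of p. *)
Lemma W_distinct i j : (i < p)%N -> (j < p)%N -> i <> j -> W i `&` W j = set0.
Proof.
move=> ip jp ij; apply/seteqP; split => // z [Wi Wj].
wlog lij : i j ip jp ij Wi Wj / (i < j)%N.
  move=> wl; have [ij'|ij'] := ltnP i j; first exact: (wl i j).
  apply: (wl j i) => //; first by move=> E; apply: ij.
  by rewrite ltn_neqAle ij' andbT; apply/eqP => E; apply: ij.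
have WE m : (j + m <= p)%N -> W (i + m) = W (j + m).
  elim: m => [_|m IH jmp].
    rewrite !addn0 (fatou_component_eq (W_comp (ltnW ip)) Wi).
    by rewrite (fatou_component_eq (W_comp (ltnW jp)) Wj).
  rewrite !addnS in jmp *.
  have imp : (i + m < p)%N by apply: leq_trans jmp; rewrite ltnS leq_add2r ltnW.
  have [y Wy] := fatou_component_nonempty (W_comp (ltnW jmp)).
  have Wy' : W (i + m) y by rewrite IH// ltnW.
  rewrite (fatou_component_eq (W_comp imp) (W_step imp Wy')).
  by rewrite (fatou_component_eq (W_comp jmp) (W_step jmp Wy)).
have := WE (p - j)%N; rewrite subnKC ?(ltnW jp)// => /(_ (leqnn p)); rewrite W_p => E.
have [_ _ _] := Hper; move=> /(_ (i + (p - j))%N); apply => //.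
by rewrite addn_gt0 subn_gt0 jp orbT /= addnC -ltn_subRL subKn// ltnW.
Qed.

(** The level of a point of W k is the normalised modulus of the point of H that it reaches after p
    - k further steps, so f preserves levels by construction. As the rotation preserves the modulus,
    the level of G k x is also that of x in H. *)
Lemma W_annulus_map : exists tau : nat -> C -> R, forall k, (k < p)%N ->
  annulus_map f (W k) (tau k) (W k.+1) (tau k.+1).
Proof.
have [r [phi [psi [c [r1 c1 [h1 h2 h3 h4] Hp]]]]] := herman_iterates.
have c0 : c != 0 by rewrite -cabs_gt0 c1.
have r10 : 0 < r - 1 by lra.
pose tau0 z := (cabs (phi z) - 1) / (r - 1).
pose tau k z := tau0 (G (p - k) z).
exists tau => k kp.
have tauG j x : (j <= p)%N -> H x -> tau j (G j x) = tau0 x.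
  move=> jp Hx; rewrite /tau /tau0 /G -iterD subnK// -/(G p x).
  by have [_ ->] := Hp x Hx; rewrite cabsM c1 mul1r.
have psiA x : annulus r x -> {for x, continuous psi}.
  move=> Ax; have := h4; rewrite continuous_open_subspace; last exact: annulus_open.
  by apply; exact: mem_set.
have ann j : (j <= p)%N -> annular (W j) (tau j).
  move=> jp.
  (* Pieces of W j cut out by levels are continuous images of round annuli, closed or open, and
     inherit their compactness or connectedness. *)
  have levels (P : R -> Prop) : W j `&` [set y | P (tau j y)] =
      (fun z => G j (psi z)) @` (annulus r `&` [set z | P ((cabs z - 1) / (r - 1))]).
    rewrite (W_image jp); apply/seteqP; split => y.
      move=> [[x Hx <-]] /=; rewrite (tauG j x jp Hx) => Px.
      have [Ax xE] := h1 x Hx.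
      by exists (phi x); [split|rewrite xE].
    move=> [z [Az Pz] <-]; have [Hz zE] := h2 z Az.
    by split; [exists (psi z)|rewrite /= (tauG j _ jp Hz) /tau0 zE].
  have cont (A : set C) : A `<=` annulus r ->
      {within A, continuous (fun z => G j (psi z))}.
    move=> AA; apply: continuous_in_subspaceT => z /set_mem /AA Az.
    apply: (continuous_comp (psiA z Az)); have [Hz _] := h2 z Az.
    by apply: (@W_iter_continuous 0 j); rewrite ?add0n// W_0.
  have tr (x s : R) : (x - 1) / (r - 1) = s <-> x = 1 + s * (r - 1).
    split=> [<-|->]; first by rewrite divfK ?gt_eqF//; lra.
    by rewrite addrAC subrr add0r mulfK// gt_eqF.
  have trlt (x s : R) : ((x - 1) / (r - 1) < s) = (x < 1 + s * (r - 1)).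
    by rewrite ltr_pdivrMr// ltrBlDl.
  have trgt (x s : R) : (s < (x - 1) / (r - 1)) = (1 + s * (r - 1) < x).
    by rewrite ltr_pdivlMr// ltrBrDl.
  split.
  - exact: fatou_component_open (W_comp jp).
  - exact: fatou_component_connected (W_comp jp).
  - rewrite (W_image jp) => _ [x Hx <-]; rewrite (tauG j x jp Hx) /tau0.
    have [/andP[a1 a2] _] := h1 x Hx.
    by rewrite divr_gt0 ?subr_gt0//= ltr_pdivrMr// mul1r ltrD2r.
  - move=> x Wx; have jpj : (j + (p - j) <= p)%N by rewrite subnKC.
    have c2 := W_iter_continuous jpj Wx.
    have Hx : H (G (p - j) x) by have := W_iter jpj Wx; rewrite subnKC// W_p.
    have c3 : {for G (p - j) x, continuous phi} by apply/cderivable_continuous/h3.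
    have c4 : {for x, continuous (fun z => cabs (phi (G (p - j) z)))}.
      by apply: cont_cabs; exact: (continuous_comp c2 c3).
    have c5 := continuousB c4 (@cst_continuous _ _ (1 : R) x).
    exact: (continuousM c5 (@cst_continuous _ _ ((r - 1)^-1 : R) x)).
  - move=> s t s0 t1; rewrite (levels (fun y => s <= y <= t)).
    have AE : annulus r `&` [set z | s <= (cabs z - 1) / (r - 1) <= t] =
        [set z : C | 1 + s * (r - 1) <= cabs z] `&` [set z | cabs z <= 1 + t * (r - 1)].
      apply/seteqP; split => z.
        by move=> [_ /= /andP[a1 a2]]; split => /=; rewrite leNgt -?trlt -?trgt -leNgt.
      move=> [/= a1 a2]; split.
        have s1 : 0 < s * (r - 1) by rewrite mulr_gt0.
        have s2 : t * (r - 1) < r - 1 by rewrite gtr_pMl.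
        by rewrite /annulus /=; apply/andP; split; lra.
      by apply/andP; split; rewrite leNgt ?trlt ?trgt -leNgt.
    apply: continuous_compact; first by apply: cont => z [].
    rewrite AE; apply: compactC.
      by apply: closedI; [apply: closed_geC|apply: closed_leC]; exact: continuous_cabs.
    by apply/bounded_cabs; exists (1 + t * (r - 1)) => z [].
  - move=> s /andP[s0 s1].
    have s2 : 0 < s * (r - 1) by rewrite mulr_gt0.
    have s3 : s * (r - 1) < r - 1 by rewrite gtr_pMl.
    pose z : C := ((1 + s * (r - 1))%:C)%C.
    have cz : cabs z = 1 + s * (r - 1) by rewrite cabs_real ger0_norm//; lra.
    have Az : annulus r z by apply/andP; rewrite cz; split; lra.
    have [Hz zE] := h2 z Az.
    exists (G j (psi z)); first exact: W_iterH.
    by rewrite (tauG j _ jp Hz) /tau0 zE; apply/tr.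
  - move=> s /andP[s0 s1]; rewrite (levels (fun y => y < s)).
    have s3 : s * (r - 1) < r - 1 by rewrite gtr_pMl.
    apply: connected_continuous_connected; last by apply: cont => z [].
    have -> : annulus r `&` [set z | (cabs z - 1) / (r - 1) < s] =
        [set z : C | 1 < cabs z < 1 + s * (r - 1)].
      apply/seteqP; split => z; rewrite /annulus /= trlt.
        by move=> [/andP[-> _] ->].
      by move=> /andP[a1 a2]; split => //; rewrite a1; lra.
    exact: round_annulus_connected.
  - move=> s /andP[s0 s1]; rewrite (levels (fun y => s < y)).
    have s3 : 0 < s * (r - 1) by rewrite mulr_gt0.
    apply: connected_continuous_connected; last by apply: cont => z [].
    have -> : annulus r `&` [set z | s < (cabs z - 1) / (r - 1)] =
        [set z : C | 1 + s * (r - 1) < cabs z < r].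
      apply/seteqP; split => z; rewrite /annulus /= trgt.
        by move=> [/andP[_ ->] ->].
      by move=> /andP[a1 a2]; split => //; rewrite a2 andbT; lra.
    by apply: round_annulus_connected; lra.
have kp' := ltnW kp.
split; [exact: ann|exact: ann| | |].
- move=> x Wx.
  have px := fatou_nonpole (fatou_component_sub (W_comp kp') Wx).
  exists (g x); split; [exact: nonpoleE|exact: W_step|].
  by rewrite /tau /G -(subnSK kp) iterSr.
- move=> x x'; rewrite (W_image kp') => -[y Hy <-] [y' Hy' <-] E.
  have gE : g (G k y) = g (G k y') by rewrite /finite_part E.
  have GpE : G p y = G p y'.
    rewrite /G -(subnK kp) !iterD; congr (iter _ _ _); exact: gE.
  have [_ e1] := Hp y Hy; have [_ e2] := Hp y' Hy'.
  have /(mulfI c0) pp : c * phi y = c * phi y' by rewrite -e1 -e2 GpE.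
  by have [_ <-] := h1 y Hy; have [_ <-] := h1 y' Hy'; rewrite pp.
- rewrite (W_image kp) => _ [x Hx <-]; exists (G k x); first exact: W_iterH.
  apply: nonpoleE; apply: fatou_nonpole.
  exact: (fatou_component_sub (W_comp kp') (W_iterH kp' Hx)).
Qed.

End Dynamics.

(** * Counting along the cycle *)

Section Counting.
Local Open Scope nat_scope.

(** Among n + 1 distinct naturals one is at least n; it is removed and the rest is handled by
    induction. *)
Lemma uniq_sumn (s : seq nat) : uniq s -> sumn (iota 0 (size s)) <= sumn s.
Proof.
move sz : (size s) => n; elim: n s sz => [//|n IH] s sz us.
have [m ms nm] : exists2 m, m \in s & n <= m.
  apply: contrapT => H.
  have : size s <= size (iota 0 n).
    apply: uniq_leq_size => // x xs; rewrite mem_iota /= add0n ltnNge.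
    by apply/negP => nx; apply: H; exists x.
  by rewrite sz size_iota ltnn.
rewrite -[in iota _ _]addn1 iotaD sumn_cat /= addn0 add0n.
have -> : sumn s = m + sumn (rem m s) by rewrite (perm_sumn (perm_to_rem ms)).
by rewrite addnC leq_add// IH ?rem_uniq// size_rem// sz.
Qed.

Lemma sumn_iota h : sumn (iota 0 h) * 2 = h * h.-1.
Proof.
elim: h => [//|h IH]; rewrite -[in iota _ _]addn1 iotaD sumn_cat /= addn0 add0n.
by rewrite mulnDl IH; case: h {IH} => //= h; rewrite -mulnDr mulnC addn2.
Qed.

(** The numbers t k - c are distinct naturals, with sum at least h(h - 1)/2, and h(c + 1) is added
    back. For c = 0 this is h(h + 1)/2, for c = 1 it is h(h + 3)/2. *)
Lemma sum_distinct (h c : nat) (t : nat -> nat) :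
  (forall k l, k < h -> l < h -> t k = t l -> k = l) ->
  (forall k, k < h -> c <= t k) ->
  (h * (h + 1 + c.*2)) %/ 2 <= sumn [seq (t k).+1 | k <- iota 0 h].
Proof.
move=> tinj tc.
have u : uniq [seq t k - c | k <- iota 0 h].
  rewrite map_inj_in_uniq ?iota_uniq// => k l; rewrite !mem_iota !add0n /= => kh lh E.
  by apply: tinj => //; rewrite -(subnK (tc k kh)) -(subnK (tc l lh)) E.
have := uniq_sumn u; rewrite size_map size_iota => le.
have -> : sumn [seq (t k).+1 | k <- iota 0 h] = sumn [seq t k - c | k <- iota 0 h] + h * c.+1.
  have : forall k, k \in iota 0 h -> c <= t k by move=> k; rewrite mem_iota add0n => /tc.
  rewrite -[X in _ + X * _](size_iota 0 h).
  elim: (iota 0 h) => [|k s IH] H /=; first by [].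
  rewrite IH; last by move=> l ls; apply: H; rewrite inE ls orbT.
  by rewrite mulSn addnACA; congr (_ + _); rewrite addnS subnK// H// inE eqxx.
apply: leq_trans (leq_add le (leqnn _)).
have -> : h * (h + 1 + c.*2) = (sumn (iota 0 h) + h * c.+1) * 2; last by rewrite mulnK.
rewrite mulnDl sumn_iota -mulnA -mulnDr; case: h {tinj tc u le} => //= n.
congr (_ * _); lia.
Qed.

Variable p : nat.
Hypothesis p_gt0 : 0 < p.

Definition nx i := i.+1 %% p.
Definition pr i := (i + p.-1) %% p.

Lemma nx_lt i : nx i < p. Proof. exact: ltn_pmod. Qed.
Lemma pr_lt i : pr i < p. Proof. exact: ltn_pmod. Qed.

Lemma nx_pr i : i < p -> nx (pr i) = i.
Proof.
by move=> ip; rewrite /nx /pr -addn1 modnDml -addnA addn1 prednK// modnDr modn_small.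
Qed.

Lemma pr_nx i : i < p -> pr (nx i) = i.
Proof.
by move=> ip; rewrite /nx /pr modnDml addSnnS prednK// modnDr modn_small.
Qed.

Lemma iter_pr_lt n i : i < p -> iter n pr i < p.
Proof. by case: n => [//|n] _; exact: pr_lt. Qed.

Lemma iter_nx_lt n i : i < p -> iter n nx i < p.
Proof. by case: n => [//|n] _; exact: nx_lt. Qed.

Lemma iter_nx_pr n i : i < p -> iter n nx (iter n pr i) = i.
Proof.
by move=> ip; elim: n => [//|n IH]; rewrite iterSr iterS nx_pr// iter_pr_lt.
Qed.

Lemma iter_pr_nx n m i : i < p -> m <= n -> iter m nx (iter n pr i) = iter (n - m) pr i.
Proof.
move=> ip mn; rewrite -{1}(subnKC mn) iterD iter_nx_pr// iter_pr_lt//.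
Qed.

Lemma iter_pr_p i : i < p -> iter p.-1 pr i = nx i.
Proof.
move=> ip; rewrite -{1}(pr_nx ip) -iterSr prednK//.
have prn n j : j < p -> iter n pr j = (j + n * p.-1) %% p.
  move=> jp; elim: n => [|n IH]; first by rewrite mul0n addn0 modn_small.
  by rewrite iterS IH /pr modnDml -addnA (addnC (n * _)) mulSn.
by rewrite prn ?nx_lt// addnC mulnC modnMDl modn_small ?nx_lt.
Qed.

Variables (h c : nat) (A P : nat -> Prop) (i_ : nat -> nat).
Hypothesis i_lt : forall k, k < h -> i_ k < p.
Hypothesis PA : forall i, i < p -> P i -> A (nx i).
Hypothesis Pi : forall k, k < h -> P (i_ k).

(** Later [A] means surrounding the omitted values and [P] surrounding a pole. The successor of i_k
    satisfies [A] and is reached after p - 1 steps back, so the search ends. *)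
Lemma last_return k : k < h -> exists t, A (iter t pr (i_ k)) /\
  forall s, s < t -> ~ A (iter s pr (i_ k)).
Proof.
move=> kh; have ex : exists t, `[< A (iter t pr (i_ k)) >].
  by exists p.-1; apply/asboolP; rewrite iter_pr_p ?i_lt//; apply: PA; [exact: i_lt|exact: Pi].
exists (ex_minn ex); case: ex_minnP => t /asboolP At mint; split => // s st As.
by have := mint s (asboolT As); rewrite leqNgt st.
Qed.

Variable t : nat -> nat.
Hypothesis tA : forall k, k < h -> A (iter (t k) pr (i_ k)).
Hypothesis tmin : forall k s, k < h -> s < t k -> ~ A (iter s pr (i_ k)).
Hypothesis tinj : forall k l, k < h -> l < h -> t k = t l -> k = l.
Hypothesis tc : forall k, k < h -> c <= t k.

(** Backward segments that meet continue together, so by minimality both reach [A] after the same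
    number of further steps. The shorter one then starts inside the longer one: i_k is at position
    s' - s > 0 of the segment of l, and its successor, one position earlier, satisfies [A] because
    i_k satisfies [P]. This is too early for t l. *)
Lemma segments_disjoint k l s s' : k < h -> l < h -> s <= t k -> s' <= t l ->
  iter s pr (i_ k) = iter s' pr (i_ l) -> t k < t l -> False.
Proof.
move=> kh lh sk sl E tkl.
have ik := i_lt kh; have il := i_lt lh.
have [e|e] : t k - s < t l - s' \/ t l - s' <= t k - s.
  by case: ltnP; [left|right].
  have : A (iter (s' + (t k - s)) pr (i_ l)).
    by rewrite addnC iterD -E -iterD subnK//; exact: tA.
  by apply: tmin => //; move: e sl; lia.
have : t l - s' = t k - s.
  apply/eqP; rewrite eqn_leq e /= leqNgt; apply/negP => e'.
  have : A (iter (s + (t l - s')) pr (i_ k)).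
    by rewrite addnC iterD E -iterD subnK//; exact: tA.
  by apply: tmin => //; move: e' sk; lia.
move=> e'; have ss' : s < s' by move: e' sk sl tkl; lia.
have ik' : i_ k = iter (s' - s) pr (i_ l).
  have := congr1 (iter s nx) E; rewrite iter_nx_pr// iter_pr_nx//; exact: ltnW.
have := PA ik (Pi kh); rewrite ik'.
have -> : nx (iter (s' - s) pr (i_ l)) = iter (s' - s).-1 pr (i_ l).
  by have := @iter_pr_nx (s' - s) 1 (i_ l) il; rewrite /= subn1; apply; rewrite subn_gt0.
by apply: tmin => //; move: ss' sl; lia.
Qed.

Theorem cycle_length : (h * (h + 1 + c.*2)) %/ 2 <= p.
Proof.
apply: leq_trans (sum_distinct tinj tc) _.
pose s := [seq iter m pr (i_ k) | k <- iota 0 h, m <- iota 0 (t k).+1].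
have inh k : k \in iota 0 h -> k < h by rewrite mem_iota add0n.
have inm k m : m \in iota 0 (t k).+1 -> m <= t k by rewrite mem_iota add0n ltnS.
have -> : sumn [seq (t k).+1 | k <- iota 0 h] = size s.
  rewrite size_allpairs_dep; congr sumn; apply: eq_map => k.
  by rewrite size_iota.
have <- : size (iota 0 p) = p by rewrite size_iota.
apply: uniq_leq_size; last first.
  move=> x /allpairsPdep[k [m [/inh kh _ ->]]].
  by rewrite mem_iota add0n /= iter_pr_lt// i_lt.
apply: allpairs_uniq_dep; first exact: iota_uniq.
  by move=> k _; exact: iota_uniq.
move=> x y /allpairsPdep[k [m [/inh kh /inm mk ->]]] /allpairsPdep[l [n [/inh lh /inm nl ->]]] /= E.
have [kl|lk|kl] := ltngtP (t k) (t l).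
- by exfalso; exact: (segments_disjoint kh lh mk nl E).
- by exfalso; exact: (segments_disjoint lh kh nl mk (esym E)).
have kl' := tinj kh lh kl; subst l.
suff -> : m = n by [].
have key a b : a <= t k -> b <= t k -> iter a pr (i_ k) = iter b pr (i_ k) -> a < b -> False.
  move=> ak bk E' ab.
  have : A (iter (a + (t k - b)) pr (i_ k)).
    by rewrite addnC iterD E' -iterD subnK//; exact: tA.
  by apply: tmin => //; move: ab bk; lia.
have [mn|nm|//] := ltngtP m n; first by exfalso; exact: (key m n).
by exfalso; exact: (key n m).
Qed.

End Counting.

(** * Nests *)

Section Nests.
Variable R : realType.
Local Notation C := (Cplx R).
Local Notation Chat := (Csphere R).
Variable f : C -> Chat.
Hypothesis merof : meromorphic f.

Lemma surroundsP (V A : set C) : surrounds V A <-> exists2 B, hole V B & A `<=` B.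
Proof.
split; first by move=> [B [cB /bounded_cabs bB AB]]; exists B.
by move=> [B [cB bB] AB]; exists B; split => //; apply/bounded_cabs.
Qed.

Lemma filled_exists (V B : set C) tau : annular V tau -> hole V B ->
  exists tau', filled V tau' B.
Proof. by move=> aV hB; have [] := ends aV hB; [exists tau|exists (flip tau)]. Qed.

Lemma annulus_map_filled V tau W tau' B : annulus_map f V tau W tau' -> hole V B ->
  exists t t', annulus_map f V t W t' /\ filled V t B.
Proof.
move=> am hB; have [fil|fil] := ends (am_ann am) hB; first by exists tau, tau'.
by exists (flip tau), (flip tau'); split => //; exact: annulus_map_flip.
Qed.

(** If W does not meet B, it misses the connected filled ring B + V, which meets B' at x and
    therefore lies in the component B'. *)
Lemma annuli_nested (V W B B' : set C) tau tau' x : annular V tau -> annular W tau' ->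
  V `&` W = set0 -> hole V B -> hole W B' -> B x -> B' x -> W `<=` B \/ V `<=` B'.
Proof.
move=> aV aW VW hB hB' Bx B'x.
have WV : W `<=` ~` V by move=> z Wz Vz; exact: (set0_absurd VW (conj Vz Wz)).
have [WB|WB] := pselect (W `&` B !=set0).
  by left; apply: (hole_max hB (ann_conn aW) WV).
right; have [t fil] := filled_exists aV hB.
have DW : B `|` V `<=` ~` W.
  move=> z [Bz|Vz] Wz; first by apply: WB; exists z.
  exact: (set0_absurd VW (conj Vz Wz)).
have DB' : B `|` V `<=` B'.
  by apply: (hole_max hB' (fil_connV fil) DW); exists x; split => //; left.
by move=> z Vz; apply: DB'; right.
Qed.

(** If V met B', each ring would lie in the hole of the other, and the union of the holes would be
    bounded, open and closed. Otherwise the connected filled ring B' + W avoids V and meets B. *)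
Lemma annuli_hole_sub (V W B B' : set C) tau tau' : annular V tau -> annular W tau' ->
  V `&` W = set0 -> hole V B -> hole W B' -> W `<=` B -> B' `<=` B.
Proof.
move=> aV aW VW hB hB' WB.
have [t fil] := filled_exists aV hB; have [t' fil'] := filled_exists aW hB'.
have VW' : V `<=` ~` W by move=> z Vz Wz; exact: (set0_absurd VW (conj Vz Wz)).
have [VB|VB] := pselect (V `&` B' !=set0).
  have VB' : V `<=` B' by apply: (hole_max hB' (ann_conn aV) VW').
  exfalso; have E : B `|` B' = set0.
    apply: bdd_clopen_set0.
    - exact: bddU hB.2 hB'.2.
    - have -> : B `|` B' = (B `|` V) `|` (B' `|` W).
        apply/seteqP; split => z.
          by move=> [Bz|Bz]; [left; left|right; left].
        by move=> [[Bz|/VB' Bz]|[Bz|/WB Bz]]; [left|right|right|left].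
      by apply: openU; [exact: (fil_openV fil)|exact: (fil_openV fil')].
    - apply: closedU; [exact: hole_closed (ann_open aV) hB|exact: hole_closed (ann_open aW) hB'].
  have [b Bb] := hole_nonempty hB.
  by apply: (set0_absurd E (x := b)); left.
have DV : B' `|` W `<=` ~` V.
  by move=> z [Bz|Wz] Vz; [apply: VB; exists z|exact: VW' Vz Wz].
have s01 : 0 < (1 / 2 : R) < 1 by lra.
have [w Ww _] := ann_onto aW s01.
have DB : B' `|` W `<=` B.
  by apply: (hole_max hB (fil_connV fil') DV); exists w; split; [right|exact: WB].
by move=> z B'z; apply: DB; left.
Qed.

Variables (p : nat) (H : set C) (a : C).
Hypothesis Hherman : herman_ring f p H.
Hypothesis oma : omitted f (Some a).

Let W k := component_iter f H k.
Let p_gt0 : (0 < p)%N. Proof. by case: Hherman => -[]. Qed.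

Definition around (k : nat) : Prop :=
  exists2 B, hole (W k) B & Some @^-1` omitted f `<=` B.
Definition has_pole (k : nat) : Prop :=
  exists B w, [/\ hole (W k) B, B w & is_pole f w].

Let W_nx k : (k < p)%N -> W (nx p k) = W k.+1.
Proof.
move=> kp; rewrite /nx; move: kp; rewrite leq_eqVlt => /orP[/eqP kp|kp]; last by rewrite modn_small.
have [[cH _ Wp _] _] := Hherman.
by rewrite kp modnn /W Wp (W_0 Hherman).
Qed.

Let am k : (k < p)%N -> exists tau tau', annulus_map f (W k) tau (W (nx p k)) tau'.
Proof.
move=> kp; have [tau Htau] := W_annulus_map merof Hherman.
by exists (tau k), (tau k.+1); rewrite W_nx//; exact: Htau.
Qed.

Let annW k : (k < p)%N -> exists tau, annular (W k) tau.
Proof. by move=> /am[tau [tau' /am_ann h]]; exists tau. Qed.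

Lemma pole_around k : (k < p)%N -> has_pole k -> around (nx p k).
Proof.
move=> kp [B [w [hB Bw pw]]]; have [t0 [t0' am0]] := am kp.
have [t [t' [am1 fil]]] := annulus_map_filled am0 hB.
have ho := omitted_hole merof am1 fil oma Bw pw.
exists (connected_component (~` W (nx p k)) a) => // a' /= oma'.
have ho' := omitted_hole merof am1 fil oma' Bw pw.
rewrite (hole_unique (am_ann' am1) ho ho').
by apply: connected_component_refl; exact: (omitted_notW am1 oma').
Qed.

(** The hole is mapped into the filled next ring; the image of an inner ring is a different ring,
    disjoint from that next ring, so it can only lie in the hole. *)
Lemma polefree_step k B : (k < p)%N -> hole (W k) B -> ~ has_pole k ->
  exists2 B', hole (W (nx p k)) B' &
    forall j, (j < p)%N -> j <> k -> W j `<=` B -> W (nx p j) `<=` B'.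
Proof.
move=> kp hB np; have [t0 [t0' am0]] := am kp.
have [t [t' [am1 fil]]] := annulus_map_filled am0 hB.
have npB z : B z -> ~ is_pole f z by move=> Bz pz; apply: np; exists B, z.
have [B' [hB' _ fB]] := polefree_hole merof am1 fil npB.
exists B' => // j jp jk WB y Wy.
have [s0 [s0' amj]] := am jp; have [x Wx fx] := am_onto amj Wy.
have [Wky|//] := fB x y (WB x Wx) fx.
exfalso; have njk : nx p j <> nx p k.
  by move=> E; apply: jk; rewrite -(pr_nx p_gt0 jp) E pr_nx.
exact: (set0_absurd (W_distinct merof Hherman (nx_lt p_gt0 j) (nx_lt p_gt0 k) njk) (conj Wy Wky)).
Qed.

Lemma one_pole k B w1 w2 : (k < p)%N -> hole (W k) B -> B w1 -> B w2 ->
  is_pole f w1 -> is_pole f w2 -> w1 = w2.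
Proof.
move=> kp hB; have [t0 [t0' am0]] := am kp.
have [t [t' [am1 fil]]] := annulus_map_filled am0 hB.
exact: (hole_one_pole merof am1 fil oma).
Qed.

Lemma hole_eq k B B' : (k < p)%N -> hole (W k) B -> hole (W k) B' -> B = B'.
Proof. by move=> /annW[t aW]; exact: hole_unique aW. Qed.

Lemma nested_rings j k B B' x : (j < p)%N -> (k < p)%N -> j <> k ->
  hole (W j) B -> hole (W k) B' -> B x -> B' x -> W k `<=` B \/ W j `<=` B'.
Proof.
move=> jp kp jk; have [t aj] := annW jp; have [t' ak] := annW kp.
exact: (annuli_nested aj ak (W_distinct merof Hherman jp kp jk)).
Qed.

Lemma nested_holes j k B B' : (j < p)%N -> (k < p)%N -> j <> k ->
  hole (W j) B -> hole (W k) B' -> W k `<=` B -> B' `<=` B.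
Proof.
move=> jp kp jk; have [t aj] := annW jp; have [t' ak] := annW kp.
exact: (annuli_hole_sub aj ak (W_distinct merof Hherman jp kp jk)).
Qed.

Lemma nesting_transported j l t B : (j < p)%N -> (l < p)%N -> j <> l ->
  hole (W j) B -> W l `<=` B ->
  (forall s, (s < t)%N -> ~ has_pole (iter s (nx p) j)) ->
  exists2 B', hole (W (iter t (nx p) j)) B' & W (iter t (nx p) l) `<=` B'.
Proof.
move=> jp lp jl hB WB; elim: t => [|t IH] np; first by exists B.
have [|B' hB' WB'] := IH; first by move=> s st; apply: np; exact: ltnW.
have jt := @iter_nx_lt p p_gt0 t _ jp; have lt := @iter_nx_lt p p_gt0 t _ lp.
have jlt : iter t (nx p) l <> iter t (nx p) j.
  elim: (t) => [|n IHn]; first by move=> E; exact: jl.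
  rewrite !iterS => E; apply: IHn.
  by rewrite -(pr_nx p_gt0 (@iter_nx_lt p p_gt0 n _ lp)) E pr_nx// iter_nx_lt.
have [B'' hB'' H''] := polefree_step jt hB' (np t (ltnSn t)).
by exists B''; rewrite ?iterS //; exact: H''.
Qed.

Variables (h : nat) (w_ : nat -> C) (i_ : nat -> nat).
Hypothesis w_inj : forall k l, (k < h)%N -> (l < h)%N -> w_ k = w_ l -> k = l.
Hypothesis i_lt : forall k, (k < h)%N -> (i_ k < p)%N.
Hypothesis w_pole : forall k, (k < h)%N -> is_pole f (w_ k).
Hypothesis w_in : forall k, (k < h)%N -> exists2 B, hole (W (i_ k)) B & B (w_ k).

Let w_has k : (k < h)%N -> has_pole (i_ k).
Proof. by move=> kh; have [B hB Bw] := w_in kh; exists B, (w_ k); split => //; exact: w_pole. Qed.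

Let i_inj k l : (k < h)%N -> (l < h)%N -> i_ k = i_ l -> k = l.
Proof.
move=> kh lh E; apply: w_inj => //.
have [B hB Bw] := w_in kh; have [B' hB' B'w] := w_in lh.
rewrite -E in hB'; rewrite (hole_eq (i_lt kh) hB' hB) in B'w.
exact: (one_pole (i_lt kh) hB Bw B'w (w_pole kh) (w_pole lh)).
Qed.

(** The parameter c selects the bound: for c = 0 the first hypothesis holds trivially; for c = 1 it
    says that no ring surrounds both a pole and the omitted values, which makes every t_k
    positive. *)
Theorem period_bound (c : nat) :
  (forall k, (k < p)%N -> around k -> has_pole k -> c = 0%N) -> (c <= 1)%N ->
  ((h * (h + 1 + c.*2)) %/ 2 <= p)%N.
Proof.
move=> Hc c1.
have LR := last_return p_gt0 i_lt pole_around w_has.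
have [t Ht] : exists t : nat -> nat, forall k, (k < h)%N ->
    around (iter (t k) (pr p) (i_ k)) /\
    forall s, (s < t k)%N -> ~ around (iter s (pr p) (i_ k)).
  have S k : {t | (k < h)%N -> around (iter t (pr p) (i_ k)) /\
      forall s, (s < t)%N -> ~ around (iter s (pr p) (i_ k))}.
    apply: cid; have [kh|kh] := ltnP k h; last by exists 0%N.
    by have [t Ht] := LR k kh; exists t.
  by exists (fun k => sval (S k)) => k kh; exact: (svalP (S k) kh).
apply: (@cycle_length p p_gt0 h c around has_pole i_ i_lt pole_around w_has t).
- by move=> k kh; have [] := Ht k kh.
- by move=> k s kh; have [_] := Ht k kh; apply.
(* If t_k = t_l, the two rings reached both surround a and are nested. Going forward again, the
   outer one meets no pole before the last ring, as its successor would surround the omitted values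
   too early. So one of the rings i_k, i_l is inside the hole of the other, which then contains both
   poles. *)
- move=> k l kh lh E; apply: contrapT => kl.
  have np m s : (m < h)%N -> (s < t m)%N ->
      ~ has_pole (iter s (nx p) (iter (t m) (pr p) (i_ m))).
    move=> mh st; rewrite (iter_pr_nx p_gt0 (i_lt mh) (ltnW st)) => hp.
    have mlt := @iter_pr_lt p p_gt0 (t m - s) _ (i_lt mh).
    have := pole_around mlt hp.
    have -> : nx p (iter (t m - s) (pr p) (i_ m)) = iter (t m - s).-1 (pr p) (i_ m).
      have := @iter_pr_nx p p_gt0 (t m - s) 1 (i_ m) (i_lt mh).
      by rewrite /= subn1; apply; rewrite subn_gt0.
    by have [_] := Ht m mh; apply; move: st; lia.
  have jl : iter (t k) (pr p) (i_ k) <> iter (t l) (pr p) (i_ l).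
    move=> jE; apply: kl; apply: i_inj => //.
    by rewrite -(@iter_nx_pr p p_gt0 (t k) _ (i_lt kh)) jE E iter_nx_pr ?i_lt.
  have main m n : (m < h)%N -> (n < h)%N -> t m = t n -> m <> n ->
     iter (t m) (pr p) (i_ m) <> iter (t n) (pr p) (i_ n) ->
     forall B, hole (W (iter (t m) (pr p) (i_ m))) B ->
     W (iter (t n) (pr p) (i_ n)) `<=` B -> False.
    move=> mh nh tE mn jE B hB WB.
    have mlt := @iter_pr_lt p p_gt0 (t m) _ (i_lt mh).
    have nlt := @iter_pr_lt p p_gt0 (t n) _ (i_lt nh).
    have [B' hB' WB'] := nesting_transported mlt nlt jE hB WB (fun s => np m s mh).
    rewrite iter_nx_pr ?i_lt// in hB'.
    rewrite tE iter_nx_pr ?i_lt// in WB'.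
    have imn : i_ m <> i_ n by move=> e; apply: mn; exact: i_inj.
    have [Bm hBm Bmw] := w_in mh; have [Bn hBn Bnw] := w_in nh.
    have BB := nested_holes (i_lt mh) (i_lt nh) imn hB' hBn WB'.
    rewrite (hole_eq (i_lt mh) hBm hB') in Bmw.
    apply: mn; apply: w_inj => //.
    exact: (one_pole (i_lt mh) hB' Bmw (BB _ Bnw) (w_pole mh) (w_pole nh)).
  have [[B hB oB] _] := Ht k kh; have [[B' hB' oB'] _] := Ht l lh.
  have klt := @iter_pr_lt p p_gt0 (t k) _ (i_lt kh).
  have llt := @iter_pr_lt p p_gt0 (t l) _ (i_lt lh).
  have [WB|WB] := nested_rings klt llt jl hB hB' (oB a oma) (oB' a oma).
    exact: (main k l kh lh E kl jl B hB WB).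
  by apply: (main l k lh kh (esym E) _ _ B' hB' WB) => e; [apply: kl|apply: jl].
- move=> k kh; have [[B hB oB] _] := Ht k kh.
  case: c Hc c1 => [//|[|//]] Hc _; rewrite lt0n; apply/eqP => t0.
  have := Hc (i_ k) (i_lt kh) _ (w_has kh); suff ar : around (i_ k) by move=> /(_ ar).
  by have [+ _] := Ht k kh; rewrite t0.
Qed.

End Nests.

Local Close Scope ring_scope.
Local Open Scope nat_scope.

Theorem theorem3p5 (R : realType) (f : Cplx R -> Csphere R)
    (p h : nat) (H : set (Cplx R))
    (f_Mo : class_Mo f)
    (H_herman : herman_ring f p H)
    (p_gt2 : 2 < p)
    (h_card : (relevant_pole f p H #= `I_h)%card) :
  (h * (h + 1)) %/ 2 <= p /\
  (forall N : set (set (Cplx R)), basic_nest f p H N ->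
     (nest_surrounds_pole f p H N -> (h * (h + 1)) %/ 2 <= p) /\
     (~ nest_surrounds_pole f p H N -> (h * (h + 3)) %/ 2 <= p)).
Proof.
have [[[merof _] poles] [[a|] oma]] := f_Mo; last first.
  by exfalso; case: poles => [[z [_ [_ pz _]]]|[z [pz _ _]]]; exact: oma pz.
move: h_card; rewrite card_eq_sym => /card_set_bijP[w_ [wfun winj _]].
have w_rel k : k < h -> relevant_pole f p H (w_ k) by move=> kh; exact: (wfun k kh).
have w_inj k l : k < h -> l < h -> w_ k = w_ l -> k = l.
  by move=> kh lh E; apply: winj => //; exact/mem_set.
have [i_ Hi] : exists i_ : nat -> nat, forall k, k < h ->
    i_ k < p /\ exists2 B, hole (component_iter f H (i_ k)) B & B (w_ k).
  have S k : {i | k < h -> i < p /\ exists2 B, hole (component_iter f H i) B & B (w_ k)}.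
    apply: cid; have [kh|kh] := ltnP k h; last by exists 0.
    have [_ [_ [i ip <-] /surroundsP[B hB wB]]] := w_rel k kh.
    by exists i => _; split => //; exists B => //; exact: wB.
  by exists (fun k => sval (S k)) => k kh; exact: (svalP (S k) kh).
have i_lt k : k < h -> i_ k < p by move=> /Hi[].
have w_in k : k < h -> exists2 B, hole (component_iter f H (i_ k)) B & B (w_ k).
  by move=> /Hi[].
have w_pole k : k < h -> is_pole f (w_ k) by move=> /w_rel[].
have bound := period_bound merof H_herman oma w_inj i_lt w_pole w_in.
have b0 : (h * (h + 1)) %/ 2 <= p.
  by have := bound 0 (fun _ _ _ _ => erefl) isT; rewrite addn0.
split => // N [_ [V [NV outV /surroundsP[BV hBV oV]]]]; split => // nopole.
have b1 : (h * (h + 1 + 1.*2)) %/ 2 <= p; last by move: b1; rewrite -addnA.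
(* A ring surrounding both the omitted values and a pole is nested with the outermost ring V of the
   basic nest, as both holes contain a. It equals V or lies inside it, since V is outermost; either
   way V surrounds its pole. *)
apply: bound => // k kp [B hB oB] [B1 [w [hB1 B1w pw]]]; exfalso; apply: nopole.
rewrite (hole_eq merof H_herman kp hB1 hB) in B1w.
have [[m mp VE] outer] := outV.
exists w => //; exists V; split => //; apply/surroundsP; exists BV => // _ ->.
rewrite -VE in hBV; have [mk|mk] := eqVneq m k.
  by rewrite -mk in hB; rewrite (hole_eq merof H_herman mp hBV hB).
have {}mk : m <> k by apply/eqP.
have VK : component_iter f H k <> V.
  move=> E; have dis := W_distinct merof H_herman mp kp mk.
  have [t /(_ m mp) amm] := W_annulus_map merof H_herman.
  have s01 : (0 < (1 / 2 : R) < 1)%R by lra.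
  have [x Vx _] := ann_onto (am_ann amm) s01.
  by apply: (set0_absurd dis (x := x)); split => //; rewrite E -VE.
have [WB|WB] := nested_rings merof H_herman mp kp mk hBV hB (oV a oma) (oB a oma).
  exact: (nested_holes merof H_herman mp kp mk hBV hB WB).
exfalso; apply: (outer (component_iter f H k)) => //; first by exists k.
by apply/surroundsP; exists B => //; rewrite -VE.
Qed.
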